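(* For every constant $\varepsilon>0$ there is a randomized algorithm which, given a set $S$ of $n$ points in $\mathbb{R}^3$ and a point $y\in\mathbb{R}^3$, returns two points $a,b\in S$ such that the Euclidean distance from $y$ to the line through $a$ and $b$ is at most $(1+\varepsilon)$ times the minimum, over all pairs of distinct points $a',b'\in S$, of the distance from $y$ to the line through $a'$ and $b'$. With high probability the algorithm runs in time $O_{\varepsilon}(n\log^3 n)$.
   Context: This is the nearest induced line problem in $\mathbb{R}^3$. The distance from a point to a line is the Euclidean distance to the closest point of the line. $O_\varepsilon$ hides factors depending only on $\varepsilon$. *)

(* Defs.v *)
From mathcomp Require Import all_boot all_order all_algebra.
From mathcomp Require Import all_classical all_reals all_analysis.
Set Implicit Arguments.
Unset Strict Implicit.
Unset Printing Implicit Defensive.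
Import Order.TTheory GRing.Theory Num.Theory.
Local Open Scope classical_set_scope.
Local Open Scope ring_scope.

(** * Distance to the nearest induced line *)

(* The norm `|x| that MathComp-Analysis puts on 'rV[R]_d is the sup norm, so
   the Euclidean one is defined here. *)
Definition eucl_norm (R : realType) (d : nat) (x : 'rV[R]_d) : R :=
  Num.sqrt (\sum_(i < d) x 0 i ^+ 2).

Definition line (R : realType) (d : nat) (a b : 'rV[R]_d) : set 'rV[R]_d :=
  [set a + t *: (b - a) | t in [set: R]].

Definition line_dist (R : realType) (d : nat) (y a b : 'rV[R]_d) : R :=
  inf [set eucl_norm (y - z) | z in line a b].

(* The infimum is over a finite set, nonempty as soon as S has two distinct
   points, so it is then a minimum. *)
Definition nearest_line_dist (R : realType) (d : nat) (y : 'rV[R]_d)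
    (S : seq 'rV[R]_d) : R :=
  inf [set r | exists a b, [/\ a \in S, b \in S, a != b & r = line_dist y a b]].

(** * The randomized real RAM *)

(* The machine has two banks of cells, both addressed by natural numbers: word
   cells hold integers in [0, 2 ^ w), where w is the word length, and real
   cells hold exact real numbers.  Programs are structured, with finitely many
   constants.  Every primitive instruction, every evaluation of a test and
   every unfolding of a sequence takes one unit of time.  There is no rounding,
   floor, or other conversion from reals to words; addresses are words or
   constants of the program.  Dividing a real by 0 gives 0. *)

Inductive operand :=
| Direct of nat     (* the cell with the given address *)
| Indirect of nat.  (* the cell whose address is stored in the given word cell *)

Inductive word_op := WAdd | WSub | WMul | WDiv | WMod.
Inductive real_op := RAdd | RSub | RMul | RDiv.

Inductive instr :=
| WConst of operand & nat
| WMove of operand & operand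
| WBin of word_op & operand & operand & operand
| WRand of operand & operand
    (* WRand d s: d receives a uniform element of {0, ..., k - 1}, k being the
       content of s *)
| RConst of operand & rat
| RMove of operand & operand
| RBin of real_op & operand & operand & operand
| ROfWord of operand & operand.

Inductive test :=
| WEq of operand & operand
| WLt of operand & operand
| REq of operand & operand
| RLt of operand & operand.

Inductive program :=
| PInstr of instr
| PSeq of program & program
| PIf of test & program & program
| PWhile of test & program.

Record memory (R : realType) := Memory {
  words : nat -> nat;
  reals : nat -> R }.

(* The programs that remain to be executed, and the memory. *)
Definition config (R : realType) : Type := (seq program * memory R)%type.

Section Semantics.
Variables (R : realType) (w : nat).
Implicit Types (m : memory R) (o : operand).

Definition address m o : nat :=
  match o with Direct a => a | Indirect a => words m a end.

Definition get_word m o : nat := words m (address m o).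
Definition get_real m o : R := reals m (address m o).

Definition update (T : Type) (f : nat -> T) (a : nat) (v : T) : nat -> T :=
  fun x => if x == a then v else f x.

(* Writing returns the list of possible resulting memories: overflow of a word
   yields the empty list, and then the machine is stuck. *)
Definition set_word m o (v : nat) : seq (memory R) :=
  if (v < 2 ^ w)%N then [:: Memory (update (words m) (address m o) v) (reals m)]
  else [::].

Definition set_real m o (v : R) : seq (memory R) :=
  [:: Memory (words m) (update (reals m) (address m o) v)].

Definition eval_word_op (op : word_op) (x y : nat) : nat :=
  match op with
  | WAdd => x + y | WSub => x - y | WMul => x * y
  | WDiv => x %/ y | WMod => x %% y
  end%N.

Definition eval_real_op (op : real_op) (x y : R) : R :=
  match op with
  | RAdd => x + y | RSub => x - y | RMul => x * y | RDiv => x / y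
  end.

Definition eval_test m (t : test) : bool :=
  match t with
  | WEq o1 o2 => get_word m o1 == get_word m o2
  | WLt o1 o2 => (get_word m o1 < get_word m o2)%N
  | REq o1 o2 => get_real m o1 == get_real m o2
  | RLt o1 o2 => get_real m o1 < get_real m o2
  end.

Definition exec_instr m (i : instr) : seq (memory R) :=
  match i with
  | WConst d k => set_word m d k
  | WMove d s => set_word m d (get_word m s)
  | WBin op d s1 s2 =>
      set_word m d (eval_word_op op (get_word m s1) (get_word m s2))
  | WRand d s => flatten [seq set_word m d k | k <- iota 0 (get_word m s)]
  | RConst d q => set_real m d (ratr q)
  | RMove d s => set_real m d (get_real m s)
  | RBin op d s1 s2 =>
      set_real m d (eval_real_op op (get_real m s1) (get_real m s2))
  | ROfWord d s => set_real m d (get_word m s)%:R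
  end.

(* The list of the equally likely successors of a configuration, with
   multiplicity.  It is empty if the machine has halted (nothing remains to be
   executed) or is stuck. *)
Definition step (c : config R) : seq (config R) :=
  match c with
  | ([::], _) => [::]
  | (PInstr i :: k, m) => [seq (k, m') | m' <- exec_instr m i]
  | (PSeq p q :: k, m) => [:: (p :: q :: k, m)]
  | (PIf t p q :: k, m) => [:: ((if eval_test m t then p else q) :: k, m)]
  | (PWhile t p :: k, m) =>
      [:: (if eval_test m t then p :: PWhile t p :: k else k, m)]
  end.

(* The probability that, started from c, the machine halts within time t in a
   memory satisfying Q. *)
Fixpoint halt_prob (Q : memory R -> Prop) (t : nat) (c : config R) : R :=
  if c.1 is [::] then (`[< Q c.2 >])%:R
  else if t is t'.+1 then
    (\sum_(c' <- step c) halt_prob Q t' c') / (size (step c))%:R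
  else 0.

End Semantics.

(** * Nearest induced line as a computational problem *)

(* Initially word cell 0 contains n = size S, and the real cells contain the
   three coordinates of y, followed by those of the points of S, in order; all
   other cells contain 0. *)
Definition input (R : realType) (y : 'rV[R]_3) (S : seq 'rV[R]_3) : memory R :=
  Memory (fun a => if a is 0%N then size S else 0%N)
         (fun a => (nth 0 (y :: S) (a %/ 3)) 0 (inord (a %% 3))).

(* Word cells 0 and 1 finally contain the positions in S of two points. *)
Definition approx_nearest_line (R : realType) (eps : R) (y : 'rV[R]_3)
    (S : seq 'rV[R]_3) (m : memory R) : Prop :=
  let a := nth 0 S (words m 0) in
  let b := nth 0 S (words m 1) in
  [/\ (words m 0 < size S)%N, (words m 1 < size S)%N, a != b &
      line_dist y a b <= (1 + eps) * nearest_line_dist y S].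

(* Words have length kappa * log2 n, for a constant kappa. *)
Definition word_length (kappa n : nat) : nat := (kappa * up_log 2 n)%N.

Definition prob_halts_with (R : realType) (P : program) (kappa : nat)
    (y : 'rV[R]_3) (S : seq 'rV[R]_3) (Q : memory R -> Prop) (t : nat) : R :=
  halt_prob (word_length kappa (size S)) Q t ([:: P], input y S).

(* Main.v *)
Require Import Defs.
From mathcomp Require Import all_boot all_order all_algebra.
From mathcomp Require Import all_classical all_reals all_analysis.
From mathcomp Require Import ring lra zify.
Set Implicit Arguments.
Unset Strict Implicit.
Unset Printing Implicit Defensive.
Import Order.TTheory GRing.Theory Num.Theory.
Import numFieldNormedType.Exports.
Local Open Scope classical_set_scope.
Local Open Scope ring_scope.

(* Take y as the origin.  Points a and b span a line at distance at least d from
   the origin if and only if some vector w with |w| <= 1 satisfies w.a = w.b = d.  In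
   a chart (1, p) of the directions, with f(a) = d / x(a), this reads
   w.(1, p(a)) = f(a) and w.(1, p(b)) = f(b): it bounds the slope of f between p(a)
   and p(b).  A distance bound that holds on the edges of a (1 + e)-spanner of the
   points p of a small cell thus carries over, up to a factor 1 + O(e), to all pairs
   of that cell, and the edges of a theta graph, found by sweeping each of O(1/e)
   cones, suffice.  For two points a, b in distant directions, convexity in f shows
   that b may be replaced by one of the two points that minimize and maximize 1/x in
   a small cell of directions around b.  The candidate pairs are thus O(n log n) in
   number for fixed e, and they are examined deterministically in time O(n log n):
   sorting and dominance searching are done with tournament trees. *)

(** * Runs of the machine *)

Definition halts (R : realType) (w : nat) (P : program) (m m' : memory R)
    (t : nat) : Prop :=
  forall k Q T, halt_prob w Q (t + T) (P :: k, m) = halt_prob w Q T (k, m').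

Section Halts.
Variables (R : realType) (w : nat).
Implicit Types (m : memory R) (P : program) (k : seq program).

Lemma halt_prob_step Q T (c c' : config R) : c.1 <> [::] -> step w c = [:: c'] ->
  halt_prob w Q T.+1 c = halt_prob w Q T c'.
Proof.
case: c => [[|p k] m] //= _ ->.
by rewrite big_cons big_nil addr0 divr1.
Qed.

Lemma halts_instr i m m' : exec_instr w m i = [:: m'] ->
  halts w (PInstr i) m m' 1.
Proof. by move=> h k Q T; rewrite add1n; apply: halt_prob_step => //=; rewrite h. Qed.

Lemma halts_seq P P' m m' m'' t t' : halts w P m m' t -> halts w P' m' m'' t' ->
  halts w (PSeq P P') m m'' (t + t').+1.
Proof.
move=> h h' k Q T; rewrite addSn (@halt_prob_step _ _ _ (P :: P' :: k, m)) //.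
by rewrite -addnA h h'.
Qed.

Lemma halts_if tst P P' m m' t :
  halts w (if eval_test m tst then P else P') m m' t ->
  halts w (PIf tst P P') m m' t.+1.
Proof.
move=> h k Q T.
by rewrite addSn (@halt_prob_step _ _ _ ((if eval_test m tst then P else P') :: k, m)).
Qed.

Lemma halts_while_end tst P m : eval_test m tst = false ->
  halts w (PWhile tst P) m m 1.
Proof. by move=> h k Q T; rewrite add1n (@halt_prob_step _ _ _ (k, m)) //= h. Qed.

Lemma halts_while_step tst P m m' m'' t t' : eval_test m tst ->
  halts w P m m' t -> halts w (PWhile tst P) m' m'' t' ->
  halts w (PWhile tst P) m m'' (t + t').+1.
Proof.
move=> ht h h' k Q T.
rewrite addSn (@halt_prob_step _ _ _ (P :: PWhile tst P :: k, m)) //= ?ht //.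
by rewrite -addnA h h'.
Qed.

Lemma halts_le (T t : nat) P m m' Q : halts w P m m' t -> (t <= T)%N ->
  halt_prob w Q T ([:: P], m) = (`[< Q m' >])%:R.
Proof. by move=> h /subnKC <-; rewrite h; case: (T - t)%N. Qed.

End Halts.

(** * A structured language over arrays of words *)

(* Scalars are arrays used at index 0.  [EPow] is the least power of two that is
   at least the number [n] of points. *)
Inductive wexp :=
| ENum of nat
| EPow
| EArr of nat & wexp
| EBin of word_op & wexp & wexp.

(* [XCoord e c] is coordinate [c] of block [e] of the input: block 0 is [y] and
   block [i.+1] is the point of index [i]. *)
Inductive rexp :=
| XConst of rat
| XCoord of wexp & nat
| XBin of real_op & rexp & rexp.

Inductive htest :=
| TWEq of wexp & wexp
| TWLt of wexp & wexp
| TREq of rexp & rexp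
| TRLt of rexp & rexp.

Inductive stmt :=
| Skip
| Store of nat & wexp & wexp
| Seq of stmt & stmt
| If of htest & stmt & stmt
| ForN of nat & stmt
| ForL of nat & stmt.

Definition store := nat -> nat -> nat.

Definition upd (s : store) (k i v : nat) : store :=
  fun k' => if k' == k then fun i' => if i' == i then v else s k' i' else s k'.

Section Denotation.
Variables (R : realType) (n L : nat) (inp : nat -> R).
Let P := (2 ^ L)%N.

Fixpoint weval (e : wexp) (s : store) : nat :=
  match e with
  | ENum c => c
  | EPow => P
  | EArr k a => s k (weval a s)
  | EBin op a b => eval_word_op op (weval a s) (weval b s)
  end.

Fixpoint xeval (x : rexp) (s : store) : R :=
  match x with
  | XConst q => ratr q
  | XCoord e c => inp (3 * weval e s + c)%N
  | XBin op a b => eval_real_op op (xeval a s) (xeval b s)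
  end.

Definition teval (t : htest) (s : store) : bool :=
  match t with
  | TWEq a b => weval a s == weval b s
  | TWLt a b => (weval a s < weval b s)%N
  | TREq a b => xeval a s == xeval b s
  | TRLt a b => xeval a s < xeval b s
  end.

Fixpoint for_loop (v : nat) (f : store -> store) (N : nat) (s : store) : store :=
  if N is N'.+1 then f (upd (for_loop v f N' s) v 0 N') else s.

Fixpoint den (st : stmt) (s : store) : store :=
  match st with
  | Skip => s
  | Store k a e => upd s k (weval a s) (weval e s)
  | Seq a b => den b (den a s)
  | If t a b => if teval t s then den a s else den b s
  | ForN v b => for_loop v (den b) n s
  | ForL v b => for_loop v (den b) L s
  end.

Fixpoint safe (st : stmt) (s : store) : Prop :=
  match st with
  | Skip => True
  | Store k a e => (weval e s < P ^ 2)%N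
  | Seq a b => safe a s /\ safe b (den a s)
  | If t a b => if teval t s then safe a s else safe b s
  | ForN v b => forall i, (i < n)%N -> safe b (upd (for_loop v (den b) i s) v 0 i)
  | ForL v b => forall i, (i < L)%N -> safe b (upd (for_loop v (den b) i s) v 0 i)
  end.

Definition bounded (s : store) := forall k i, (s k i < P ^ 2)%N.

Lemma upd_bounded s k i v : bounded s -> (v < P ^ 2)%N -> bounded (upd s k i v).
Proof. by move=> bs hv k' i'; rewrite /upd; case: eqP => // _; case: eqP. Qed.

End Denotation.

Fixpoint wmods (st : stmt) : seq nat :=
  match st with
  | Skip => [::]
  | Store k _ _ => [:: k]
  | Seq a b | If _ a b => wmods a ++ wmods b
  | ForN v b | ForL v b => v :: wmods b
  end.

Lemma upd_other s k i v k' : k' != k -> upd s k i v k' = s k'.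
Proof. by rewrite /upd => /negbTE ->. Qed.

Lemma upd_same s k i v i' : upd s k i v k i' = if i' == i then v else s k i'.
Proof. by rewrite /upd eqxx. Qed.

Lemma den_frame (R : realType) n L (inp : nat -> R) st s k :
  k \notin wmods st -> den n L inp st s k = s k.
Proof.
elim: st s => //= [k' a e|a iha b ihb|t a iha b ihb|v b ih|v b ih] s.
- by rewrite inE => /upd_other.
- by rewrite mem_cat negb_or => /andP[ha hb]; rewrite ihb // iha.
- by rewrite mem_cat negb_or => /andP[ha hb]; case: ifP => _; [apply: iha|apply: ihb].
- rewrite inE negb_or => /andP[hv hb].
  by elim: {2}n => [//|N ihN] /=; rewrite ih // upd_other.
- rewrite inE negb_or => /andP[hv hb].
  by elim: {2}L => [//|N ihN] /=; rewrite ih // upd_other.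
Qed.

Section Compiler.
Variable NV : nat.

(* Entry [i] of array [k < NV] lives in word cell [NV.+1 * i + k].  The cells of
   residue [NV] are hidden: they hold n, L, 2 ^ L, the base address of the
   scratch real cells, then alternately loop counters and temporaries. *)
Definition adr (k i : nat) : nat := (NV.+1 * i + k)%N.

Definition hid j := Direct (adr NV j).
Definition cnt_idx d := (4 + d.*2)%N.
Definition tmp_idx j := (5 + j.*2)%N.
Definition cnt d := hid (cnt_idx d).
Definition tmp j := hid (tmp_idx j).
Definition ind j := Indirect (adr NV (tmp_idx j)).

Definition block (p : program) (l : seq program) : program :=
  foldl PSeq p l.

Definition wi (op : word_op) j j' := PInstr (WBin op (tmp j) (tmp j) (tmp j')).
Definition wc j c := PInstr (WConst (tmp j) c).

Definition rptr j r :=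
  PSeq (wc j r) (PInstr (WBin WAdd (tmp j) (tmp j) (hid 3))).

Definition toadr M k j :=
  block (wc j.+1 M) [:: wi WMul j j.+1; wc j.+1 k; wi WAdd j j.+1].

Fixpoint cw (e : wexp) (j : nat) : program :=
  match e with
  | ENum c => wc j c
  | EPow => PInstr (WMove (tmp j) (hid 2))
  | EArr k a =>
      block (cw a j) [:: toadr NV.+1 k j; PInstr (WMove (tmp j) (ind j))]
  | EBin op a b => block (cw a j) [:: cw b j.+1; wi op j j.+1]
  end.

Fixpoint cx (x : rexp) (r : nat) : program :=
  match x with
  | XConst q => PSeq (rptr 0 r) (PInstr (RConst (ind 0) q))
  | XCoord e c =>
      block (cw e 0) [:: toadr 3 c 0; rptr 1 r; PInstr (RMove (ind 1) (ind 0))]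
  | XBin op a b =>
      block (cx a r) [:: cx b r.+1; rptr 0 r; rptr 1 r.+1;
                         PInstr (RBin op (ind 0) (ind 0) (ind 1))]
  end.

Definition ct (t : htest) (p q : program) : program :=
  match t with
  | TWEq a b => block (cw a 0) [:: cw b 1; PIf (WEq (tmp 0) (tmp 1)) p q]
  | TWLt a b => block (cw a 0) [:: cw b 1; PIf (WLt (tmp 0) (tmp 1)) p q]
  | TREq x y => block (cx x 0) [:: cx y 1; rptr 0 0; rptr 1 1;
                                   PIf (REq (ind 0) (ind 1)) p q]
  | TRLt x y => block (cx x 0) [:: cx y 1; rptr 0 0; rptr 1 1;
                                   PIf (RLt (ind 0) (ind 1)) p q]
  end.

Definition cfor (v d : nat) (bnd : operand) (p : program) : program :=
  PSeq (PInstr (WConst (cnt d) 0))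
    (PWhile (WLt (cnt d) bnd)
       (block (PInstr (WMove (Direct (adr v 0)) (cnt d)))
          [:: p; wc 0 1; PInstr (WBin WAdd (cnt d) (cnt d) (tmp 0))])).

Fixpoint cs (s : stmt) (d : nat) : program :=
  match s with
  | Skip => wc 0 0
  | Store k a e =>
      block (cw a 0) [:: toadr NV.+1 k 0; cw e 1;
                         PInstr (WMove (ind 0) (tmp 1))]
  | Seq a b => PSeq (cs a d) (cs b d)
  | If t a b => ct t (cs a d) (cs b d)
  | ForN v b => cfor v d (hid 0) (cs b d.+1)
  | ForL v b => cfor v d (hid 1) (cs b d.+1)
  end.

Fixpoint psize (p : program) : nat :=
  match p with
  | PInstr _ => 1
  | PSeq a b => (psize a + psize b).+1
  | PIf _ a b => (psize a + psize b).+1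
  | PWhile _ b => (psize b).+1
  end.

Fixpoint cost (n L : nat) (s : stmt) (d : nat) : nat :=
  match s with
  | Skip | Store _ _ _ => psize (cs s d)
  | Seq a b => (cost n L a d + cost n L b d).+1
  | If t a b => psize (ct t (wc 0 0) (wc 0 0)) + cost n L a d + cost n L b d
  | ForN _ b => 3 + n * (cost n L b d.+1 + 7)
  | ForL _ b => 3 + L * (cost n L b d.+1 + 7)
  end%N.

(* With [2 ^ L] as unit, all subexpressions evaluate to less than its [we e]-th
   power, and so do the addresses they give rise to. *)
Fixpoint we (e : wexp) : nat :=
  match e with
  | ENum c => c
  | EPow => 2
  | EArr k a => we a + NV.+3
  | EBin _ a b => we a + we b
  end%N.

Fixpoint wx (x : rexp) : nat :=
  match x with
  | XConst _ => 0
  | XCoord e c => we e + c + 3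
  | XBin _ a b => maxn (wx a) (wx b)
  end%N.

Fixpoint rx (x : rexp) : nat :=
  match x with
  | XBin _ a b => (maxn (rx a) (rx b)).+2
  | _ => 1
  end%N.

Definition wt (t : htest) : nat :=
  match t with
  | TWEq a b | TWLt a b => maxn (we a) (we b)
  | TREq a b | TRLt a b => maxn (wx a) (wx b)
  end.

Definition rt (t : htest) : nat :=
  match t with
  | TWEq a b | TWLt a b => 0
  | TREq a b | TRLt a b => maxn (rx a) (rx b)
  end.

Fixpoint ws (s : stmt) : nat :=
  match s with
  | Skip => 0
  | Store k a e => maxn (we a + NV.+3) (we e)
  | Seq a b => maxn (ws a) (ws b)
  | If t a b => maxn (wt t) (maxn (ws a) (ws b))
  | ForN _ b | ForL _ b => ws b
  end%N.

Fixpoint rs (s : stmt) : nat :=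
  match s with
  | Skip | Store _ _ _ => 0
  | Seq a b => maxn (rs a) (rs b)
  | If t a b => maxn (rt t) (maxn (rs a) (rs b))
  | ForN _ b | ForL _ b => rs b
  end%N.

Fixpoint okw (e : wexp) : bool :=
  match e with
  | ENum _ | EPow => true
  | EArr k a => (k < NV)%N && okw a
  | EBin _ a b => okw a && okw b
  end.

Fixpoint okx (x : rexp) : bool :=
  match x with
  | XConst _ => true
  | XCoord e _ => okw e
  | XBin _ a b => okx a && okx b
  end.

Definition okt (t : htest) : bool :=
  match t with
  | TWEq a b | TWLt a b => okw a && okw b
  | TREq a b | TRLt a b => okx a && okx b
  end.

Fixpoint oks (s : stmt) : bool :=
  match s with
  | Skip => true
  | Store k a e => [&& (k < NV)%N, okw a & okw e]
  | Seq a b => oks a && oks b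
  | If t a b => [&& okt t, oks a & oks b]
  | ForN v b | ForL v b => (v < NV)%N && oks b
  end.

Section Correctness.
Variables (R : realType) (n L B kap : nat) (inp : nat -> R).
Let P := (2 ^ L)%N.
Let w := (kap * L)%N.
Hypothesis L_gt0 : (0 < L)%N.
Hypothesis n_le : (n <= P)%N.
Hypothesis BNV : (NV.+3 <= B)%N.
Hypothesis Bkap : (B < kap)%N.
Implicit Types (m : memory R) (s : store).

Lemma P_gt1 : (1 < P)%N.
Proof. by rewrite -[1%N]/(2 ^ 0)%N ltn_exp2l. Qed.

Lemma leq_powP a b : (a <= b)%N -> (P ^ a <= P ^ b)%N.
Proof. by move=> h; rewrite leq_exp2l // P_gt1. Qed.

Lemma P_lt_sqr : (2 ^ L < P ^ 2)%N.
Proof. by rewrite -/P -[ltnLHS]expn1 ltn_exp2l // P_gt1. Qed.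

Lemma word_sizeP : (2 ^ w = P ^ kap)%N.
Proof. by rewrite /w mulnC expnM. Qed.

Lemma ltn_powP c : (c < P ^ c)%N.
Proof. exact: ltn_expl P_gt1. Qed.

Record rep s m : Prop := Rep {
  rep_words : forall k i, (k < NV)%N -> words m (adr k i) = s k i;
  rep_n : words m (adr NV 0) = n;
  rep_L : words m (adr NV 1) = L;
  rep_P : words m (adr NV 2) = P;
  rep_B : words m (adr NV 3) = (P ^ B)%N;
  rep_reals : forall a, (a < P ^ B)%N -> reals m a = inp a }.

Lemma adr_inj k i k' i' : (k <= NV)%N -> (k' <= NV)%N ->
  adr k i = adr k' i' -> k = k' /\ i = i'.
Proof.
rewrite /adr => hk hk' e.
have ek : k = k'.
  move/(congr1 (modn^~ NV.+1)): e.
  by rewrite ![(NV.+1 * _)%N]mulnC !modnMDl !modn_small.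
by split=> //; move: e; rewrite ek => /eqP; rewrite eqn_add2r eqn_pmul2l // => /eqP.
Qed.

Lemma adr_eq k i k' i' : (k <= NV)%N -> (k' <= NV)%N ->
  (adr k i == adr k' i') = (k == k') && (i == i').
Proof.
move=> hk hk'; apply/eqP/andP => [/(adr_inj hk hk')[-> ->]|[/eqP-> /eqP->]] //.
Qed.

Lemma hid_eq i i' : (adr NV i == adr NV i') = (i == i').
Proof. by rewrite adr_eq // eqxx. Qed.

Definition tagree j r m m' :=
  (forall a, (forall j', (j <= j')%N -> a != adr NV (tmp_idx j')) ->
     words m' a = words m a) /\
  (forall a, (a < P ^ B + r)%N -> reals m' a = reals m a).

Lemma tagree_trans j r m m' m'' :
  tagree j r m m' -> tagree j r m' m'' -> tagree j r m m''.
Proof. by move=> [h1 h2] [h3 h4]; split=> a ha; rewrite ?h3 ?h4 ?h1 ?h2. Qed.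

Lemma tagreeW j r j' r' m m' : (j' <= j)%N -> (r' <= r)%N ->
  tagree j r m m' -> tagree j' r' m m'.
Proof.
move=> hj hr [h1 h2]; split=> a ha; [apply: h1 => i hi|apply: h2].
  by apply: ha; apply: leq_trans hi.
by apply: leq_trans ha _; rewrite leq_add2l.
Qed.

Lemma tagree_rep j r s m m' : tagree j r m m' -> rep s m -> rep s m'.
Proof.
move=> [h1 h2] [hw hn hL hP hB hr].
have hid_same i : (i < 5)%N -> words m' (adr NV i) = words m (adr NV i).
  by move=> hi; apply: h1 => j' _; rewrite hid_eq /tmp_idx; lia.
split; rewrite ?hid_same //.
- move=> k i hk; rewrite h1 ?hw // => j' _.
  by rewrite adr_eq ?(ltnW hk) // (ltn_eqF hk).
- by move=> a ha; rewrite h2 ?hr // (leq_trans ha) ?leq_addr.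
Qed.

Lemma tagree_tmp j r i m m' : (i < j)%N -> tagree j r m m' ->
  words m' (adr NV (tmp_idx i)) = words m (adr NV (tmp_idx i)).
Proof. by move=> hi [-> //] j' hj; rewrite hid_eq /tmp_idx; lia. Qed.

Lemma tagree_cnt j r d m m' : tagree j r m m' ->
  words m' (adr NV (cnt_idx d)) = words m (adr NV (cnt_idx d)).
Proof. by move=> [-> //] j' hj; rewrite hid_eq /cnt_idx /tmp_idx; lia. Qed.

Definition wset m a v : memory R := Memory (update (words m) a v) (reals m).
Definition rset m a (v : R) : memory R := Memory (words m) (update (reals m) a v).

Lemma tagree_wset j r i m v : (j <= i)%N -> tagree j r m (wset m (adr NV (tmp_idx i)) v).
Proof. by move=> hi; split=> //= a ha; rewrite /update ifN // ha. Qed.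

Lemma tagree_rset j r a m v : (P ^ B + r <= a)%N -> tagree j r m (rset m a v).
Proof. by move=> hi; split=> //= b hb; rewrite /update ifN //; lia. Qed.

Lemma wsetE m a v : words (wset m a v) a = v.
Proof. by rewrite /= /update eqxx. Qed.

Lemma rsetE m a v : reals (rset m a v) a = v.
Proof. by rewrite /= /update eqxx. Qed.

Lemma halts_wset P' i m o v : P' = PInstr i ->
  exec_instr w m i = set_word w m o v -> (v < P ^ kap)%N ->
  halts w P' m (wset m (address m o) v) 1.
Proof.
by move=> -> h hv; apply: halts_instr; rewrite h /set_word word_sizeP hv.
Qed.

Lemma halts_wc m j c : (c < P ^ kap)%N ->
  halts w (wc j c) m (wset m (adr NV (tmp_idx j)) c) 1.
Proof. exact: (@halts_wset _ _ m (tmp j)). Qed.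

Lemma halts_wi m op j j' v :
  eval_word_op op (words m (adr NV (tmp_idx j))) (words m (adr NV (tmp_idx j'))) = v ->
  (v < P ^ kap)%N ->
  halts w (wi op j j') m (wset m (adr NV (tmp_idx j)) v) 1.
Proof. by move=> <-; apply: (@halts_wset _ _ m (tmp j)). Qed.

Lemma halts_rptr s m j r : rep s m -> (B + r < kap)%N ->
  exists m', [/\ halts w (rptr j r) m m' 3,
    words m' (adr NV (tmp_idx j)) = (P ^ B + r)%N,
    (forall a, a != adr NV (tmp_idx j) -> words m' a = words m a) &
    reals m' = reals m].
Proof.
move=> hm hB.
have hBr : (P ^ B + r < P ^ kap)%N.
  apply: leq_trans (leq_powP hB); rewrite expnS expnD.
  have hr := ltn_powP r; have hx : (0 < P ^ B)%N by rewrite expn_gt0 ltnW ?P_gt1.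
  apply: (@leq_trans (P ^ B * P ^ r + P ^ B * P ^ r)); last first.
    by rewrite addnn -mul2n leq_mul2r P_gt1 orbT.
  by rewrite -addnS leq_add // ?leq_pmulr //; [lia | exact: leq_trans hr (leq_pmull _ _)].
exists (wset (wset m (adr NV (tmp_idx j)) r) (adr NV (tmp_idx j)) (P ^ B + r)).
split=> //=; rewrite /update ?eqxx //; last first.
  by move=> a /negbTE h; rewrite !h.
apply: (@halts_seq _ _ _ _ _ _ _ 1 1).
  apply: halts_wc; apply: leq_trans (ltn_powP _) (leq_powP _); lia.
apply: (@halts_wset _ _ _ (tmp j)) => //=.
have h3 : (adr NV 3 == adr NV (tmp_idx j)) = false by rewrite hid_eq /tmp_idx; lia.
by congr set_word; rewrite /get_word /= /update eqxx h3 (rep_B hm) addnC.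
Qed.

Lemma halts_toadr m M k j v :
  words m (adr NV (tmp_idx j)) = v ->
  (M < P ^ kap)%N -> (M * v + k < P ^ kap)%N ->
  exists m', [/\ halts w (toadr M k j) m m' 7,
    words m' (adr NV (tmp_idx j)) = (M * v + k)%N,
    tagree j 0 m m' & reals m' = reals m].
Proof.
move=> hv hM hk.
pose a := adr NV (tmp_idx j); pose b := adr NV (tmp_idx j.+1).
have hab : (a == b) = false by rewrite hid_eq /tmp_idx; lia.
have hba : (b == a) = false by rewrite eq_sym.
exists (wset (wset (wset (wset m b M) a (M * v)) b k) a (M * v + k)).
split=> //=; first 2 last.
- rewrite /a /b.
  do 3!(apply: tagree_trans; last by apply: tagree_wset; rewrite ?leqnSn).
  exact: tagree_wset.
- apply: (@halts_seq _ _ _ _ _ _ _ 5 1); last first.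
    by apply: halts_wi => //=; rewrite /update -/a -/b !eqxx hab.
  apply: (@halts_seq _ _ _ _ _ _ _ 3 1); last first.
    by apply: halts_wc; apply: leq_trans hk; rewrite ltnS leq_addl.
  apply: (@halts_seq _ _ _ _ _ _ _ 1 1); first exact: halts_wc.
  apply: halts_wi; first by rewrite /= /update -/a -/b !eqxx hab -hv mulnC.
  by apply: leq_trans hk; rewrite ltnS leq_addr.
- by rewrite /update eqxx.
Qed.

Lemma weval_lt s e : bounded L s -> (weval L e s < P ^ we e)%N.
Proof.
move=> bs; elim: e => /= [c||k a iha|op a iha b ihb].
- exact: ltn_powP.
- exact: P_lt_sqr.
- by apply: leq_trans (bs k _) (leq_powP _); lia.
- rewrite expnD; set x := weval _ _ _ in iha *; set y := weval _ _ _ in ihb *.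
  move: (P ^ _)%N (P ^ _)%N iha ihb => M' M hx hy.
  have hxM : (x < M * M')%N by nia.
  case: op => //=; [nia|lia|nia| |].
  + exact: leq_ltn_trans (leq_div _ _) hxM.
  + exact: leq_ltn_trans (leq_mod _ _) hxM.
Qed.

Lemma cw_ok s e j m : rep s m -> bounded L s -> okw e -> (we e <= kap)%N ->
  exists m', [/\ halts w (cw e j) m m' (psize (cw e j)),
    words m' (adr NV (tmp_idx j)) = weval L e s,
    tagree j 0 m m' & reals m' = reals m].
Proof.
move=> hm bs; elim: e j m hm => /= [c||k a iha|op a iha b ihb] j m hm hok hk.
- exists (wset m (adr NV (tmp_idx j)) c); split=> //.
  + by apply: halts_wc; apply: leq_trans (ltn_powP c) (leq_powP _).
  + exact: wsetE.
  + exact: tagree_wset.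
- exists (wset m (adr NV (tmp_idx j)) P); split=> //.
  + apply: (@halts_wset _ _ m (tmp j)) => //=.
      by rewrite /get_word /= (rep_P hm).
    exact: leq_trans P_lt_sqr (leq_powP hk).
  + exact: wsetE.
  + exact: tagree_wset.
- case/andP: hok => hkN hok.
  have [|m1 [h1 e1 t1 r1]] := iha j m hm hok; first by lia.
  have hv := weval_lt a bs; set v := weval _ _ _ in hv e1.
  have hlt : (NV.+1 * v + k < P ^ kap)%N.
    apply: leq_trans (leq_powP hk); rewrite expnD.
    have := ltn_powP NV.+3; have := expn_gt0 P (we a); nia.
  have hM : (NV.+1 < P ^ kap)%N.
    by apply: leq_trans (ltn_powP _) (leq_powP _); lia.
  have [m2 [h2 e2 t2 r2]] := halts_toadr e1 hM hlt.
  have hm1 := tagree_rep t1 hm; have hm2 := tagree_rep t2 hm1.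
  exists (wset m2 (adr NV (tmp_idx j)) (s k v)); split.
  + apply: halts_seq; first exact: halts_seq h1 h2.
    apply: (@halts_wset _ _ m2 (tmp j)) => //=.
      by rewrite /get_word /= e2 (rep_words hm2).
    by apply: leq_trans (bs _ _) (leq_powP _); lia.
  + exact: wsetE.
  + by apply: tagree_trans (tagree_trans t1 t2) _; apply: tagree_wset.
  + by rewrite /= r2.
- case/andP: hok => hoka hokb.
  have [|m1 [h1 e1 t1 r1]] := iha j m hm hoka; first by lia.
  have hm1 := tagree_rep t1 hm.
  have [|m2 [h2 e2 t2 r2]] := ihb j.+1 m1 hm1 hokb; first by lia.
  have e1' : words m2 (adr NV (tmp_idx j)) = weval L a s.
    by rewrite (tagree_tmp _ t2).
  exists (wset m2 (adr NV (tmp_idx j)) (weval L (EBin op a b) s)); split=> //.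
  + apply: halts_seq; first exact: halts_seq h1 h2.
    apply: halts_wi; first by rewrite e1' e2.
    exact: leq_trans (weval_lt (EBin op a b) bs) (leq_powP hk).
  + exact: wsetE.
  + apply: (@tagree_trans _ _ _ m2); last exact: tagree_wset.
    by apply: tagree_trans t1 _; apply: tagreeW t2.
  + by rewrite /= r2.
Qed.

Lemma halts_rset P' i m o v : P' = PInstr i ->
  exec_instr w m i = set_real m o v ->
  halts w P' m (rset m (address m o) v) 1.
Proof. by move=> -> h; apply: halts_instr; rewrite h. Qed.

Lemma cx_ok s x r m : rep s m -> bounded L s -> okx x ->
  (wx x <= B)%N -> (B + r + rx x <= kap)%N ->
  exists m', [/\ halts w (cx x r) m m' (psize (cx x r)),
    reals m' (P ^ B + r)%N = xeval L inp x s & tagree 0 r m m'].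
Proof.
move=> hm bs; elim: x r m hm => /= [q|e c|op a iha b ihb] r m hm hok hB hk.
- have [|m1 [h1 e1 t1 r1]] := @halts_rptr s m 0 r hm; first by lia.
  exists (rset m1 (P ^ B + r) (ratr q)); split.
  + apply: (@halts_seq _ _ _ _ _ _ _ 3 1) h1 _.
    have := @halts_rset _ (RConst (ind 0) q) m1 (ind 0) (ratr q).
    by rewrite /= e1; apply.
  + exact: rsetE.
  + apply: (@tagree_trans _ _ _ m1); last exact: tagree_rset.
    split=> [a0 ha|a0 ha]; last by rewrite r1.
    by rewrite t1 // ha.
- have [|m1 [h1 e1 t1 r1]] := @cw_ok s e 0 m hm bs hok; first by lia.
  have hv := weval_lt e bs; set v := weval _ _ _ in hv e1.
  have hlt : (3 * v + c < P ^ B)%N.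
    apply: leq_trans (leq_powP hB); rewrite -addnA expnD.
    have := ltn_powP (c + 3); have := expn_gt0 P (we e); nia.
  have hBk : (P ^ B <= P ^ kap)%N by apply: leq_powP; lia.
  have hM : (3 < P ^ kap)%N.
    by apply: leq_trans (ltn_powP 3) (leq_powP _); lia.
  have [m2 [h2 e2 t2 r2]] := halts_toadr e1 hM (leq_trans hlt hBk).
  have hm1 := tagree_rep t1 hm; have hm2 := tagree_rep t2 hm1.
  have [|m3 [h3 e3 t3 r3]] := @halts_rptr s m2 1 r hm2; first by lia.
  have e2' : words m3 (adr NV (tmp_idx 0)) = (3 * v + c)%N.
    by rewrite t3 ?e2 // hid_eq.
  exists (rset m3 (P ^ B + r) (inp (3 * v + c))); split.
  + apply: halts_seq; first by apply: halts_seq h3; apply: halts_seq h2.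
    have := @halts_rset _ (RMove (ind 1) (ind 0)) m3 (ind 1) (inp (3 * v + c)%N).
    rewrite /= e3; apply=> //.
    by rewrite /get_real /= e2' r3 (rep_reals hm2).
  + exact: rsetE.
  + apply: (@tagree_trans _ _ _ m3); last exact: tagree_rset.
    split=> [a0 ha|a0 ha]; last by rewrite r3 r2 r1.
    by rewrite t3 ?ha // t2.1 ?t1.1.
- case/andP: hok => hoka hokb.
  have [||m1 [h1 e1 t1]] := iha r m hm hoka; [by lia..|].
  have hm1 := tagree_rep t1 hm.
  have [||m2 [h2 e2 t2]] := ihb r.+1 m1 hm1 hokb; [by lia..|].
  have hm2 := tagree_rep t2 hm1.
  have [|m3 [h3 e3 t3 r3]] := @halts_rptr s m2 0 r hm2; first by lia.
  have hm3 : rep s m3.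
    apply: (@tagree_rep 0 0) hm2; split=> [a0 ha|a0 ha]; last by rewrite r3.
    by rewrite t3 ?ha.
  have [|m4 [h4 e4 t4 r4]] := @halts_rptr s m3 1 r.+1 hm3; first by lia.
  have e3' : words m4 (adr NV (tmp_idx 0)) = (P ^ B + r)%N.
    by rewrite t4 ?e3 // hid_eq.
  exists (rset m4 (P ^ B + r) (xeval L inp (XBin op a b) s)); split.
  + apply: halts_seq.
      by apply: halts_seq h4; apply: halts_seq h3; apply: halts_seq h1 h2.
    have := @halts_rset _ (RBin op (ind 0) (ind 0) (ind 1)) m4 (ind 0).
    rewrite /= e3'; apply=> //.
    by rewrite /get_real /= e3' e4 r4 r3 e2 -e1 t2.2 // ltn_add2l.
  + exact: rsetE.
  + apply: (@tagree_trans _ _ _ m4); last exact: tagree_rset.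
    apply: tagree_trans t1 _; apply: (@tagree_trans _ _ _ m2).
      by apply: tagreeW t2.
    split=> [a0 ha|a0 ha]; last by rewrite r4 r3.
    by rewrite t4 ?ha // t3 ?ha.
Qed.

Lemma rx_gt0 x : (0 < rx x)%N. Proof. by case: x. Qed.

Lemma ct_ok s t m p q : rep s m -> bounded L s -> okt t ->
  (wt t <= B)%N -> (B + rt t < kap)%N ->
  exists2 m', tagree 0 0 m m' &
    forall m'' t', halts w (if teval L inp t s then p else q) m' m'' t' ->
    exists2 t'', (t'' <= psize (ct t (wc 0 0) (wc 0 0)) + t')%N &
      halts w (ct t p q) m m'' t''.
Proof.
move=> hm bs; case: t => a b /= /andP[oka okb] hB hk.
1,2: have [|m1 [h1 e1 t1 r1]] := cw_ok 0 hm bs oka; first by lia.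
1,2: have hm1 := tagree_rep t1 hm.
1,2: have [|m2 [h2 e2 t2 r2]] := cw_ok 1 hm1 bs okb; first by lia.
1,2: have e1' : words m2 (adr NV (tmp_idx 0)) = weval L a s
  by rewrite (tagree_tmp _ t2).
1,2: exists m2; first by apply: tagree_trans t1 _; apply: tagreeW t2.
1,2: move=> m'' t' h.
1,2: eexists; last first.
1,3: apply: halts_seq (halts_seq h1 h2) _; apply: halts_if;
  by rewrite /= /get_word /= e1' e2; exact: h.
1,2: by rewrite /=; lia.
1,2: have [||m1 [h1 e1 t1]] := cx_ok (r := 0) hm bs oka; [by lia..|].
1,2: have hm1 := tagree_rep t1 hm.
1,2: have [||m2 [h2 e2 t2]] := cx_ok (r := 1) hm1 bs okb; [by lia..|].
1,2: have hm2 := tagree_rep t2 hm1.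
1,2: have [|m3 [h3 e3 t3 r3]] := @halts_rptr s m2 0 0 hm2; first by lia.
1,2: have t3' : tagree 0 0 m2 m3
  by split=> [a0 ha|a0 ha]; [rewrite t3 ?ha|rewrite r3].
1,2: have hm3 := tagree_rep t3' hm2.
1,2: have [|m4 [h4 e4 t4 r4]] := @halts_rptr s m3 1 1 hm3; first by have := rx_gt0 a; lia.
1,2: have e3' : words m4 (adr NV (tmp_idx 0)) = (P ^ B + 0)%N
  by rewrite t4 ?e3 // hid_eq.
1,2: exists m4; first (
  apply: tagree_trans t1 _; apply: (@tagree_trans _ _ _ m2);
    [by apply: tagreeW t2|apply: tagree_trans t3' _];
    by split=> [a0 ha|a0 ha]; [rewrite t4 ?ha|rewrite r4]).
1,2: move=> m'' t' h.
1,2: eexists; last first.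
1,3: apply: halts_seq; [exact: halts_seq (halts_seq (halts_seq h1 h2) h3) h4|];
  apply: halts_if; rewrite /= /get_real /= e3' e4 r4 r3 e2 t2.2 ?ltn_add2l // e1;
  exact: h.
1,2: by rewrite /=; lia.
Qed.

Lemma rep_upd s k i v m : (k < NV)%N -> rep s m ->
  rep (upd s k i v) (wset m (adr k i) v).
Proof.
move=> hk [hw hn hL hP hB hr].
have hne j : (adr NV j == adr k i) = false.
  by rewrite adr_eq ?(ltnW hk) // gtn_eqF.
split=> //=; rewrite /update ?hne //.
move=> k' i' hk'; rewrite adr_eq ?(ltnW hk) ?(ltnW hk') // /upd.
by case: eqP => [->|] /=; [case: eqP|]; rewrite ?hw.
Qed.

Lemma rep_cnt s d v m : rep s m -> rep s (wset m (adr NV (cnt_idx d)) v).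
Proof.
move=> [hw hn hL hP hB hr].
have hne j : (j < 4)%N -> (adr NV j == adr NV (cnt_idx d)) = false.
  by move=> hj; rewrite hid_eq /cnt_idx; lia.
split=> //=; rewrite /update ?hne //.
by move=> k' i' hk'; rewrite adr_eq ?(ltnW hk') // (ltn_eqF hk') /= hw.
Qed.

Definition cagree d m m' := forall d', (d' < d)%N ->
  words m' (adr NV (cnt_idx d')) = words m (adr NV (cnt_idx d')).

Lemma sqrP_le_word : (P ^ 2 <= P ^ kap)%N.
Proof. by apply: leq_powP; lia. Qed.

Lemma for_ok v d bnd N p f c s m :
  (forall s m, rep s m -> get_word m bnd = N) -> (N < P ^ 2)%N -> (v < NV)%N ->
  (forall i m, (i < N)%N -> rep (upd (for_loop v f i s) v 0 i) m ->
     exists m' t, [/\ halts w p m m' t, (t <= c)%N,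
       rep (for_loop v f i.+1 s) m' & cagree d.+1 m m']) ->
  rep s m ->
  exists m' t, [/\ halts w (cfor v d bnd p) m m' t, (t <= 3 + N * (c + 7))%N,
       rep (for_loop v f N s) m' & cagree d m m'].
Proof.
move=> hbnd hN hv hbody hm.
set body := block (PInstr (WMove (Direct (adr v 0)) (cnt d)))
          [:: p; wc 0 1; PInstr (WBin WAdd (cnt d) (cnt d) (tmp 0))].
have loop r i m1 : (i + r)%N = N -> rep (for_loop v f i s) m1 ->
  words m1 (adr NV (cnt_idx d)) = i ->
  exists m' t, [/\ halts w (PWhile (WLt (cnt d) bnd) body) m1 m' t,
    (t <= 1 + r * (c + 7))%N, rep (for_loop v f N s) m' & cagree d m1 m'].
  elim: r i m1 => [|r ih] i m1 hi hm1 hc.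
    exists m1, 1%N; split=> //; last by rewrite -hi addn0.
    apply: halts_while_end.
    by rewrite /= (hbnd _ _ hm1) /get_word /= hc -hi addn0 ltnn.
  have hiN : (i < N)%N by lia.
  pose m2 := wset m1 (adr v 0) i.
  have hm2 : rep (upd (for_loop v f i s) v 0 i) m2 by exact: rep_upd.
  have [m3 [t [h3 le3 hm3 ca3]]] := hbody i m2 hiN hm2.
  have c3 : words m3 (adr NV (cnt_idx d)) = i.
    rewrite ca3 // /= /update adr_eq ?(ltnW hv) // gtn_eqF //=.
  pose m4 := wset m3 (adr NV (tmp_idx 0)) 1.
  have t4 : tagree 0 0 m3 m4 by exact: tagree_wset.
  have hm4 := tagree_rep t4 hm3.
  pose m5 := wset m4 (adr NV (cnt_idx d)) i.+1.
  have hm5 : rep (for_loop v f i.+1 s) m5 by exact: rep_cnt.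
  have [|m6 [t' [h6 le6 hm6 ca6]]] := ih i.+1 m5 _ hm5 (wsetE _ _ _); first by lia.
  have h5 : halts w body m1 m5 (t + 6).
    have -> : (t + 6 = (((1 + t).+1 + 1).+1 + 1).+1)%N by lia.
    apply: halts_seq; first apply: halts_seq; first apply: halts_seq; last 1 first.
    - apply: (@halts_wset _ _ m4 (cnt d)) => //.
        have g1 : get_word m4 (cnt d) = i by rewrite -c3; exact: (tagree_cnt _ t4).
        have g2 : get_word m4 (tmp 0) = 1%N by exact: wsetE.
        by rewrite /exec_instr g1 g2 /= addn1.
      by apply: leq_trans sqrP_le_word; lia.
    - apply: (@halts_wset _ _ m1 (Direct (adr v 0)) i) => //=.
        by rewrite /get_word /= hc.
      by apply: leq_trans sqrP_le_word; lia.
    - exact: h3.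
    - by apply: halts_wc; apply: leq_trans (ltn_powP 1) (leq_powP _); lia.
  exists m6, (t + 6 + t').+1; split=> //.
  - apply: halts_while_step h5 h6.
    by rewrite /= (hbnd _ _ hm1) /get_word /= hc.
  - by rewrite mulSn; lia.
  - move=> d' hd'; rewrite ca6 //.
    have -> : words m5 (adr NV (cnt_idx d')) = words m4 (adr NV (cnt_idx d')).
      rewrite {1}/m5 /wset /words /update ifN // hid_eq /cnt_idx; lia.
    rewrite (tagree_cnt _ t4) ca3; last by lia.
    by rewrite /= /update adr_eq ?(ltnW hv) // gtn_eqF.
pose m0 := wset m (adr NV (cnt_idx d)) 0.
have [//|||m' [t [h le hm' ca]]] := loop N 0%N m0.
- exact: rep_cnt.
- exact: wsetE.
exists m', (1 + t).+1; split=> //.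
- apply: halts_seq h; apply: (@halts_wset _ _ m (cnt d)) => //.
  by rewrite expn_gt0 (ltnW P_gt1).
- move=> d' hd'; rewrite ca // /= /update hid_eq ifN //.
  by rewrite /cnt_idx; lia.
Qed.

Lemma n_lt : (n < P ^ 2)%N.
Proof. exact: leq_ltn_trans n_le P_lt_sqr. Qed.

Lemma L_lt : (L < P ^ 2)%N.
Proof. by apply: ltn_trans P_lt_sqr; apply: ltn_expl. Qed.

Lemma for_bounded v f N s : bounded L s -> (N <= P ^ 2)%N ->
  (forall i, (i < N)%N -> let s' := upd (for_loop v f i s) v 0 i in
     bounded L s' -> bounded L (f s')) ->
  bounded L (for_loop v f N s).
Proof.
move=> bs; elim: N => [//|N ihN] hN hf /=.
apply: (hf N) => //; apply: upd_bounded => //.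
by apply: ihN; [exact: ltnW|move=> i hi; apply: hf; apply: ltnW].
Qed.

Lemma den_bounded st s : bounded L s -> safe n L inp st s ->
  bounded L (den n L inp st s).
Proof.
elim: st s => //= [k a e|a iha b ihb|t a iha b ihb|v b ih|v b ih] s bs.
- exact: upd_bounded.
- by case=> ha hb; apply: ihb => //; apply: iha.
- by case: ifP => _; [apply: iha|apply: ihb].
- move=> hs; apply: for_bounded => //; first exact: ltnW n_lt.
  by move=> i hi s' bs'; apply: ih => //; apply: hs.
- move=> hs; apply: for_bounded => //; first exact: ltnW L_lt.
  by move=> i hi s' bs'; apply: ih => //; apply: hs.
Qed.

Lemma cs_ok st d s m : rep s m -> bounded L s -> safe n L inp st s ->
  oks st -> (ws st <= B)%N -> (B + rs st < kap)%N ->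
  exists m' t, [/\ halts w (cs st d) m m' t, (t <= cost n L st d)%N,
    rep (den n L inp st s) m' & cagree d m m'].
Proof.
elim: st d s m => [|k a e|a iha b ihb|t a iha b ihb|v b ih|v b ih] d s m hm bs hs
  hok hB hk.
- have t0 : tagree 0 0 m (wset m (adr NV (tmp_idx 0)) 0) by exact: tagree_wset.
  exists (wset m (adr NV (tmp_idx 0)) 0), 1%N; split=> //.
  + by apply: halts_wc; rewrite expn_gt0 ltnW // P_gt1.
  + exact: tagree_rep t0 hm.
  + by move=> d' _; rewrite (tagree_cnt _ t0).
- case/and3P: hok => hkN oka oke; move: hB hk hs; rewrite /= => hB hk hs.
  have [|m1 [h1 e1 t1 r1]] := cw_ok 0 hm bs oka; first by lia.
  have hv := weval_lt a bs; set v := weval _ _ _ in hv e1.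
  have hlt : (NV.+1 * v + k < P ^ kap)%N.
    apply: (@leq_trans (P ^ (we a + NV.+3))); last by apply: leq_powP; lia.
    rewrite expnD.
    have := ltn_powP NV.+3; have := expn_gt0 P (we a); nia.
  have hM : (NV.+1 < P ^ kap)%N.
    by apply: leq_trans (ltn_powP _) (leq_powP _); lia.
  have [m2 [h2 e2 t2 r2]] := halts_toadr e1 hM hlt.
  have hm1 := tagree_rep t1 hm; have hm2 := tagree_rep t2 hm1.
  have [|m3 [h3 e3 t3 r3]] := cw_ok 1 hm2 bs oke; first by lia.
  have hm3 := tagree_rep t3 hm2.
  have e2' : words m3 (adr NV (tmp_idx 0)) = adr k v.
    by rewrite (tagree_tmp _ t3).
  exists (wset m3 (adr k v) (weval L e s)), (psize (cs (Store k a e) d)).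
  split=> //; last 2 first.
  + exact: rep_upd.
  + move=> d' _; rewrite /= /update adr_eq ?(ltnW hkN) // gtn_eqF //=.
    by rewrite (tagree_cnt _ t3) (tagree_cnt _ t2) (tagree_cnt _ t1).
  apply: halts_seq; first exact: halts_seq (halts_seq h1 h2) h3.
  have := @halts_wset _ (WMove (ind 0) (tmp 1)) m3 (ind 0) (weval L e s).
  rewrite /= e2'; apply=> //; first by rewrite /get_word /= e3.
  exact: leq_trans hs sqrP_le_word.
- case/andP: hok => oka okb; move: hB hk hs; rewrite /= => hB hk [hsa hsb].
  have [||m1 [t1 [h1 le1 hm1 ca1]]] := iha d s m hm bs hsa oka; [by lia..|].
  have [||m2 [t2 [h2 le2 hm2 ca2]]] := ihb d _ m1 hm1 (den_bounded bs hsa) hsb okb;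
    [by lia..|].
  exists m2, (t1 + t2).+1; split=> //.
  + exact: halts_seq h1 h2.
  + by rewrite /= ltnS leq_add.
  + by move=> d' hd'; rewrite ca2 // ca1.
- case/and3P: hok => okt' oka okb; move: hB hk hs; rewrite /= => hB hk hs.
  have [||m1 t1 h1] := @ct_ok s t m (cs a d) (cs b d) hm bs okt'; [by lia..|].
  have hm1 := tagree_rep t1 hm.
  case: ifP hs h1 => _ hs h1.
  + have [||m2 [t2 [h2 le2 hm2 ca2]]] := iha d s m1 hm1 bs hs oka; [by lia..|].
    have [t' le' h'] := h1 _ _ h2; exists m2, t'; split=> //; first by lia.
    by move=> d' hd'; rewrite ca2 // (tagree_cnt _ t1).
  + have [||m2 [t2 [h2 le2 hm2 ca2]]] := ihb d s m1 hm1 bs hs okb; [by lia..|].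
    have [t' le' h'] := h1 _ _ h2; exists m2, t'; split=> //; first by lia.
    by move=> d' hd'; rewrite ca2 // (tagree_cnt _ t1).
- case/andP: hok => hv okb; move: hB hk hs; rewrite /= => hB hk hs.
  apply: for_ok => //; [by move=> s' m'; apply: rep_n|exact: n_lt|].
  move=> i m1 hi hm1; apply: ih => //; last exact: hs.
  apply: upd_bounded; last by apply: ltn_trans n_lt.
  apply: for_bounded => //; first by apply: ltnW; apply: ltn_trans n_lt.
  by move=> j hj s' bs'; apply: den_bounded => //; apply: hs; apply: ltn_trans hi.
- case/andP: hok => hv okb; move: hB hk hs; rewrite /= => hB hk hs.
  apply: for_ok => //; [by move=> s' m'; apply: rep_L|exact: L_lt|].
  move=> i m1 hi hm1; apply: ih => //; last exact: hs.
  apply: upd_bounded; last by apply: ltn_trans L_lt.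
  apply: for_bounded => //; first by apply: ltnW; apply: ltn_trans L_lt.
  by move=> j hj s' bs'; apply: den_bounded => //; apply: hs; apply: ltn_trans hi.
Qed.

End Correctness.
End Compiler.

Section Startup.
Variable NV : nat.
Hypothesis NV_gt1 : (1 < NV)%N.
Notation adr := (adr NV).
Let adr_ k i : adr k i = (NV.+1 * i + k)%N. Proof. by []. Qed.
Notation hid := (hid NV).

Fixpoint rpow (B : nat) : program :=
  if B is B'.+1
  then PSeq (rpow B') (PInstr (WBin WMul (hid 3) (hid 3) (hid 2)))
  else PInstr (WConst (hid 3) 1).

Definition double_up : program :=
  block (PInstr (WBin WAdd (hid 2) (hid 2) (hid 2)))
    [:: PInstr (WConst (hid 5) 1); PInstr (WBin WAdd (hid 1) (hid 1) (hid 5))].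

Definition startup (B : nat) : program :=
  block (PInstr (WMove (hid 0) (Direct 0)))
    [:: PInstr (WConst (hid 2) 1);
        PWhile (WLt (hid 2) (hid 0)) double_up;
        rpow B; PInstr (WConst (Direct 0) 0); PInstr (WConst (Direct 1) 1)].

Definition store0 : store := fun k i => if (k == 1%N) && (i == 0%N) then 1%N else 0%N.

Section Run.
Variables (R : realType) (n B kap : nat) (m0 : memory R).
Let L := up_log 2 n.
Let w := (kap * L)%N.
Hypothesis n_gt1 : (1 < n)%N.
Hypothesis B_gt1 : (1 < B)%N.
Hypothesis Bkap : (B < kap)%N.
Hypothesis m0_words : forall a, words m0 a = if a is 0 then n else 0%N.
Implicit Types (hv : nat -> nat) (m : memory R).

Lemma L_gt0 : (0 < L)%N. Proof. by rewrite up_log_gt0. Qed.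

Let P := (2 ^ L)%N.

Lemma word_lt x : (x <= P ^ B)%N -> (x < 2 ^ w)%N.
Proof.
move=> hx; rewrite /w mulnC expnM; apply: leq_ltn_trans hx _.
by rewrite ltn_exp2l // (P_gt1 L_gt0).
Qed.

Let P_le : (P <= P ^ B)%N.
Proof. by rewrite -[leqLHS]expn1 leq_exp2l // ?(P_gt1 L_gt0) // ltnW. Qed.

Let n_le : (n <= P)%N. Proof. exact: up_logP. Qed.

Record booting hv m : Prop := Booting {
  boot_hid : forall i, words m (adr NV i) = hv i;
  boot_words : forall k i, (k < NV)%N ->
    words m (adr k i) = if (k == 0%N) && (i == 0%N) then n else 0%N;
  boot_reals : reals m = reals m0 }.

Lemma booting_wset hv m i v : booting hv m ->
  booting (update hv i v) (wset m (adr NV i) v).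
Proof.
move=> [hh hw hr]; split=> //= [j|k j hk]; rewrite /update.
  by rewrite hid_eq hh.
by rewrite adr_eq ?(ltnW hk) // (ltn_eqF hk) /= hw.
Qed.

Lemma boot_const hv m i v : booting hv m -> (v <= P ^ B)%N ->
  exists2 m', halts w (PInstr (WConst (hid i) v)) m m' 1 &
    booting (update hv i v) m'.
Proof.
move=> hm hv'; exists (wset m (adr NV i) v); last exact: booting_wset.
by apply: halts_instr; rewrite /= /set_word word_lt.
Qed.

Lemma boot_bin hv m op i a b : booting hv m ->
  (eval_word_op op (hv a) (hv b) <= P ^ B)%N ->
  exists2 m', halts w (PInstr (WBin op (hid i) (hid a) (hid b))) m m' 1 &
    booting (update hv i (eval_word_op op (hv a) (hv b))) m'.
Proof.
move=> hm hv'.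
exists (wset m (adr NV i) (eval_word_op op (hv a) (hv b))); last exact: booting_wset.
by apply: halts_instr; rewrite /= /set_word /get_word /= !(boot_hid hm) word_lt.
Qed.

Lemma boot_double r j hv m : (j + r = L)%N -> booting hv m ->
  hv 0%N = n -> hv 1%N = j -> hv 2 = (2 ^ j)%N ->
  exists m' hv', [/\ halts w (PWhile (WLt (hid 2) (hid 0)) (double_up)) m m'
    (1 + r * 6), booting hv' m', hv' 0%N = n, hv' 1%N = L & hv' 2 = P].
Proof.
elim: r j hv m => [|r ih] j hv m hj hm h0 h1 h2.
  move: hj; rewrite addn0 => hj; exists m, hv; split=> //; rewrite ?h1 ?h2 ?hj //.
  apply: halts_while_end; rewrite /= /get_word /= !(boot_hid hm) h2 h0 hj.
  by rewrite ltnNge n_le.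
have hp : (2 ^ j.+1 <= P)%N by rewrite leq_exp2l //; lia.
have hlt : (2 ^ j < n)%N.
  by rewrite ltnNge; apply/negP => /(up_log_min (isT : 1 < 2)%N); rewrite -/L; lia.
have e2 : eval_word_op WAdd (hv 2) (hv 2) = (2 ^ j.+1)%N.
  by rewrite /= h2 addnn -mul2n expnS.
have [|m1 r1 hm1] := @boot_bin hv m WAdd 2 2 2 hm.
  by rewrite e2; apply: leq_trans hp P_le.
have [|m2 r2 hm2] := @boot_const _ _ 5 1 hm1; first by rewrite expn_gt0 expn_gt0.
have [|m3 r3 hm3] := @boot_bin _ _ WAdd 1 1 5 hm2.
  rewrite /= /update /= h1; apply: leq_trans P_le; apply: ltnW.
  by apply: leq_ltn_trans (ltn_expl L (isT : 1 < 2)%N); lia.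
have [||||m4 [hv4 [r4 hm4 e0 e1 e2']]] := ih j.+1 _ _ _ hm3.
- by lia.
- by rewrite /update.
- by rewrite /update /= h1 addn1.
- by rewrite /update /= -e2.
exists m4, hv4; split=> //.
have -> : (1 + r.+1 * 6 = (((1 + 1).+1 + 1).+1 + (1 + r * 6)).+1)%N by lia.
apply: halts_while_step (halts_seq (halts_seq r1 r2) r3) r4.
by rewrite /= /get_word /= !(boot_hid hm) h2 h0.
Qed.

Lemma boot_pow b hv m : (b <= B)%N -> booting hv m ->
  hv 0%N = n -> hv 1%N = L -> hv 2 = P ->
  exists m' hv', halts w (rpow b) m m' (1 + 2 * b) /\ [/\ booting hv' m',
    hv' 0%N = n, hv' 1%N = L, hv' 2 = P & hv' 3 = (P ^ b)%N].
Proof.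
move=> + hm h0 h1 h2; elim: b => [|b ih] hb.
  have [|m1 r1 hm1] := @boot_const _ _ 3 1 hm; first by rewrite expn_gt0 expn_gt0.
  by exists m1; eexists; split; [exact: r1|split; first exact: hm1]; rewrite /update.
have [m1 [hv1 [r1 [hm1 e0 e1 e2 e3]]]] := ih (ltnW hb).
have e4 : eval_word_op WMul (hv1 3) (hv1 2) = (P ^ b.+1)%N.
  by rewrite /= e2 e3 expnSr.
have [|m2 r2 hm2] := @boot_bin _ _ WMul 3 3 2 hm1.
  by rewrite e4 leq_exp2l // (P_gt1 L_gt0).
exists m2; eexists; split; last by split; first exact: hm2; rewrite /update /=.
have -> : (1 + 2 * b.+1 = (1 + 2 * b + 1).+1)%N by lia.
exact: halts_seq r1 r2.
Qed.

Lemma startup_ok : exists2 m', halts w (startup B) m0 m' (11 + 2 * B + 6 * L) &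
  rep NV n L B (reals m0) store0 m'.
Proof.
have hm0 : booting (fun=> 0%N) m0.
  split=> // [i|k i hk]; rewrite m0_words adr_.
    have : (0 < NV.+1 * i + NV)%N by lia.
    by case: (NV.+1 * i + NV)%N.
  by case: k i hk => [|k] [|i] hk; rewrite ?muln0 ?addnS ?mulnS.
have r1 : halts w (PInstr (WMove (hid 0) (Direct 0))) m0 (wset m0 (adr NV 0) n) 1.
  apply: halts_instr; rewrite /= /set_word /get_word /= m0_words word_lt //.
  exact: leq_trans n_le P_le.
have hm1 := booting_wset 0 n hm0.
have [|m2 r2 hm2] := @boot_const _ _ 2 1 hm1; first by rewrite expn_gt0 expn_gt0.
have [||||m3 [hv3 [r3 hm3 a0 a1 a2]]] := @boot_double L 0%N _ _ _ hm2 => //.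
have [m4 [hv4 [r4 [[hh hw hr] e0 e1 e2 e3]]]] := boot_pow (leqnn B) hm3 a0 a1 a2.
have ltw x : (x <= 1)%N -> (x < 2 ^ w)%N.
  by move=> hx; apply: word_lt; apply: leq_trans hx _; rewrite expn_gt0 expn_gt0.
exists (wset (wset m4 0 0) 1 1).
  have -> : (11 + 2 * B + 6 * L = (((((1 + 1).+1 + (1 + L * 6)).+1 + (1 + 2 * B)).+1
    + 1).+1 + 1).+1)%N by lia.
  apply: halts_seq; last by apply: halts_instr; rewrite /= /set_word ltw.
  apply: halts_seq; last by apply: halts_instr; rewrite /= /set_word ltw.
  exact: halts_seq (halts_seq (halts_seq r1 r2) r3) r4.
have hidE i : words (wset (wset m4 0 0) 1 1) (adr NV i) = hv4 i.
  by rewrite /= /update -hh !ifN // adr_; lia.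
split; rewrite ?hidE //.
- move=> k i hk; rewrite /= /update hw // /store0.
  have -> : (adr k i == 1%N) = (k == 1%N) && (i == 0%N).
    rewrite (_ : (adr k i == 1%N) = (adr k i == adr 1 0)).
      by rewrite adr_eq // ltnW // ltnW.
    by rewrite [adr 1 0]adr_ muln0.
  have -> : (adr k i == 0%N) = (k == 0%N) && (i == 0%N).
    rewrite (_ : (adr k i == 0%N) = (adr k i == adr 0 0)).
      by rewrite adr_eq // ltnW // ltnW.
    by rewrite [adr 0 0]adr_ muln0.
  by case: ((k == 1%N) && _) => //; case: (_ && _).
- by move=> a _ /=; rewrite hr.
Qed.

End Run.

Fixpoint degN (s : stmt) : nat :=
  match s with
  | Skip | Store _ _ _ => 0
  | Seq a b | If _ a b => maxn (degN a) (degN b)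
  | ForN _ b => (degN b).+1
  | ForL _ b => degN b
  end.

Fixpoint degL (s : stmt) : nat :=
  match s with
  | Skip | Store _ _ _ => 0
  | Seq a b | If _ a b => maxn (degL a) (degL b)
  | ForN _ b => degL b
  | ForL _ b => (degL b).+1
  end.

Lemma cost_poly n L s d : (0 < n)%N -> (0 < L)%N ->
  (cost NV n L s d <= cost NV 1 1 s d * (n ^ degN s * L ^ degL s))%N.
Proof.
move=> n0 L0.
have mono a b a' b' : (a <= a')%N -> (b <= b')%N ->
    (n ^ a * L ^ b <= n ^ a' * L ^ b')%N.
  by move=> ha hb; apply: leq_mul; apply: leq_pexp2l.
have pos a b : (0 < n ^ a * L ^ b)%N by rewrite muln_gt0 !expn_gt0 n0 L0.
elim: s d => [|k a e|a iha b ihb|t a iha b ihb|v b ih|v b ih] d.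
- by rewrite /= !muln1.
- by rewrite leq_pmulr.
- have /= := pos (maxn (degN a) (degN b)) (maxn (degL a) (degL b)).
  have := mono _ _ _ _ (leq_maxl (degN a) (degN b)) (leq_maxl (degL a) (degL b)).
  have := mono _ _ _ _ (leq_maxr (degN a) (degN b)) (leq_maxr (degL a) (degL b)).
  move: (iha d) (ihb d) => /=; set x := (n ^ _ * _)%N; set y := (n ^ _ * _)%N.
  set z := (n ^ _ * _)%N; nia.
- have /= := pos (maxn (degN a) (degN b)) (maxn (degL a) (degL b)).
  have := mono _ _ _ _ (leq_maxl (degN a) (degN b)) (leq_maxl (degL a) (degL b)).
  have := mono _ _ _ _ (leq_maxr (degN a) (degN b)) (leq_maxr (degL a) (degL b)).
  move: (iha d) (ihb d) => /=; set x := (n ^ _ * _)%N; set y := (n ^ _ * _)%N.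
  set z := (n ^ _ * _)%N; nia.
- move: (ih d.+1) => /=; rewrite expnS -mulnA; have := pos (degN b) (degL b).
  set x := (n ^ _ * _)%N; nia.
- move: (ih d.+1) => /=; rewrite expnS [(L * _)%N]mulnC mulnA.
  have := pos (degN b) (degL b); set x := (n ^ _ * _)%N; nia.
Qed.

Section Whole.
Variable main : stmt.
Hypothesis okm : oks NV main.
Hypothesis degNm : (degN main <= 1)%N.
Hypothesis degLm : (degL main <= 1)%N.

Let B := (NV.+3 + ws NV main)%N.
Definition whole_kappa := (B + rs main + 1)%N.
Definition whole := PSeq (startup B) (cs NV main 0).

Lemma whole_ok (R : realType) : exists C, forall (y : 'rV[R]_3) (S : seq 'rV[R]_3),
  let L := up_log 2 (size S) in
  let s := den (size S) L (reals (input y S)) main store0 in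
  (1 < size S)%N -> safe (size S) L (reals (input y S)) main store0 ->
  exists m' t, [/\ halts (word_length whole_kappa (size S)) whole (input y S) m' t,
    (t <= C * (size S * L))%N, words m' 0 = s 0%N 0%N & words m' 1 = s 1%N 0%N].
Proof.
exists (15 + 2 * B + 6 + cost NV 1 1 main 0)%N => y S L s n1 hs.
have L0 : (0 < L)%N by rewrite up_log_gt0.
have [m1 r1 hm1] : exists2 m', halts (word_length whole_kappa (size S)) (startup B)
    (input y S) m' (11 + 2 * B + 6 * L) &
    rep NV (size S) L B (reals (input y S)) store0 m'.
  by apply: startup_ok => //; rewrite /whole_kappa; lia.
have bs0 : bounded L store0.
  move=> k i; rewrite /store0; apply: (@leq_ltn_trans 1); first by case: ifP.
  by rewrite -expnM -{1}(expn0 2) ltn_exp2l //; lia.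
have [|||||m2 [t [r2 le2 hm2 _]]] := @cs_ok NV R (size S) L B whole_kappa _
  L0 _ _ _ main 0 _ _ hm1 bs0 hs okm;
  [by apply: up_logP|by rewrite /whole_kappa; lia..|].
exists m2, (11 + 2 * B + 6 * L + t).+1; split.
- exact: halts_seq r1 r2.
- have h := cost_poly main 0 (ltnW n1) L0.
  have h' : (size S ^ degN main * L ^ degL main <= size S * L)%N.
    by apply: leq_mul; rewrite -[leqRHS]expn1 leq_pexp2l // ltnW.
  have : (t <= cost NV 1 1 main 0 * (size S * L))%N.
    by apply: leq_trans le2 (leq_trans h _); rewrite leq_mul2l h' orbT.
  nia.
- by rewrite /s -(rep_words hm2) ?(ltnW NV_gt1) // adr_ muln0.
- by rewrite /s -(rep_words hm2) // adr_ muln0.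
Qed.

End Whole.
End Startup.

Definition prec (R : realType) (kv : nat -> R) (x y : nat) : bool :=
  (kv x < kv y) || (kv x == kv y) && (x < y)%N.

Lemma prec_le (R : realType) (kv : nat -> R) x y : prec kv x y -> kv x <= kv y.
Proof. by case/orP => [/ltW|/andP[/eqP->]]. Qed.

(** * Cones and spanners *)

Section Spanner.
Variable R : realType.

(* The points of the cone at [a] whose directions have slope between
   [cone_slope m j] and [cone_slope m j + 2 / m] are those that do not exceed [a]
   in the keys [cone_key1] and [cone_key2]. *)
Definition cone_slope (m j : nat) : rat := (j%:Q - 1) / m%:Q - 1.

Definition cone_key1 (m j : nat) (p1 p2 : nat -> R) (i : nat) : R :=
  ratr (cone_slope m j) * p1 i - p2 i.
Definition cone_key2 (m j : nat) (p1 p2 : nat -> R) (i : nat) : R :=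
  p2 i - ratr (cone_slope m j + 2 / m%:Q) * p1 i.

Lemma ratr_cone_slope m j : ratr (cone_slope m j) = (j%:R - 1) / m%:R - 1 :> R.
Proof.
by rewrite /cone_slope -!pmulrn !(rmorphB, rmorph1, fmorph_div) /= !(rmorphB, rmorph1, ratr_nat).
Qed.

Lemma ratr_cone_slope2 m j :
  ratr (cone_slope m j + 2 / m%:Q) = (j%:R + 1) / m%:R - 1 :> R.
Proof.
rewrite rmorphD /= ratr_cone_slope -pmulrn fmorph_div /= !ratr_nat.
by rewrite -addrA [-1 + _]addrC addrA -mulrDl; congr (_ / _ - _); lra.
Qed.

Record seminorm (nu : R -> R -> R) : Prop := Seminorm {
  nuD : forall a b c d, nu (a + c) (b + d) <= nu a b + nu c d;
  nuZ : forall t a b, nu (t * a) (t * b) = `|t| * nu a b }.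

Section Step.
Variables (n m : nat) (av : nat -> bool) (p1 p2 : nat -> R) (nu : R -> R -> R).
Variables (edge : nat -> nat -> Prop) (e1 : R).
Hypothesis m_gt0 : (0 < m)%N.
Hypothesis e1_ge0 : 0 <= e1.
Hypothesis nuP : seminorm nu.
Hypothesis nu_gt0 : forall a b, a != 0 -> 0 < nu a b.
Hypothesis nu_cone : forall sl, 2 / m%:R * (2 + e1) * nu 0 1 <= e1 * nu 1 sl.
Hypothesis edge_neq : forall i j, (i < n)%N -> (j < n)%N -> av i -> av j ->
  edge i j -> p1 i = p1 j -> p2 i = p2 j -> False.
Hypothesis edgeP : forall j, (j <= 2 * m)%N -> forall a b, (a < n)%N -> (b < n)%N ->
  av a -> av b -> prec (cone_key1 m j p1 p2) b a -> prec (cone_key2 m j p1 p2) b a ->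
  exists b', [/\ (b' < n)%N, av b', prec (cone_key1 m j p1 p2) b' a,
    prec (cone_key2 m j p1 p2) b' a & p1 b' <= p1 b /\ edge a b'].

Lemma spanner_step a b : (a < n)%N -> (b < n)%N -> av a -> av b ->
  `|p2 b - p2 a| <= p1 b - p1 a ->
  p1 a < p1 b \/ (p1 a = p1 b /\ p2 a = p2 b) /\ (b < a)%N ->
  exists b', [/\ (b' < n)%N, av b', edge a b', 0 < nu (p1 b' - p1 a) (p2 b' - p2 a) &
    nu (p1 b' - p1 a) (p2 b' - p2 a) + (1 + e1) * nu (p1 b - p1 b') (p2 b - p2 b')
      <= (1 + e1) * nu (p1 b - p1 a) (p2 b - p2 a)].
Proof.
move=> ha hb aa ab hslope hab.
have m0 : 0 < m%:R :> R by rewrite ltr0n.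
have m0' : m%:R != 0 :> R by rewrite gt_eqF.
pose i := m%:R^-1 : R; have i0 : 0 < i by rewrite invr_gt0.
pose t := p1 b - p1 a.
have [j [sl [jm h1 h2 hsl hj]]] : exists j sl, [/\ (j <= 2 * m)%N,
    prec (cone_key1 m j p1 p2) b a, prec (cone_key2 m j p1 p2) b a,
    p2 b - p2 a = sl * t & ((j%:R - 1) * i - 1 <= sl <= (j%:R + 1) * i - 1)].
  case: hab => [lt|[[e1' e2'] lt]]; last first.
    exists 0%N, (-1); split=> //.
    - by rewrite /prec /cone_key1 e1' e2' eqxx lt orbT.
    - by rewrite /prec /cone_key2 e1' e2' eqxx lt orbT.
    - by rewrite /t e1' e2' !subrr mulr0.
    - by apply/andP; split; lra.
  have t0 : 0 < t by rewrite /t subr_gt0.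
  pose sl := (p2 b - p2 a) / t.
  have hsl : p2 b - p2 a = sl * t by rewrite /sl divfK // gt_eqF.
  have /andP[hsl1 hsl2] : -1 <= sl <= 1.
    move: hslope; rewrite hsl -/t normrM (gtr0_norm t0) -{2}[t]mul1r.
    by rewrite ler_pM2r // ler_norml.
  pose v := (sl + 1) * m%:R.
  have v0 : 0 <= v by rewrite mulr_ge0 ?ler0n //; lra.
  have /andP[j1 j2] := truncn_itv v0.
  pose j := Num.truncn v; rewrite -/j in j1 j2.
  have vE : v * i = sl + 1 by rewrite /v mulfK.
  have {}j1 : j%:R * i <= sl + 1 by rewrite -vE ler_pM2r.
  have {}j2 : sl + 1 < (j%:R + 1) * i by rewrite -vE ltr_pM2r // -natr1 in j2 *.
  exists j, sl; split=> //.
  - rewrite -(ler_nat R); have h2m : j%:R <= (sl + 1) * m%:R.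
      by rewrite -ler_pdivrMr.
    by apply: le_trans h2m _; rewrite natrM ler_pM2r //; lra.
  - apply/orP; left; rewrite /cone_key1 ratr_cone_slope -/i -subr_gt0.
    have -> : ((j%:R - 1) * i - 1) * p1 a - p2 a - (((j%:R - 1) * i - 1) * p1 b - p2 b) =
      (sl - ((j%:R - 1) * i - 1)) * t.
      by rewrite [RHS]mulrBl -hsl /t; ring.
    by apply: mulr_gt0 => //; lra.
  - apply/orP; left; rewrite /cone_key2 ratr_cone_slope2 -/i -subr_gt0.
    have -> : p2 a - ((j%:R + 1) * i - 1) * p1 a - (p2 b - ((j%:R + 1) * i - 1) * p1 b) =
      (((j%:R + 1) * i - 1) - sl) * t.
      by rewrite [RHS]mulrBl -hsl /t; ring.
    by apply: mulr_gt0 => //; lra.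
  - by apply/andP; split; lra.
have [b' [hb' ab' /prec_le p1' /prec_le p2' [tb' hedge]]] := edgeP jm ha hb aa ab h1 h2.
move: p1' p2'; rewrite /cone_key1 /cone_key2 ratr_cone_slope ratr_cone_slope2 -/i.
set lo := (j%:R - 1) * i - 1 in hj *; set hi := (j%:R + 1) * i - 1 in hj * => q1 q2.
have hilo : hi - lo = 2 * i by rewrite /hi /lo; lra.
pose t' := p1 b' - p1 a; pose d' := p2 b' - p2 a.
have {}q1 : lo * t' <= d' by rewrite /t' /d'; lra.
have {}q2 : d' <= hi * t' by rewrite /t' /d'; lra.
have t'0 : 0 <= t'.
  have : 0 <= (hi - lo) * t' by rewrite mulrBl; lra.
  by rewrite hilo pmulr_rge0 // mulr_gt0.
have t'gt0 : 0 < t'.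
  rewrite lt_neqAle t'0 andbT eq_sym; apply/eqP => e0.
  have d0 : d' = 0 by move: q1 q2; rewrite e0 !mulr0; lra.
  by apply: (edge_neq ha hb' aa ab' hedge); [move: e0|move: d0]; rewrite /t' /d'; lra.
have t'neq : t' != 0 by rewrite gt_eqF.
pose sl' := d' / t'; have hsl' : d' = sl' * t' by rewrite /sl' divfK.
have h1' : lo <= sl' by rewrite -(ler_pM2r t'gt0) -hsl'.
have h2' : sl' <= hi by rewrite -(ler_pM2r t'gt0) -hsl'.
have hdiff : `|sl' - sl| <= 2 * i by rewrite ler_norml; apply/andP; split; lra.
have htt : 0 <= t - t' by rewrite /t /t'; lra.
have n01 : 0 <= nu 0 1.
  by have := nuD nuP 0 1 0 (-1); have := nuZ nuP 0 0 0; have := nuZ nuP (-1) 0 1;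
    rewrite normrN1 mul1r mulr0 mulN1r normr0 mul0r addr0 subrr => -> ->; lra.
have N1 : nu t' d' <= t' * nu 1 sl + 2 * i * t' * nu 0 1.
  have -> : nu t' d' = nu (t' * 1 + t' * 0) (t' * sl + t' * (sl' - sl)).
    by rewrite mulr0 addr0 mulr1 hsl' -mulrDr addrC subrK mulrC.
  apply: le_trans (nuD nuP _ _ _ _) _; rewrite (nuZ nuP) (gtr0_norm t'gt0) lerD2l.
  have -> : nu (t' * 0) (t' * (sl' - sl)) = nu ((t' * (sl' - sl)) * 0) ((t' * (sl' - sl)) * 1).
    by rewrite !mulr0 mulr1.
  rewrite (nuZ nuP) normrM (gtr0_norm t'gt0); apply: ler_wpM2r => //.
  by rewrite mulrC; apply: ler_wpM2r.
have N2 : nu (p1 b - p1 b') (p2 b - p2 b') <= (t - t') * nu 1 sl + 2 * i * t' * nu 0 1.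
  have -> : nu (p1 b - p1 b') (p2 b - p2 b') =
      nu ((t - t') * 1 + (t' * (sl - sl')) * 0) ((t - t') * sl + (t' * (sl - sl')) * 1).
    congr (nu _ _); first by rewrite /t /t'; ring.
    have -> : p2 b - p2 b' = sl * t - d' by rewrite -hsl /d'; ring.
    by rewrite hsl'; ring.
  apply: le_trans (nuD nuP _ _ _ _) _; rewrite !(nuZ nuP) (ger0_norm htt) lerD2l.
  rewrite normrM (gtr0_norm t'gt0); apply: ler_wpM2r => //.
  by rewrite mulrC distrC; apply: ler_wpM2r.
have N3 : nu (p1 b - p1 a) (p2 b - p2 a) = t * nu 1 sl.
  rewrite hsl -/t -{1}[t]mulr1 [sl * t]mulrC (nuZ nuP) ger0_norm //; lra.
exists b'; split=> //; first exact: nu_gt0.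
rewrite -/t' -/d' N3.
have := nu_cone sl; rewrite -/i => hc.
have hc' : t' * (2 * i * (2 + e1) * nu 0 1) <= t' * (e1 * nu 1 sl) by rewrite ler_pM2l.
have N2' : (1 + e1) * nu (p1 b - p1 b') (p2 b - p2 b') <=
   (1 + e1) * ((t - t') * nu 1 sl + 2 * i * t' * nu 0 1).
  exact: ler_wpM2l (addr_ge0 ler01 e1_ge0) _ _ N2.
apply: le_trans (lerD N1 N2') _; rewrite -subr_ge0.
have -> : (1 + e1) * (t * nu 1 sl) - (t' * nu 1 sl + 2 * i * t' * nu 0 1 +
  (1 + e1) * ((t - t') * nu 1 sl + 2 * i * t' * nu 0 1)) =
  t' * (e1 * nu 1 sl) - t' * (2 * i * (2 + e1) * nu 0 1) by ring.
by rewrite subr_ge0.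
Qed.

End Step.

Section SpannerLip.
Variables (n m : nat) (av : nat -> bool) (p1 p2 g : nat -> R) (nu : R -> R -> R).
Variables (edge : nat -> nat -> Prop) (e1 kap : R).
Hypothesis m_gt0 : (0 < m)%N.
Hypothesis e1_ge0 : 0 <= e1.
Hypothesis kap_ge0 : 0 <= kap.
Hypothesis nuP : seminorm nu.
Hypothesis nu_gt0 : forall a b, (a != 0) || (b != 0) -> 0 < nu a b.
Hypothesis nu_cone1 : forall sl, 2 / m%:R * (2 + e1) * nu 0 1 <= e1 * nu 1 sl.
Hypothesis nu_cone2 : forall sl, 2 / m%:R * (2 + e1) * nu 1 0 <= e1 * nu sl 1.
Hypothesis edge_neq : forall i j, (i < n)%N -> (j < n)%N -> av i -> av j ->
  edge i j -> p1 i = p1 j -> p2 i = p2 j -> False.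
Hypothesis edge_lip : forall i j, (i < n)%N -> (j < n)%N -> av i -> av j ->
  edge i j -> `|g i - g j| <= kap * nu (p1 j - p1 i) (p2 j - p2 i).

Definition cone_edges (q1 q2 : nat -> R) := forall j, (j <= 2 * m)%N ->
  forall a b, (a < n)%N -> (b < n)%N -> av a -> av b ->
  prec (cone_key1 m j q1 q2) b a -> prec (cone_key2 m j q1 q2) b a ->
  exists b', [/\ (b' < n)%N, av b', prec (cone_key1 m j q1 q2) b' a,
    prec (cone_key2 m j q1 q2) b' a & q1 b' <= q1 b /\ edge a b'].

Hypothesis edges1 : cone_edges p1 p2.
Hypothesis edges2 : cone_edges p2 p1.

Let dist a b := nu (p1 b - p1 a) (p2 b - p2 a).

Lemma nu_sym a b : nu (- a) (- b) = nu a b.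
Proof. by have := nuZ nuP (-1) a b; rewrite !mulN1r normrN1 mul1r. Qed.

Let dist_sym a b : dist a b = dist b a.
Proof. by rewrite /dist -nu_sym !opprB. Qed.

(* A pair violating the bound at minimal distance can be shortened by its
   first cone edge. *)
Lemma spanner_lip a b : (a < n)%N -> (b < n)%N -> av a -> av b ->
  `|g a - g b| <= (1 + e1) * kap * dist a b.
Proof.
move=> ha hb aa ab; rewrite leNgt; apply/negP => hviol.
pose viol (p : 'I_n * 'I_n) := [&& av p.1, av p.2 &
  (1 + e1) * kap * dist p.1 p.2 < `|g p.1 - g p.2|].
have viol0 : viol (Ordinal ha, Ordinal hb) by rewrite /viol /= aa ab.
case: (@arg_minP _ R _ _ viol (fun p => dist p.1 p.2) viol0).
move=> {viol0 hviol aa ab ha hb a b} [[a ha] [b hb]] /and3P[/= aa ab v] vmin.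
have no_step c d : (c < n)%N -> (d < n)%N -> av c -> av d -> dist c d = dist a b ->
    `|g c - g d| = `|g a - g b| ->
    ~ exists b', [/\ (b' < n)%N, av b', edge c b', 0 < dist c b' &
      dist c b' + (1 + e1) * dist b' d <= (1 + e1) * dist c d].
  move=> hc hd ac ad ed eg [b' [hb' ab' eb' d0 hle]].
  have short : dist b' d < dist a b.
    have e10 : 0 < 1 + e1 by rewrite ltr_pwDl.
    by rewrite -ed -(ltr_pM2l e10); apply: lt_le_trans hle; rewrite ltrDr.
  have ok : `|g b' - g d| <= (1 + e1) * kap * dist b' d.
    rewrite leNgt; apply/negP => hv.
    have := vmin (Ordinal hb', Ordinal hd); rewrite /viol /= ab' ad hv => /(_ isT).
    by rewrite leNgt short.
  have lip := edge_lip hc hb' ac ab' eb'; rewrite -/(dist _ _) in lip.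
  suff : `|g c - g d| <= (1 + e1) * kap * dist c d by rewrite eg ed leNgt v.
  apply: le_trans (ler_distD (g b') _ _) _; apply: le_trans (lerD lip ok) _.
  have -> : (1 + e1) * kap * dist c d = kap * ((1 + e1) * dist c d) by ring.
  apply: le_trans (ler_wpM2l kap_ge0 hle).
  by rewrite mulrDr mulrCA mulrA.
have [e12|] := boolP ((p1 a == p1 b) && (p2 a == p2 b)).
  have [/eqP e1' /eqP e2'] := andP e12.
  have hab : a != b.
    by apply: contraTneq v => ->; rewrite /dist !subrr normr0 -leNgt mulr_ge0 ?mulr_ge0
      ?addr_ge0 // -[X in nu X _](mulr0 0) -[X in nu _ X](mulr0 0) (nuZ nuP) normr0 mul0r.
  have [hlt|hlt|e] := ltngtP a b; last by rewrite e eqxx in hab.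
    apply: (no_step b a) => //; [exact: distrC|].
    have [|||b' [h1 h2 h3 h4 h5]] := spanner_step m_gt0 e1_ge0 nuP _ nu_cone1 edge_neq
      edges1 hb ha ab aa.
    - by move=> x y x0; apply: nu_gt0; rewrite x0.
    - by rewrite e1' e2' !subrr normr0.
    - by right.
    by exists b'.
  apply: (no_step a b) => //.
  have [|||b' [h1 h2 h3 h4 h5]] := spanner_step m_gt0 e1_ge0 nuP _ nu_cone1 edge_neq
      edges1 ha hb aa ab.
  - by move=> x y x0; apply: nu_gt0; rewrite x0.
  - by rewrite e1' e2' !subrr normr0.
  - by right.
  by exists b'.
rewrite negb_and => hne.
have step1 c d : (c < n)%N -> (d < n)%N -> av c -> av d ->
    `|p2 d - p2 c| <= p1 d - p1 c -> p1 c < p1 d ->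
    exists b', [/\ (b' < n)%N, av b', edge c b', 0 < dist c b' &
      dist c b' + (1 + e1) * dist b' d <= (1 + e1) * dist c d].
  move=> hc hd ac ad h1 h2.
  apply: (spanner_step m_gt0 e1_ge0 nuP _ nu_cone1 edge_neq edges1 hc hd ac ad h1) => //.
    by move=> x y x0; apply: nu_gt0; rewrite x0.
  by left.
have step2 c d : (c < n)%N -> (d < n)%N -> av c -> av d ->
    `|p1 d - p1 c| <= p2 d - p2 c -> p2 c < p2 d ->
    exists b', [/\ (b' < n)%N, av b', edge c b', 0 < dist c b' &
      dist c b' + (1 + e1) * dist b' d <= (1 + e1) * dist c d].
  move=> hc hd ac ad h1 h2.
  have nuP' : seminorm (fun x y => nu y x).
    by split=> [x y z t|t x y]; [apply: (nuD nuP)|apply: (nuZ nuP)].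
  apply: (spanner_step m_gt0 e1_ge0 nuP' _ nu_cone2 _ edges2 hc hd ac ad h1) => //.
  - by move=> x y x0; apply: nu_gt0; rewrite x0 orbT.
  - by move=> i j hi hj ai aj eij e2' e1'; apply: (edge_neq hi hj ai aj eij).
  - by left.
have [h12|h12] := lerP `|p2 b - p2 a| `|p1 b - p1 a|.
  have hp1 : p1 a != p1 b.
    apply: contraTneq h12 => e; move: hne; rewrite e eqxx /= subrr normr0 => hne.
    by rewrite -ltNge normr_gt0 subr_eq0 eq_sym.
  case: ltgtP hp1 => // hlt _.
    apply: (no_step a b) => //; apply: step1 => //.
    by rewrite -[leRHS]ger0_norm ?subr_ge0 ?(ltW hlt).
  apply: (no_step b a) => //; [exact: distrC|]; apply: step1 => //.
  by rewrite -[leRHS]ger0_norm ?subr_ge0 ?(ltW hlt) // distrC [leRHS]distrC.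
have hp2 : p2 a != p2 b.
  by apply: contraTneq h12 => e; rewrite e subrr normr0 -leNgt.
case: ltgtP hp2 => // hlt _.
  apply: (no_step a b) => //; apply: step2 => //.
  by rewrite -[leRHS]ger0_norm ?subr_ge0 ?(ltW hlt) ?(ltW h12).
apply: (no_step b a) => //; [exact: distrC|]; apply: step2 => //.
by rewrite -[leRHS]ger0_norm ?subr_ge0 ?(ltW hlt) // distrC [leRHS]distrC ltW.
Qed.

End SpannerLip.
End Spanner.

(** * Supporting planes *)

Section Planes.
Variables (R : realType) (x y z : nat -> R).
Implicit Types (i j : nat).

Definition cross2 i j : R :=
  (y i * z j - z i * y j) ^+ 2 + (z i * x j - x i * z j) ^+ 2
  + (x i * y j - y i * x j) ^+ 2.
Definition gap2 i j : R := (x i - x j) ^+ 2 + (y i - y j) ^+ 2 + (z i - z j) ^+ 2.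

(* The plane [w . v = dl] through the points [i] and [j] is at distance
   [dl / |w| >= dl / sqrt K] from the origin; with [K = 1] such a plane exists if
   and only if the line through [i] and [j] is at distance at least [dl]. *)
Definition plane (dl K : R) i j (w0 w1 w2 : R) :=
  [/\ w0 * x i + w1 * y i + w2 * z i = dl, w0 * x j + w1 * y j + w2 * z j = dl &
      w0 ^+ 2 + w1 ^+ 2 + w2 ^+ 2 <= K].

Lemma plane_dist dl K i j w0 w1 w2 : plane dl K i j w0 w1 w2 ->
  dl ^+ 2 * gap2 i j <= K * cross2 i j.
Proof.
move=> [hi hj hK].
apply: le_trans (ler_wpM2r _ hK); last by rewrite /cross2 !addr_ge0 // sqr_ge0.
rewrite -subr_ge0.
have -> : (w0 ^+ 2 + w1 ^+ 2 + w2 ^+ 2) * cross2 i j - dl ^+ 2 * gap2 i j =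
  (w0 * (y i * z j - z i * y j) + w1 * (z i * x j - x i * z j)
   + w2 * (x i * y j - y i * x j)) ^+ 2.
  have e0 : dl * (x i - x j) = w1 * (x i * y j - y i * x j) - w2 * (z i * x j - x i * z j).
    by rewrite mulrBr -{1}hj -hi; ring.
  have e1 : dl * (y i - y j) = w2 * (y i * z j - z i * y j) - w0 * (x i * y j - y i * x j).
    by rewrite mulrBr -{1}hj -hi; ring.
  have e2 : dl * (z i - z j) = w0 * (z i * x j - x i * z j) - w1 * (y i * z j - z i * y j).
    by rewrite mulrBr -{1}hj -hi; ring.
  rewrite /gap2 !mulrDr -!exprMn e0 e1 e2 /cross2; ring.
exact: sqr_ge0.
Qed.

Lemma plane_exists dl i j : 0 < cross2 i j -> dl ^+ 2 * gap2 i j <= cross2 i j ->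
  exists w0 w1 w2, plane dl 1 i j w0 w1 w2.
Proof.
move=> c0 hle; pose c := dl / cross2 i j.
pose n0 := y i * z j - z i * y j; pose n1 := z i * x j - x i * z j.
pose n2 := x i * y j - y i * x j.
have cE : c * cross2 i j = dl by rewrite /c divfK // gt_eqF.
exists (c * ((y j - y i) * n2 - (z j - z i) * n1)),
  (c * ((z j - z i) * n0 - (x j - x i) * n2)),
  (c * ((x j - x i) * n1 - (y j - y i) * n0)).
split.
- by rewrite -cE /cross2 /n0 /n1 /n2; ring.
- by rewrite -cE /cross2 /n0 /n1 /n2; ring.
- have -> : (c * ((y j - y i) * n2 - (z j - z i) * n1)) ^+ 2 +
    (c * ((z j - z i) * n0 - (x j - x i) * n2)) ^+ 2 +
    (c * ((x j - x i) * n1 - (y j - y i) * n0)) ^+ 2 =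
    dl ^+ 2 * gap2 i j / cross2 i j.
    have -> : dl ^+ 2 * gap2 i j / cross2 i j = c ^+ 2 * (gap2 i j * cross2 i j).
      by rewrite -cE; field; rewrite gt_eqF.
    by rewrite /gap2 /cross2 /n0 /n1 /n2; ring.
  by rewrite ler_pdivrMr // mul1r.
Qed.

End Planes.

Section Norm3.
Variable R : realType.
Implicit Types a b c x y z : R.

Definition norm3 a b c : R := Num.sqrt (a ^+ 2 + b ^+ 2 + c ^+ 2).

Lemma sumsq_ge0 a b c : 0 <= a ^+ 2 + b ^+ 2 + c ^+ 2.
Proof. by rewrite !addr_ge0 // sqr_ge0. Qed.

Lemma sqr_norm3 a b c : norm3 a b c ^+ 2 = a ^+ 2 + b ^+ 2 + c ^+ 2.
Proof. by rewrite sqr_sqrtr // sumsq_ge0. Qed.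

Lemma norm3_ge0 a b c : 0 <= norm3 a b c. Proof. exact: sqrtr_ge0. Qed.

Lemma ler_of_sqr x y : 0 <= y -> x ^+ 2 <= y ^+ 2 -> x <= y.
Proof.
move=> y0 h; case: (lerP 0 x) => [x0|/ltW x0]; last exact: le_trans y0.
by rewrite -(ler_pXn2r (n := 2)) // nnegrE.
Qed.

Lemma ler_norm_of_sqr x y : 0 <= y -> x ^+ 2 <= y ^+ 2 -> `|x| <= y.
Proof. by move=> y0 h; apply: ler_of_sqr => //; rewrite real_normK // num_real. Qed.

Lemma cauchy3_sqr a b c x y z : (a * x + b * y + c * z) ^+ 2 <=
  (a ^+ 2 + b ^+ 2 + c ^+ 2) * (x ^+ 2 + y ^+ 2 + z ^+ 2).
Proof.
rewrite -subr_ge0.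
have -> : (a ^+ 2 + b ^+ 2 + c ^+ 2) * (x ^+ 2 + y ^+ 2 + z ^+ 2) -
  (a * x + b * y + c * z) ^+ 2 =
  (a * y - b * x) ^+ 2 + (a * z - c * x) ^+ 2 + (b * z - c * y) ^+ 2 by ring.
exact: sumsq_ge0.
Qed.

Lemma cauchy3 a b c x y z : `|a * x + b * y + c * z| <= norm3 a b c * norm3 x y z.
Proof.
apply: ler_norm_of_sqr; first by rewrite mulr_ge0 ?norm3_ge0.
by rewrite exprMn !sqr_norm3 cauchy3_sqr.
Qed.

Lemma norm3D a b c x y z :
  norm3 (a + x) (b + y) (c + z) <= norm3 a b c + norm3 x y z.
Proof.
apply: ler_of_sqr; first by rewrite addr_ge0 ?norm3_ge0.
rewrite sqrrD !sqr_norm3.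
have := le_trans (ler_norm _) (cauchy3 a b c x y z); set p := _ * norm3 _ _ _.
rewrite mulr2n => h; nra.
Qed.

Lemma norm3Z t a b c : norm3 (t * a) (t * b) (t * c) = `|t| * norm3 a b c.
Proof. by rewrite /norm3 !exprMn -!mulrDr sqrtrM ?sqr_ge0 // sqrtr_sqr. Qed.

Lemma norm3_ge a b c : `|a| <= norm3 a b c.
Proof.
apply: ler_norm_of_sqr; first exact: norm3_ge0.
by rewrite sqr_norm3 -addrA lerDl addr_ge0 // sqr_ge0.
Qed.

End Norm3.

Lemma root_bound (R : realType) (U S tau q V : R) : 0 <= tau -> tau <= 1 -> 1 <= S ->
  S ^+ 2 = U -> 0 <= q -> 0 <= V -> V ^+ 2 = U - q + 2 * S * tau ->
  (V + tau * S) ^+ 2 <= U - q + 7 * tau * U.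
Proof.
move=> t0 t1 S1 S2 q0 V0 V2; have S0 : 0 <= S by lra.
have VS : V <= S + tau.
  apply: ler_of_sqr; first by lra.
  by rewrite V2 sqrrD S2 mulr2n; have := sqr_ge0 tau; lra.
rewrite sqrrD V2 exprMn S2 mulr2n.
have SU : S <= U by rewrite -S2 expr2 ler_peMl.
have h1 : S * tau <= U * tau by rewrite ler_wpM2r.
have h2 : V * (tau * S) <= (S + tau) * (tau * S) by rewrite ler_wpM2r ?mulr_ge0.
have h3 : (S + tau) * (tau * S) = U * tau + tau * (tau * S) by rewrite -S2; ring.
have h4 : tau * (tau * S) <= tau * U.
  by rewrite ler_wpM2l //; apply: le_trans SU; rewrite ler_piMl.
have h5 : tau ^+ 2 * U <= tau * U.
  by rewrite ler_wpM2r // -?S2 ?sqr_ge0 // expr2 ler_piMl.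
lra.
Qed.

Lemma cone_width_bound (R : realType) (i e q s : R) : 0 <= i -> i <= e / 15 ->
  0 < e -> e <= 1 -> q <= 5 -> 1 <= s -> i * (2 + e) * q <= e * s.
Proof.
move=> i0 ie e0 e1 q5 s1.
have h1 : i * (2 + e) * q <= i * (2 + e) * 5.
  by apply: ler_wpM2l => //; apply: mulr_ge0 => //; lra.
have h2 : i * (2 + e) <= e / 15 * 3 by apply: ler_pM => //; lra.
have h3 : e * 1 <= e * s by rewrite ler_pM2l.
lra.
Qed.

Lemma ler_sqr_norm (R : realType) (a c : R) : `|a| <= c -> a ^+ 2 <= c ^+ 2.
Proof.
move=> h; rewrite -[a ^+ 2]real_normK ?num_real // ler_pXn2r ?nnegrE //.
exact: le_trans h.
Qed.

Section Chart.
Variables (R : realType) (x y z : nat -> R) (dl : R) (n : nat) (av : nat -> bool).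
Hypothesis dl_gt0 : 0 < dl.
Hypothesis x_neq0 : forall i, (i < n)%N -> av i -> x i != 0.

Let p1 i := y i / x i.
Let p2 i := z i / x i.
Let f i := dl / x i.

Lemma chart_plane i w0 w1 w2 : x i != 0 ->
  (w0 * x i + w1 * y i + w2 * z i = dl) <-> (w0 + w1 * p1 i + w2 * p2 i = f i).
Proof.
move=> x0; rewrite /p1 /p2 /f; split=> [<-|h]; first by field.
have -> : w0 * x i + w1 * y i + w2 * z i = (w0 + w1 * (y i / x i) + w2 * (z i / x i)) * x i.
  by field.
by rewrite h; field.
Qed.

Section Local.
Variables (m : nat) (e1 tau : R).
Hypothesis e1_gt0 : 0 < e1.
Hypothesis e1_le1 : e1 <= 1.
Hypothesis m_large : 30 <= e1 * m%:R.
Hypothesis tau_ge0 : 0 <= tau.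
Hypothesis tau_le1 : tau <= 1.
Hypothesis p_le4 : forall i, (i < n)%N -> av i -> `|p1 i| <= 4 /\ `|p2 i| <= 4.
Hypothesis p_close : forall i j, (i < n)%N -> (j < n)%N -> av i -> av j ->
  3 * (`|p1 i - p1 j| + `|p2 i - p2 j|) <= tau.
Hypothesis gap_gt0 : forall i j, (i < n)%N -> (j < n)%N -> i != j -> 0 < gap2 x y z i j.
Hypothesis planes : forall i, (i < n)%N -> exists w0 w1 w2, plane x y z dl 1 i i w0 w1 w2.

Let edge i j := i != j /\ exists w0 w1 w2, plane x y z dl 1 i j w0 w1 w2.
Hypothesis edges1 : cone_edges n m av edge p1 p2.
Hypothesis edges2 : cone_edges n m av edge p2 p1.

Let m_gt0' : 0 < m%:R :> R.
Proof.
have h : 0 < e1 * m%:R by apply: lt_le_trans m_large.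
by rewrite pmulr_rgt0 in h.
Qed.

Let m_gt0 : (0 < m)%N. Proof. by rewrite -(ltr0n R). Qed.

Let two_m : 2 / m%:R <= e1 / 15.
Proof.
rewrite ler_pdivrMr //; have := m_large; lra.
Qed.

Let edge_neq i j : (i < n)%N -> (j < n)%N -> av i -> av j ->
  edge i j -> p1 i = p1 j -> p2 i = p2 j -> False.
Proof.
move=> hi hj ai aj [hij [w0 [w1 [w2 [h1 h2 _]]]]] e1' e2'.
have xi := x_neq0 hi ai; have xj := x_neq0 hj aj.
have fij : f i = f j.
  by rewrite -((chart_plane _ _ _ xi).1 h1) -((chart_plane _ _ _ xj).1 h2) e1' e2'.
have exx : x i = x j.
  have h : dl / x i * (x i * x j) = dl / x j * (x i * x j) by rewrite -/(f i) fij.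
  have h' : dl * x j = dl * x i.
    by move: h; rewrite mulrA divfK // [x i * x j]mulrC mulrA divfK.
  by apply: (mulfI (lt0r_neq0 dl_gt0)).
have eyy : y i = y j by rewrite -[LHS](divfK xi) -/(p1 i) e1' exx divfK.
have ezz : z i = z j by rewrite -[LHS](divfK xi) -/(p2 i) e2' exx divfK.
by have := gap_gt0 hi hj hij; rewrite /gap2 exx eyy ezz !subrr expr0n /= !addr0 ltxx.
Qed.

Let crude i j : (i < n)%N -> (j < n)%N -> av i -> av j ->
  `|f i - f j| <= 2 * (`|p1 i - p1 j| + `|p2 i - p2 j|).
Proof.
move=> hi hj ai aj.
have hs : seminorm (fun a b : R => `|a| + `|b|).
  split=> [a b c d|t a b]; last by rewrite !normrM -mulrDr.
  by have := ler_normD a c; have := ler_normD b d; lra.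
have n01 : `|0 : R| + `|1 : R| = 1 by rewrite normr0 normr1 add0r.
have cone sl : 2 / m%:R * (2 + 1) * 1 <= 1 * (1 + `|sl|) :> R.
  by have := normr_ge0 sl; have := two_m; have := e1_le1; lra.
suff : `|f i - f j| <= (1 + 1) * 1 * (`|p1 j - p1 i| + `|p2 j - p2 i|).
  by rewrite (distrC (p1 i)) (distrC (p2 i)); lra.
apply: (@spanner_lip R n m av p1 p2 f (fun a b : R => `|a| + `|b|) edge 1 1 m_gt0
  ler01 ler01 hs _ _ _ edge_neq _ edges1 edges2) => //.
- move=> a b /orP[|] h; last by rewrite ltr_wpDl // normr_gt0.
  by rewrite ltr_wpDr // normr_gt0.
- by move=> sl /=; rewrite n01 normr1.
- by move=> sl /=; rewrite [`|1| + `|0|]addrC n01 normr1 [`|sl| + 1]addrC.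
- move=> i' j' hi' hj' ai' aj' [_ [w0 [w1 [w2 [h1 h2 hw]]]]].
  have xi := x_neq0 hi' ai'; have xj := x_neq0 hj' aj'.
  rewrite -((chart_plane _ _ _ xi).1 h1) -((chart_plane _ _ _ xj).1 h2) mul1r.
  have -> : w0 + w1 * p1 i' + w2 * p2 i' - (w0 + w1 * p1 j' + w2 * p2 j') =
    - (w1 * (p1 j' - p1 i')) - w2 * (p2 j' - p2 i') by ring.
  have w1' : `|w1| <= 1.
    by apply: ler_norm_of_sqr => //; have := sqr_ge0 w0; have := sqr_ge0 w2; lra.
  have w2' : `|w2| <= 1.
    by apply: ler_norm_of_sqr => //; have := sqr_ge0 w0; have := sqr_ge0 w1; lra.
  apply: le_trans (ler_normB _ _) _; rewrite normrN !normrM.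
  by apply: lerD; rewrite -[leRHS]mul1r; apply: ler_wpM2r.
Qed.

(* Subtract from [f] the linear function of the plane that is farthest from the
   origin among those through [a].  The normal of a plane through a point near [a]
   differs from the normal of that one almost orthogonally to the direction of [a],
   so on edges the remainder [g] is Lipschitz for the norm orthogonal to the direction of [a], with
   constant close to [sqrt (1 - f(a)^2 / |(1, p(a))|^2)].  The spanner transfers
   this to the pair [a, b], and Pythagoras bounds the normal of their plane. *)
Lemma local_bound a b : (a < n)%N -> (b < n)%N -> av a -> av b -> a != b ->
  exists w0 w1 w2, plane x y z dl ((1 + e1) ^+ 2 * (1 + 7 * tau)) a b w0 w1 w2.
Proof.
move=> ha hb aa ab hab; have xa := x_neq0 ha aa; have xb := x_neq0 hb ab.
pose P := p1 a; pose Q := p2 a; pose U := 1 + P ^+ 2 + Q ^+ 2.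
have U1 : 1 <= U by rewrite /U -addrA lerDl addr_ge0 // sqr_ge0.
have U0 : 0 < U by lra.
have U0' : U != 0 by rewrite gt_eqF.
pose S := norm3 1 P Q.
have S2 : S ^+ 2 = U by rewrite sqr_norm3 expr1n.
have S1 : 1 <= S by have := norm3_ge 1 P Q; rewrite normr1.
have S0 : 0 <= S by lra.
have fS : `|f a| <= S.
  have [w0 [w1 [w2 [h _ hw]]]] := planes ha.
  rewrite -((chart_plane _ _ _ xa).1 h); apply: ler_norm_of_sqr => //.
  have -> : w0 + w1 * p1 a + w2 * p2 a = w0 * 1 + w1 * P + w2 * Q by rewrite mulr1.
  apply: le_trans (cauchy3_sqr _ _ _ _ _ _) _; rewrite expr1n -/U S2.
  by rewrite -[leRHS]mul1r; apply: ler_wpM2r => //; exact: ltW.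
have f2 : f a ^+ 2 <= U by rewrite -S2 -[f a ^+ 2]real_normK ?num_real // ler_pXn2r ?nnegrE.
pose T := U - f a ^+ 2 + 2 * S * tau.
have T0 : 0 <= T by rewrite /T addr_ge0 ?subr_ge0 // !mulr_ge0.
pose V := Num.sqrt T; have V2 : V ^+ 2 = T by rewrite sqr_sqrtr.
have V0 : 0 <= V by exact: sqrtr_ge0.
pose kap := (V + tau * S) / U.
have kap0 : 0 <= kap.
  by apply: divr_ge0 (ltW U0); apply: addr_ge0 => //; apply: mulr_ge0.
pose nu (v1 v2 : R) := norm3 v1 v2 (v1 * Q - v2 * P).
have nuP : seminorm nu.
  split=> [a1 b1 c1 d1|t a1 b1]; rewrite /nu.
    have -> : (a1 + c1) * Q - (b1 + d1) * P = (a1 * Q - b1 * P) + (c1 * Q - d1 * P) by ring.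
    exact: norm3D.
  have -> : t * a1 * Q - t * b1 * P = t * (a1 * Q - b1 * P) by ring.
  exact: norm3Z.
have nu_ge v1 v2 : `|v1| <= nu v1 v2 by exact: norm3_ge.
have nu_ge2 v1 v2 : `|v2| <= nu v1 v2.
  apply: le_trans (norm3_ge v2 v1 (v1 * Q - v2 * P)) _.
  by rewrite /nu /norm3 [v2 ^+ 2 + _]addrC.
have [P4 Q4] : `|P| <= 4 /\ `|Q| <= 4 by exact: p_le4.
have P2 : P ^+ 2 <= 4 ^+ 2 by exact: ler_sqr_norm.
have Q2 : Q ^+ 2 <= 4 ^+ 2 by exact: ler_sqr_norm.
pose g i := f i - f a / U * (1 + P * p1 i + Q * p2 i).
have lip i j : (i < n)%N -> (j < n)%N -> av i -> av j -> edge i j ->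
    `|g i - g j| <= kap * nu (p1 j - p1 i) (p2 j - p2 i).
  move=> hi hj ai aj [_ [w0 [w1 [w2 [h1 h2 hw]]]]].
  have xi := x_neq0 hi ai; have xj := x_neq0 hj aj.
  have e1' := (chart_plane _ _ _ xi).1 h1; have e2' := (chart_plane _ _ _ xj).1 h2.
  pose r := w0 + w1 * P + w2 * Q - f a.
  have rt : `|r| <= tau.
    have -> : r = (f i - f a) - (w1 * (p1 i - P) + w2 * (p2 i - Q)).
      by rewrite /r -e1'; ring.
    have w1' : `|w1| <= 1.
      by apply: ler_norm_of_sqr => //; have := sqr_ge0 w0; have := sqr_ge0 w2; lra.
    have w2' : `|w2| <= 1.
      by apply: ler_norm_of_sqr => //; have := sqr_ge0 w0; have := sqr_ge0 w1; lra.
    apply: le_trans (p_close hi ha ai aa).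
    apply: le_trans (ler_normB _ _) _.
    have hc := crude hi ha ai aa.
    have : `|w1 * (p1 i - P) + w2 * (p2 i - Q)| <= `|p1 i - P| + `|p2 i - Q|.
      apply: le_trans (ler_normD _ _) _; rewrite !normrM.
      by apply: lerD; rewrite -[leRHS]mul1r; apply: ler_wpM2r.
    rewrite /P /Q; lra.
  pose d1 := p1 j - p1 i; pose d2 := p2 j - p2 i.
  pose A := (w1 * Q - w2 * P) * (d1 * Q - d2 * P) + (w2 - w0 * Q) * d2
     + (w0 * P - w1) * (- d1).
  pose B := 0 * 1 + d1 * P + d2 * Q.
  have gE : g j - g i = (A + r * B) / U.
    rewrite /g -e1' -e2' /A /r /B /d1 /d2 /U; field; exact: U0'.
  have nuA : nu d1 d2 = norm3 (d1 * Q - d2 * P) d2 (- d1).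
    by rewrite /nu /norm3 sqrrN; congr Num.sqrt; ring.
  have hA : `|A| <= V * nu d1 d2.
    rewrite nuA; apply: le_trans (cauchy3 _ _ _ _ _ _) _.
    apply: ler_wpM2r; first exact: norm3_ge0.
    apply: ler_of_sqr => //; rewrite sqr_norm3 V2.
    have -> : (w1 * Q - w2 * P) ^+ 2 + (w2 - w0 * Q) ^+ 2 + (w0 * P - w1) ^+ 2 =
       (w0 ^+ 2 + w1 ^+ 2 + w2 ^+ 2) * U - (f a + r) ^+ 2 by rewrite /U /r; ring.
    have hwU : (w0 ^+ 2 + w1 ^+ 2 + w2 ^+ 2) * U <= U.
      by rewrite -[leRHS]mul1r ler_pM2r.
    have hfr : - (f a * r) <= S * tau.
      apply: le_trans (ler_norm _) _; rewrite normrN normrM.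
      exact: ler_pM.
    have -> : (f a + r) ^+ 2 = f a ^+ 2 + 2 * (f a * r) + r ^+ 2 by ring.
    by rewrite /T; have := sqr_ge0 r; lra.
  have hB : `|B| <= S * nu d1 d2.
    apply: le_trans (cauchy3 _ _ _ _ _ _) _; rewrite mulrC; apply: ler_wpM2l => //.
    apply: ler_of_sqr; first exact: norm3_ge0.
    by rewrite !sqr_norm3 expr0n add0r lerDl sqr_ge0.
  rewrite distrC gE normrM normfV (gtr0_norm U0) /kap mulrAC ler_pM2r ?invr_gt0 //.
  apply: le_trans (ler_normD _ _) _; rewrite [leRHS]mulrDl (normrM r).
  by apply: lerD => //; rewrite -mulrA; apply: ler_pM.
have nu01 : nu 0 1 <= 5 /\ nu 1 0 <= 5.
  by split; apply: ler_of_sqr => //; rewrite /nu sqr_norm3; lra.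
have i0 : 0 <= 2 / m%:R :> R by exact: divr_ge0.
have cone (q s : R) : q <= 5 -> 1 <= s -> 2 / m%:R * (2 + e1) * q <= e1 * s.
  exact: cone_width_bound.
have nu_gt0 v1 v2 : (v1 != 0) || (v2 != 0) -> 0 < nu v1 v2.
  case/orP => h; first by apply: lt_le_trans (nu_ge _ _); rewrite normr_gt0.
  by apply: lt_le_trans (nu_ge2 _ _); rewrite normr_gt0.
have hspan := @spanner_lip R n m av p1 p2 g nu edge e1 kap m_gt0 (ltW e1_gt0) kap0 nuP
  nu_gt0 _ _ edge_neq lip edges1 edges2.
have {}hspan : `|g a - g b| <= (1 + e1) * kap * nu (p1 b - p1 a) (p2 b - p2 a).
  apply: hspan => // sl; apply: cone; rewrite ?nu01.1 ?nu01.2 //.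
    by have := nu_ge 1 sl; rewrite normr1.
  by have := nu_ge2 sl 1; rewrite normr1.
pose d1 := p1 b - p1 a; pose d2 := p2 b - p2 a.
have ga : g a = 0.
  have -> : g a = f a - f a / U * U by rewrite /g; congr (_ - _ * _); rewrite /U /P /Q; ring.
  by rewrite divfK // subrr.
rewrite ga sub0r normrN -/d1 -/d2 in hspan.
have nz : (d1 != 0) || (d2 != 0).
  apply/negPn/negP; rewrite negb_or !negbK => /andP[/eqP z1 /eqP z2].
  have gb : g b = 0.
    apply/eqP; rewrite -normr_le0; apply: le_trans hspan _.
    have -> : nu d1 d2 = 0 by rewrite z1 z2 /nu /norm3 !mul0r subrr !expr0n !addr0 sqrtr0.
    by rewrite mulr0.
  have e1' : p1 b = p1 a by move: z1; rewrite /d1; lra.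
  have e2' : p2 b = p2 a by move: z2; rewrite /d2; lra.
  have fab : f b = f a.
    by move: gb; rewrite /g e1' e2' -ga /g -/P -/Q => /(canRL (subrK _)) ->; rewrite subrK.
  have exx : x b = x a.
    have hh : dl / x a * (x a * x b) = dl / x b * (x a * x b) by rewrite -/(f a) -fab.
    have h' : dl * x b = dl * x a.
      by move: hh; rewrite mulrA divfK // [x a * x b]mulrC mulrA divfK.
    by apply: (mulfI (lt0r_neq0 dl_gt0)).
  have eyy : y b = y a by rewrite -[LHS](divfK xb) -/(p1 b) e1' exx divfK.
  have ezz : z b = z a by rewrite -[LHS](divfK xb) -/(p2 b) e2' exx divfK.
  by have := gap_gt0 ha hb hab; rewrite /gap2 exx eyy ezz !subrr expr0n /= !addr0 ltxx.
have N0 := nu_gt0 _ _ nz; set W := nu d1 d2 in N0 hspan.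
have W2 : W ^+ 2 = d1 ^+ 2 + d2 ^+ 2 + (d1 * Q - d2 * P) ^+ 2 by exact: sqr_norm3.
have W0' : W ^+ 2 != 0 by rewrite expf_neq0 // gt_eqF.
pose h := g b; pose c := h / W ^+ 2; pose k := f a / U; pose q := d1 * P + d2 * Q.
exists (k - c * q), (k * P + c * (U * d1 - q * P)), (k * Q + c * (U * d2 - q * Q)).
have fbE : f b = h + k * (1 + P * p1 b + Q * p2 b) by rewrite /h /g -/k subrK.
have p1b : p1 b = P + d1 by rewrite /d1 /P; ring.
have p2b : p2 b = Q + d2 by rewrite /d2 /Q; ring.
split.
- apply/chart_plane => //; rewrite -/P -/Q.
  have -> : f a = k * U by rewrite /k divfK.
  by rewrite /q /U; ring.
- apply/chart_plane => //; rewrite fbE p1b p2b.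
  have -> : h = c * W ^+ 2 by rewrite /c divfK.
  by rewrite W2 /q /U; ring.
have -> : (k - c * q) ^+ 2 + (k * P + c * (U * d1 - q * P)) ^+ 2 +
    (k * Q + c * (U * d2 - q * Q)) ^+ 2 = f a ^+ 2 / U + h ^+ 2 * U / W ^+ 2.
  have -> : f a ^+ 2 / U = k ^+ 2 * U by rewrite /k; field.
  have -> : h ^+ 2 * U / W ^+ 2 = c ^+ 2 * U * W ^+ 2 by rewrite /c; field; rewrite gt_eqF.
  by rewrite W2 /q /U; ring.
pose K := (1 + e1) ^+ 2.
have e10 : 0 <= 1 + e1 by rewrite addr_ge0 // ltW.
have K1 : 1 <= K by apply: exprn_ege1; rewrite lerDl ltW.
have hh : h ^+ 2 <= K * kap ^+ 2 * W ^+ 2.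
  by have := ler_sqr_norm hspan; rewrite !exprMn.
have hkap : kap ^+ 2 * U = (V + tau * S) ^+ 2 / U by rewrite /kap; field.
have hV : (V + tau * S) ^+ 2 <= U - f a ^+ 2 + 7 * tau * U.
  by apply: root_bound => //; exact: sqr_ge0.
apply: (@le_trans _ _ (f a ^+ 2 / U + K * (kap ^+ 2 * U))).
  rewrite lerD2l ler_pdivrMr ?exprn_gt0 //.
  have -> : K * (kap ^+ 2 * U) * W ^+ 2 = K * kap ^+ 2 * W ^+ 2 * U by ring.
  by rewrite ler_pM2r.
rewrite hkap -(ler_pM2r U0) mulrDl divfK // -/K.
have -> : K * ((V + tau * S) ^+ 2 / U) * U = K * (V + tau * S) ^+ 2 by field.
have hK : K * (V + tau * S) ^+ 2 <= K * (U - f a ^+ 2 + 7 * tau * U).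
  by rewrite ler_pM2l //; lra.
have : f a ^+ 2 <= K * f a ^+ 2 by rewrite ler_peMl ?sqr_ge0.
have -> : K * (1 + 7 * tau) * U = K * (U - f a ^+ 2 + 7 * tau * U) + K * f a ^+ 2 by ring.
lra.
Qed.

End Local.

Lemma convex_coef (r s t : R) : r <= s -> s <= t ->
  exists l, [/\ 0 <= l, l <= 1 & s = l * r + (1 - l) * t].
Proof.
move=> rs st; have [e|ne] := eqVneq r t.
  by exists 1; split=> //; rewrite mul1r subrr mul0r addr0; apply/eqP; rewrite eq_le rs e st.
have rt : 0 < t - r by rewrite subr_gt0 lt_neqAle ne (le_trans rs st).
exists ((t - s) / (t - r)); split.
- by apply: divr_ge0 (ltW rt); rewrite subr_ge0.
- by rewrite ler_pdivrMr // mul1r; apply: lerB.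
- by field; rewrite gt_eqF.
Qed.

(* A convex combination of the normals for [b1] and [b2] gives a plane through [a]
   that misses [b] by little.  It is tilted around [a] so as to contain [b]; the tilt
   is small because the directions of [a] and [b] are well separated. *)
Lemma far_bound (eta c : R) a b b1 b2 : 0 <= eta -> 0 <= c -> (b < n)%N -> (b1 < n)%N ->
  (b2 < n)%N -> av b -> av b1 -> av b2 -> (x b1)^-1 <= (x b)^-1 -> (x b)^-1 <= (x b2)^-1 ->
  `|p1 b - p1 b1| + `|p2 b - p2 b1| <= eta ->
  `|p1 b - p1 b2| + `|p2 b - p2 b2| <= eta ->
  (exists w0 w1 w2, plane x y z dl 1 a b1 w0 w1 w2) ->
  (exists w0 w1 w2, plane x y z dl 1 a b2 w0 w1 w2) ->
  0 < cross2 x y z a b ->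
  (x a ^+ 2 + y a ^+ 2 + z a ^+ 2) * x b ^+ 2 <= c ^+ 2 * cross2 x y z a b ->
  exists w0 w1 w2, plane x y z dl ((1 + eta * c) ^+ 2) a b w0 w1 w2.
Proof.
move=> eta0 c0 hb hb1 hb2 ab ab1 ab2 le1 le2 d1 d2 [u0 [u1 [u2 [ua ub un]]]]
  [v0 [v1 [v2 [va vb vn]]]] cr0 hc.
have xb := x_neq0 hb ab; have xb1 := x_neq0 hb1 ab1; have xb2 := x_neq0 hb2 ab2.
have {}le1 : f b1 <= f b by rewrite /f ler_pM2l.
have {}le2 : f b <= f b2 by rewrite /f ler_pM2l.
have [l [l0 l1 fE]] := convex_coef le1 le2.
have l1' : 0 <= 1 - l by rewrite subr_ge0.
have {}ub := (chart_plane _ _ _ xb1).1 ub; have {}vb := (chart_plane _ _ _ xb2).1 vb.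
have unit_norm (w0 w1 w2 : R) : w0 ^+ 2 + w1 ^+ 2 + w2 ^+ 2 <= 1 -> norm3 w0 w1 w2 <= 1.
  by move=> h; apply: ler_of_sqr => //; rewrite sqr_norm3 expr1n.
have {}un := unit_norm _ _ _ un; have {}vn := unit_norm _ _ _ vn.
pose w0 := l * u0 + (1 - l) * v0; pose w1 := l * u1 + (1 - l) * v1.
pose w2 := l * u2 + (1 - l) * v2.
have wn : norm3 w0 w1 w2 <= 1.
  apply: le_trans (norm3D _ _ _ _ _ _) _; rewrite !norm3Z !ger0_norm //.
  apply: (@le_trans _ _ (l * 1 + (1 - l) * 1)); last by rewrite !mulr1 subrKC.
  by apply: lerD; apply: ler_wpM2l.
have wa : w0 * x a + w1 * y a + w2 * z a = dl.
  have -> : dl = l * dl + (1 - l) * dl by ring.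
  by rewrite -{1}ua -va /w0 /w1 /w2; ring.
pose err := w0 + w1 * p1 b + w2 * p2 b - f b.
have shift (t0 t1 t2 : R) b' : norm3 t0 t1 t2 <= 1 ->
    `|p1 b - p1 b'| + `|p2 b - p2 b'| <= eta ->
    `|t1 * (p1 b - p1 b') + t2 * (p2 b - p2 b')| <= eta.
  move=> tn; apply: le_trans; apply: le_trans (ler_normD _ _) _; rewrite !normrM.
  have h1 := norm3_ge t1 t0 t2; have h2 := norm3_ge t2 t1 t0.
  have e1 : norm3 t1 t0 t2 = norm3 t0 t1 t2 by rewrite /norm3 [t1 ^+ 2 + _]addrC.
  have e2 : norm3 t2 t1 t0 = norm3 t0 t1 t2.
    by rewrite /norm3; congr Num.sqrt; ring.
  apply: lerD; rewrite -[leRHS]mul1r; apply: ler_wpM2r => //.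
    by apply: le_trans h1 _; rewrite e1.
  by apply: le_trans h2 _; rewrite e2.
have errE : err = l * (u1 * (p1 b - p1 b1) + u2 * (p2 b - p2 b1)) +
    (1 - l) * (v1 * (p1 b - p1 b2) + v2 * (p2 b - p2 b2)).
  by rewrite /err fE -ub -vb /w0 /w1 /w2; ring.
have err_le : `|err| <= eta.
  rewrite errE; apply: le_trans (ler_normD _ _) _; rewrite !normrM (ger0_norm l0) (ger0_norm l1').
  have -> : eta = l * eta + (1 - l) * eta by ring.
  apply: lerD; apply: ler_wpM2l => //; [exact: shift _ _ _ _ un d1|exact: shift _ _ _ _ vn d2].
pose A := x a ^+ 2 + y a ^+ 2 + z a ^+ 2.
have A0 : 0 < A.
  rewrite lt_neqAle sumsq_ge0 andbT eq_sym; apply/eqP => A0.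
  have [z0 z1 z2] : [/\ x a = 0, y a = 0 & z a = 0].
    have := sqr_ge0 (x a); have := sqr_ge0 (y a); have := sqr_ge0 (z a).
    move=> q1 q2 q3; move: A0; rewrite /A => A0.
    by split; apply/eqP; rewrite -sqrf_eq0; apply/eqP; lra.
  by move: cr0; rewrite /cross2 z0 z1 z2 !mul0r !subrr !expr0n !addr0 ltxx.
have A0' : A != 0 by rewrite gt_eqF.
pose P := p1 b; pose Q := p2 b; pose k := (x a + y a * P + z a * Q) / A.
pose q := (1 - k * x a) ^+ 2 + (P - k * y a) ^+ 2 + (Q - k * z a) ^+ 2.
have qE : q * (A * x b ^+ 2) = cross2 x y z a b.
  have yb : y b = P * x b by rewrite /P /p1 divfK.
  have zb : z b = Q * x b by rewrite /Q /p2 divfK.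
  have kA : k * A = x a + y a * P + z a * Q by rewrite /k divfK.
  have -> : q = 1 + P ^+ 2 + Q ^+ 2 - k * (x a + y a * P + z a * Q).
    rewrite -kA /q; have -> : k * (k * A) = 2 * k * (k * A) - k * (k * A) by ring.
    by rewrite {1}kA /A; ring.
  rewrite mulrA.
  have -> : (1 + P ^+ 2 + Q ^+ 2 - k * (x a + y a * P + z a * Q)) * A =
     (1 + P ^+ 2 + Q ^+ 2) * A - (x a + y a * P + z a * Q) ^+ 2.
    by rewrite -kA; ring.
  by rewrite /cross2 yb zb /A; ring.
have xb2' : 0 < x b ^+ 2 by rewrite lt_neqAle sqr_ge0 eq_sym sqrf_eq0 xb.
have q0 : 0 < q.
  by have : 0 < q * (A * x b ^+ 2) by [rewrite qE]; rewrite pmulr_lgt0 // mulr_gt0.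
have q0' : q != 0 by rewrite gt_eqF.
have qc : 1 <= c ^+ 2 * q.
  by rewrite -(ler_pM2r (mulr_gt0 A0 xb2')) mul1r -mulrA qE.
pose s := - err / q.
have sn : norm3 (s * (1 - k * x a)) (s * (P - k * y a)) (s * (Q - k * z a)) <= eta * c.
  apply: ler_of_sqr; first exact: mulr_ge0.
  have -> : norm3 (s * (1 - k * x a)) (s * (P - k * y a)) (s * (Q - k * z a)) ^+ 2 =
     err ^+ 2 / q.
    rewrite sqr_norm3.
    have -> : (s * (1 - k * x a)) ^+ 2 + (s * (P - k * y a)) ^+ 2 +
      (s * (Q - k * z a)) ^+ 2 = s ^+ 2 * q by rewrite /q; ring.
    by rewrite /s; field.
  rewrite ler_pdivrMr // exprMn -mulrA -[leLHS]mulr1.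
  by apply: ler_pM => //; [exact: sqr_ge0|exact: ler_sqr_norm].
have kA : k * A = x a + y a * P + z a * Q by rewrite /k divfK.
have orth_a : (1 - k * x a) * x a + (P - k * y a) * y a + (Q - k * z a) * z a = 0.
  have -> : (1 - k * x a) * x a + (P - k * y a) * y a + (Q - k * z a) * z a =
     x a + y a * P + z a * Q - k * A by rewrite /A; ring.
  by rewrite kA subrr.
have dot_b : (1 - k * x a) + (P - k * y a) * P + (Q - k * z a) * Q = q.
  have -> : q = (1 - k * x a) + (P - k * y a) * P + (Q - k * z a) * Q -
     k * ((1 - k * x a) * x a + (P - k * y a) * y a + (Q - k * z a) * z a).
    by rewrite /q; ring.
  by rewrite orth_a mulr0 subr0.
exists (w0 + s * (1 - k * x a)), (w1 + s * (P - k * y a)), (w2 + s * (Q - k * z a)).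
split.
- have -> : (w0 + s * (1 - k * x a)) * x a + (w1 + s * (P - k * y a)) * y a +
    (w2 + s * (Q - k * z a)) * z a = (w0 * x a + w1 * y a + w2 * z a) +
    s * ((1 - k * x a) * x a + (P - k * y a) * y a + (Q - k * z a) * z a) by ring.
  by rewrite orth_a mulr0 addr0.
- apply/chart_plane => //; rewrite -/P -/Q.
  have -> : w0 + s * (1 - k * x a) + (w1 + s * (P - k * y a)) * P +
    (w2 + s * (Q - k * z a)) * Q = (w0 + w1 * P + w2 * Q) +
    s * ((1 - k * x a) + (P - k * y a) * P + (Q - k * z a) * Q) by ring.
  by rewrite dot_b /s divfK // /err -/P -/Q; ring.
- rewrite -sqr_norm3 ler_pXn2r ?nnegrE ?norm3_ge0 ?addr_ge0 ?mulr_ge0 //.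
  by apply: le_trans (norm3D _ _ _ _ _ _) _; apply: lerD.
Qed.

End Chart.

Lemma sqr_add_le (R : realType) (a b : R) : (a + b) ^+ 2 <= 2 * a ^+ 2 + 2 * b ^+ 2.
Proof.
rewrite -subr_ge0; have -> : 2 * a ^+ 2 + 2 * b ^+ 2 - (a + b) ^+ 2 = (a - b) ^+ 2 by ring.
exact: sqr_ge0.
Qed.

Lemma far_ratio (R : realType) (N ax ay az P Q : R) : 1 <= N -> `|P| <= 1 -> `|Q| <= 1 ->
  ~ (N * `|ay - ax * P| <= `|ax| /\ N * `|az - ax * Q| <= `|ax|) ->
  ax ^+ 2 + ay ^+ 2 + az ^+ 2 <= (3 * N) ^+ 2 *
   ((ay * Q - az * P) ^+ 2 + (az - ax * Q) ^+ 2 + (ax * P - ay) ^+ 2).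
Proof.
move=> N1 P1 Q1 hfar.
set v1 := ay - ax * P in hfar; set v2 := az - ax * Q in hfar *.
have ayE : ay = ax * P + v1 by rewrite /v1; ring.
have azE : az = ax * Q + v2 by rewrite /v2; ring.
have P2 : P ^+ 2 <= 1 by have := ler_sqr_norm P1; rewrite expr1n.
have Q2 : Q ^+ 2 <= 1 by have := ler_sqr_norm Q1; rewrite expr1n.
have N2 : 1 <= N ^+ 2 by exact: exprn_ege1.
pose V := v1 ^+ 2 + v2 ^+ 2.
have V0 : 0 <= V by rewrite addr_ge0 ?sqr_ge0.
have hV : ax ^+ 2 <= N ^+ 2 * V.
  have main v : `|ax| <= N * `|v| -> ax ^+ 2 <= N ^+ 2 * v ^+ 2.
    by move/ler_sqr_norm; rewrite exprMn real_normK ?num_real.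
  have [h|h] := lerP (N * `|v1|) `|ax|; last first.
    apply: le_trans (main _ (ltW h)) _; apply: ler_wpM2l; first exact: sqr_ge0.
    by rewrite lerDl sqr_ge0.
  have [h'|h'] := lerP (N * `|v2|) `|ax|; first by case: hfar.
  apply: le_trans (main _ (ltW h')) _; apply: ler_wpM2l; first exact: sqr_ge0.
  by rewrite lerDr sqr_ge0.
have a0 := sqr_ge0 ax.
have h1 : ay ^+ 2 <= 2 * ax ^+ 2 + 2 * v1 ^+ 2.
  have : (ax * P) ^+ 2 <= ax ^+ 2 by rewrite exprMn ler_piMr.
  by rewrite ayE; have := sqr_add_le (ax * P) v1; lra.
have h2 : az ^+ 2 <= 2 * ax ^+ 2 + 2 * v2 ^+ 2.
  have : (ax * Q) ^+ 2 <= ax ^+ 2 by rewrite exprMn ler_piMr.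
  by rewrite azE; have := sqr_add_le (ax * Q) v2; lra.
have h3 : V <= N ^+ 2 * V by rewrite ler_peMl.
have h4 : N ^+ 2 * V <= N ^+ 2 * ((ay * Q - az * P) ^+ 2 + v2 ^+ 2 + (ax * P - ay) ^+ 2).
  apply: ler_wpM2l; first exact: sqr_ge0.
  have -> : (ax * P - ay) ^+ 2 = v1 ^+ 2 by rewrite /v1; ring.
  by rewrite /V; have := sqr_ge0 (ay * Q - az * P); lra.
rewrite exprMn -mulrA; move: h4; set W := N ^+ 2 * (_ + _) => h4.
by move: hV h1 h2 h3 h4; rewrite /V; lra.
Qed.

(** * The algorithm *)

Notation V k := (EArr k (ENum 0)).
Notation Set_ k e := (Store k (ENum 0) e).
Notation "a |+| b" := (EBin WAdd a b) (at level 50, left associativity).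
Notation "a |-| b" := (EBin WSub a b) (at level 50, left associativity).
Notation "a |*| b" := (EBin WMul a b) (at level 40, left associativity).
Notation "a |/| b" := (EBin WDiv a b) (at level 40, left associativity).

Notation "x [+] y" := (XBin RAdd x y) (at level 50, left associativity).
Notation "x [-] y" := (XBin RSub x y) (at level 50, left associativity).
Notation "x [*] y" := (XBin RMul x y) (at level 40, left associativity).
Notation "x [/] y" := (XBin RDiv x y) (at level 40, left associativity).

(* Arrays: 0 and 1 hold the current best pair, 2 is the counter of [ForN], 12 that
   of [ForL], 7 is the tournament tree, 13 and 15 hold sorted orders, 14 and 16 the
   ranks; 3, 4, 5 and 6 are scalar temporaries. *)
Section Algorithm.
Variables (R : realType) (n L : nat) (inp : nat -> R).
Let P := (2 ^ L)%N.
Hypothesis L_gt0 : (0 < L)%N.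
Hypothesis n_gt0 : (0 < n)%N.
Hypothesis n_le : (n <= P)%N.
Implicit Types kv : nat -> R.

Notation den := (den n L inp).
Notation safe := (safe n L inp).
Notation bounded := (bounded L).
Notation weval := (weval L).
Notation xeval := (xeval L inp).
Notation teval := (teval L inp).

Definition runs_to st s (Q : store -> Prop) := safe st s /\ Q (den st s).

Lemma runs_toW st s (Q Q' : store -> Prop) : (forall s', Q s' -> Q' s') ->
  runs_to st s Q -> runs_to st s Q'.
Proof. by move=> h [hs hq]; split=> //; apply: h. Qed.

Lemma runs_to_frame st s (Q : store -> Prop) : bounded s -> runs_to st s Q ->
  runs_to st s (fun s' => [/\ Q s', bounded s' &
     forall k, k \notin wmods st -> s' k = s k]).
Proof.
move=> bs [hs hq]; split=> //; split=> //; first exact: den_bounded.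
by move=> k hk; apply: den_frame.
Qed.

Lemma runs_seq a b s Q : bounded s ->
  runs_to a s (fun s1 => bounded s1 -> runs_to b s1 Q) -> runs_to (Seq a b) s Q.
Proof.
move=> bs [ha /(_ (den_bounded L_gt0 n_le bs ha)) [hb hQ]].
by split=> //; split.
Qed.

Lemma runs_for (N : nat) (f : store -> store) v b s (I : nat -> store -> Prop) :
  (N <= P)%N -> bounded s -> I 0%N s ->
  (forall i s, (i < N)%N -> bounded s -> I i s ->
     runs_to b (upd s v 0 i) (I i.+1)) ->
  (forall i, (i < N)%N -> safe b (upd (for_loop v (den b) i s) v 0 i)) /\
  I N (for_loop v (den b) N s).
Proof.
move=> hN bs h0 hI.
have P2 : (P < P ^ 2)%N := P_lt_sqr L_gt0.
have inv i : (i <= N)%N -> bounded (for_loop v (den b) i s) /\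
    I i (for_loop v (den b) i s).
  elim: i => [//|i ih] hi; have [bi Ii] := ih (ltnW hi).
  have [hs hI'] := hI i _ hi bi Ii; split=> //=.
  apply: (den_bounded L_gt0 n_le) => //; apply: upd_bounded => //; lia.
split=> [i hi|]; last by have [] := inv N (leqnn N).
by have [bi Ii] := inv i (ltnW hi); have [] := hI i _ hi bi Ii.
Qed.

Lemma runs_forN v b s (I : nat -> store -> Prop) (Q : store -> Prop) :
  bounded s -> I 0%N s ->
  (forall i s, (i < n)%N -> bounded s -> I i s ->
     runs_to b (upd s v 0 i) (I i.+1)) ->
  (forall s', bounded s' -> I n s' -> Q s') ->
  runs_to (ForN v b) s Q.
Proof.
move=> bs h0 hI hQ; have [hs hn] := runs_for id n_le bs h0 hI.
split=> //; apply: hQ => //.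
exact: (den_bounded (st := ForN v b) L_gt0 n_le bs).
Qed.

Lemma runs_forL v b s (I : nat -> store -> Prop) (Q : store -> Prop) :
  bounded s -> I 0%N s ->
  (forall i s, (i < L)%N -> bounded s -> I i s ->
     runs_to b (upd s v 0 i) (I i.+1)) ->
  (forall s', bounded s' -> I L s' -> Q s') ->
  runs_to (ForL v b) s Q.
Proof.
move=> bs h0 hI hQ; have [hs hn] := runs_for id (ltnW (ltn_expl L (ltnSn 1))) bs h0 hI.
split=> //; apply: hQ => //.
exact: (den_bounded (st := ForL v b) L_gt0 n_le bs).
Qed.

Lemma denIf t a b s : den (If t a b) s = if teval t s then den a s else den b s.
Proof. by []. Qed.

Lemma safeIf t a b s : safe (If t a b) s = if teval t s then safe a s else safe b s.
Proof. by []. Qed.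

Lemma runs_if t a b s Q :
  runs_to (If t a b) s Q = if teval t s then runs_to a s Q else runs_to b s Q.
Proof. by rewrite /runs_to denIf safeIf; case: ifP. Qed.

Lemma lt_P2 x : (x < 2 * P)%N -> (x < P ^ 2)%N.
Proof.
move=> hx; apply: leq_trans hx _; rewrite -mulnn leq_mul2r.
by rewrite -[X in (X <= P)%N]/(2 ^ 1)%N leq_exp2l // L_gt0 orbT.
Qed.

(** ** Tournament trees *)

Definition if_prec (key : wexp -> rexp) x y st st' :=
  If (TRLt (key x) (key y)) st
    (If (TRLt (key y) (key x)) st' (If (TWLt x y) st st')).

Definition evals_to (key : wexp -> rexp) (kv : nat -> R) :=
  forall e s, xeval (key e) s = kv (weval e s).

Lemma prec_trans kv : transitive (prec kv).
Proof.
move=> y x z; rewrite /prec => /orP[h1|/andP[/eqP e1 h1]] /orP[h2|/andP[/eqP e2 h2]].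
- by rewrite (lt_trans h1 h2).
- by rewrite -e2 h1.
- by rewrite e1 h2.
- by rewrite e1 e2 eqxx (ltn_trans h1 h2) orbT.
Qed.

Lemma prec_irr kv x : prec kv x x = false.
Proof. by rewrite /prec ltxx ltnn andbF. Qed.

Lemma prec_total kv x y : x != y -> prec kv x y || prec kv y x.
Proof. by rewrite /prec; case: ltgtP => //= _; case: ltngtP. Qed.

Definition preceq kv x y := (x == y) || prec kv x y.

Lemma preceq_trans kv : transitive (preceq kv).
Proof.
move=> y x z; rewrite /preceq => /orP[/eqP->//|h1] /orP[/eqP<-|h2].
  by rewrite h1 orbT.
by rewrite (prec_trans h1 h2) orbT.
Qed.

Lemma preceq_le kv x y : preceq kv x y -> kv x <= kv y.
Proof. by case/orP => [/eqP->//|/prec_le]. Qed.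

Lemma if_precE key kv x y st st' s : evals_to key kv ->
  (den (if_prec key x y st st') s =
    if prec kv (weval x s) (weval y s) then den st s else den st' s) /\
  (safe (if_prec key x y st st') s =
    if prec kv (weval x s) (weval y s) then safe st s else safe st' s).
Proof.
move=> h; rewrite /= !h /prec; case: ltgtP => //= _; case: ltngtP => //.
Qed.

(* A tree node holds 0 when empty, and [i.+1] for the index [i]. *)
Definition winner kv (l r : nat) : nat :=
  if l == 0%N then r else if r == 0%N then l
  else if prec kv l.-1 r.-1 then l else r.

Definition play (key : wexp -> rexp) : stmt :=
  let l := EArr 7 (ENum 2 |*| V 4) in
  let r := EArr 7 (ENum 2 |*| V 4 |+| ENum 1) in
  If (TWEq l (ENum 0)) (Store 7 (V 4) r)
    (If (TWEq r (ENum 0)) (Store 7 (V 4) l)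
       (if_prec key (l |-| ENum 1) (r |-| ENum 1)
          (Store 7 (V 4) l) (Store 7 (V 4) r))).

Definition set_leaf (key : wexp -> rexp) (pos val : wexp) : stmt :=
  Seq (Set_ 4 (EPow |+| pos))
    (Seq (Store 7 (V 4) val)
       (ForL 12 (Seq (Set_ 4 (V 4 |/| ENum 2)) (play key)))).

Lemma playE key kv s : evals_to key kv -> bounded s ->
  safe (play key) s /\
  den (play key) s = upd s 7 (s 4%N 0%N)
    (winner kv (s 7%N (2 * s 4%N 0%N)%N) (s 7%N (2 * s 4%N 0%N + 1)%N)).
Proof.
move=> hk bs; rewrite /play.
set l := EArr 7 (ENum 2 |*| V 4); set r := EArr 7 _.
have [dp sp] := if_precE (l |-| ENum 1) (r |-| ENum 1)
  (Store 7 (V 4) l) (Store 7 (V 4) r) s hk.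
set a := s 7%N (2 * _)%N; set b := s 7%N (_ + 1)%N.
have bl : (weval l s < (2 ^ L) ^ 2)%N by exact: bs.
have br : (weval r s < (2 ^ L) ^ 2)%N by exact: bs.
have tl : teval (TWEq l (ENum 0)) s = (a == 0%N) by [].
have tr : teval (TWEq r (ENum 0)) s = (b == 0%N) by [].
rewrite denIf safeIf tl /winner; case: ifP => // _.
rewrite denIf safeIf tr; case: ifP => // _.
by rewrite dp sp /= !subn1 -/a -/b; case: ifP.
Qed.

Definition tree kv (f M : nat -> nat) :=
  (forall q, (q < P)%N -> M (P + q)%N = f q) /\
  (forall h, (0 < h < P)%N -> M h = winner kv (M (2 * h)%N) (M (2 * h + 1)%N)).

Lemma set_leafP key kv pos val s q f : evals_to key kv -> bounded s ->
  tree kv f (s 7%N) -> (q < P)%N -> weval pos s = q ->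
  (forall h, weval val (upd s 4 0 h) = weval val s) -> (weval val s < P ^ 2)%N ->
  runs_to (set_leaf key pos val) s (fun s' =>
    tree kv (fun q' => if q' == q then weval val s else f q') (s' 7%N)).
Proof.
move=> hk bs [tl ti] hq eq_pos eq_val hval.
set v := weval val s in eq_val hval *.
apply: runs_seq => //; split; first by rewrite /= eq_pos; apply: lt_P2; lia.
move=> bs1; apply: runs_seq => //; split; first by rewrite /= eq_val.
move=> bs2.
set s2 := den _ _ in bs2 *.
have s27 h : s2 7%N h = if h == (P + q)%N then v else s 7%N h.
  by rewrite /s2 /= eq_val /upd /= eq_pos.
pose f' q' := if q' == q then v else f q'.
pose I j s := s 4%N 0%N = ((P + q) %/ 2 ^ j)%N /\
  (forall q', (q' < P)%N -> s 7%N (P + q')%N = f' q') /\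
  (forall h, (0 < h < P)%N ->
    (forall j', (j < j')%N -> h != (P + q) %/ 2 ^ j')%N ->
    s 7%N h = winner kv (s 7%N (2 * h)%N) (s 7%N (2 * h + 1)%N)).
apply: (@runs_forL _ _ _ I) => //.
- split; first by rewrite /s2 /= divn1 eq_pos.
  split=> [q' hq'|h hh hne]; first by rewrite s27 eqn_add2l /f' -tl.
  rewrite !s27; have := hne 1%N isT; rewrite expn1 => hne1.
  have n0 : (h == P + q)%N = false by lia.
  have n1 : (2 * h == P + q)%N = false by lia.
  have n2 : (2 * h + 1 == P + q)%N = false by lia.
  by rewrite n0 n1 n2 ti.
- move=> j s3 hj bs3 [h4 [hl hi]].
  have bs3' : bounded (upd s3 12 0 j).
    apply: upd_bounded => //; apply: lt_P2.
    by have := ltn_expl L (ltnSn 1); rewrite -/P; lia.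
  apply: runs_seq => //; split.
    rewrite /= upd_other // h4; apply: lt_P2.
    by apply: leq_ltn_trans (leq_div _ _) _; apply: leq_ltn_trans (leq_div _ _) _; lia.
  move=> bs4; set s4 := den _ _ in bs4 *.
  have [sp dp] := playE hk bs4; split=> //.
  pose h' := ((P + q) %/ 2 ^ j.+1)%N.
  have e4 : s4 4%N 0%N = h'.
    by rewrite /s4 /= upd_same /= upd_other // h4 /h' expnSr divnMA.
  have e7 : s4 7%N = s3 7%N by [].
  have h'P : (h' < P)%N.
    rewrite /h' ltn_divLR ?expn_gt0 // expnS.
    have h2j : (0 < 2 ^ j)%N by rewrite expn_gt0.
    nia.
  have h'0 : (0 < h')%N.
    rewrite /h' divn_gt0 ?expn_gt0 //.
    by apply: leq_trans (leq_addr _ _); rewrite leq_exp2l.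
  rewrite dp e4 e7; set s5 := upd _ _ _ _.
  have s57 h : s5 7%N h = if h == h' then winner kv (s3 7%N (2 * h')%N)
      (s3 7%N (2 * h' + 1)%N) else s3 7%N h by rewrite /s5 upd_same e7.
  split; first by rewrite /s5 upd_other.
  split=> [q' hq'|h hh hne].
    by rewrite s57 ifN ?hl //; lia.
  rewrite !s57.
  case: (altP (h =P h')) => [->|hne'].
    have n1 : (2 * h' == h')%N = false by lia.
    have n2 : (2 * h' + 1 == h')%N = false by lia.
    by rewrite n1 n2.
  have hne2 : h != ((P + q) %/ 2 ^ j.+2)%N by apply: hne.
  have hh2 : (h' %/ 2 = (P + q) %/ 2 ^ j.+2)%N by rewrite /h' -divnMA -expnSr.
  have n1 : (2 * h == h')%N = false by lia.
  have n2 : (2 * h + 1 == h')%N = false by lia.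
  rewrite n1 n2 hi //.
  move=> j'; rewrite leq_eqVlt => /orP[/eqP<- //|]; exact: hne.
- move=> s' _ [_ [hl hi]]; split=> // h hh; apply: hi => // j hj.
  rewrite divn_small; first by lia.
  have : (2 ^ L.+1 <= 2 ^ j)%N by rewrite leq_exp2l.
  by rewrite expnS -/P; lia.
Qed.

Lemma winner_l kv l r : l != 0%N ->
  winner kv l r != 0%N /\ preceq kv (winner kv l r).-1 l.-1.
Proof.
move=> hl; case: (eqVneq r 0%N) => [->|hr].
  by rewrite /winner (negbTE hl) eqxx hl /preceq eqxx.
rewrite /winner (negbTE hl) (negbTE hr); case: ifP => h; rewrite /preceq.
  by rewrite hl eqxx.
split=> //; case: (eqVneq r.-1 l.-1) => //= hne.
by have := prec_total kv hne; rewrite h orbF.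
Qed.

Lemma winner_r kv l r : r != 0%N ->
  winner kv l r != 0%N /\ preceq kv (winner kv l r).-1 r.-1.
Proof.
move=> hr; case: (eqVneq l 0%N) => [->|hl].
  by rewrite /winner eqxx hr /preceq eqxx.
rewrite /winner (negbTE hl) (negbTE hr) /preceq.
by case: ifP => h; rewrite ?hl ?hr ?h ?eqxx ?orbT.
Qed.

Lemma winner_in kv l r : winner kv l r = l \/ winner kv l r = r.
Proof.
by rewrite /winner; case: ifP; [right|case: ifP; [left|case: ifP; [left|right]]].
Qed.

Lemma tree_anc kv f M q j : tree kv f M -> (q < P)%N -> f q != 0%N -> (j <= L)%N ->
  let g := ((P + q) %/ 2 ^ j)%N in
  M g != 0%N /\ preceq kv (M g).-1 (f q).-1.
Proof.
move=> [tl ti] hq hf; elim: j => [|j ih] hj /=.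
  by rewrite divn1 tl // hf /preceq eqxx.
have [hM hp] := ih (ltnW hj).
rewrite expnSr divnMA; move: hM hp; set g := ((P + q) %/ 2 ^ j)%N => hM hp.
have hg2 : (2 <= g < 2 * P)%N.
  rewrite /g; apply/andP; split.
    rewrite leq_divRL ?expn_gt0 // -expnS; apply: leq_trans (leq_addr _ _).
    by rewrite leq_exp2l.
  by apply: leq_ltn_trans (leq_div _ _) _; lia.
rewrite ti; last by lia.
have : (g = 2 * (g %/ 2) \/ g = 2 * (g %/ 2) + 1)%N by lia.
case=> e.
  have hM' : M (2 * (g %/ 2))%N != 0%N by rewrite -e.
  have hp' : preceq kv (M (2 * (g %/ 2))%N).-1 (f q).-1 by rewrite -e.
  have [h1 h2] := winner_l kv (M (2 * (g %/ 2) + 1)%N) hM'.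
  by split=> //; exact: preceq_trans h2 hp'.
have hM' : M (2 * (g %/ 2) + 1)%N != 0%N by rewrite -e.
have hp' : preceq kv (M (2 * (g %/ 2) + 1)%N).-1 (f q).-1 by rewrite -e.
have [h1 h2] := winner_r kv (M (2 * (g %/ 2))%N) hM'.
by split=> //; exact: preceq_trans h2 hp'.
Qed.

Lemma tree_mem kv f M j g : tree kv f M -> (j <= L)%N ->
  (2 ^ (L - j) <= g < 2 * 2 ^ (L - j))%N -> M g != 0%N ->
  exists q, [/\ (q < P)%N, f q = M g & ((P + q) %/ 2 ^ j = g)%N].
Proof.
move=> [tl ti]; elim: j g => [|j ih] g hj.
  rewrite subn0 -/P => hg hM; exists (g - P)%N.
  have hgP : (g - P < P)%N by lia.
  have hPg : (P + (g - P) = g)%N by lia.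
  by rewrite -tl // expn0 divn1 hPg.
have hev : (2 ^ (L - j) = 2 * 2 ^ (L - j.+1))%N by rewrite -(subnSK hj) expnS.
have hle : (2 ^ (L - j) <= P)%N by rewrite leq_exp2l //; lia.
have hpos : (0 < 2 ^ (L - j.+1))%N by rewrite expn_gt0.
move=> hg; rewrite ti; last by lia.
have [->|->] := winner_in kv (M (2 * g)%N) (M (2 * g + 1)%N) => hM.
all: have [|q [hq e1 e2]] := ih _ (ltnW hj) _ hM; first by lia.
all: exists q; split=> //; rewrite expnSr divnMA e2; lia.
Qed.

Definition zeroM (M : nat -> nat) := forall h, (0 < h < 2 * P)%N -> M h = 0%N.

Lemma zero_tree kv M : zeroM M -> tree kv (fun=> 0%N) M.
Proof.
by move=> hz; split=> [q hq|h hh]; rewrite ?hz //; lia.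
Qed.

Lemma tree_zero kv f M : tree kv f M -> (forall q, (q < P)%N -> f q = 0%N) -> zeroM M.
Proof.
move=> ht hf h hh; case: (eqVneq (M h) 0%N) => // hM.
pose j := (L - trunc_log 2 h)%N.
have [h0 hP] : (0 < h)%N /\ (h < 2 ^ L.+1)%N by rewrite expnS; lia.
have hL : (trunc_log 2 h <= L)%N.
  by rewrite -ltnS -(ltn_exp2l (m := 2)) //; apply: leq_ltn_trans (trunc_logP _ h0) hP.
have [||q [hq e _]] := @tree_mem _ _ _ j h ht _ _ hM; first by rewrite leq_subr.
  by rewrite /j subKn // trunc_logP //= -expnS trunc_log_ltn.
by rewrite -e hf // in hM.
Qed.

(** ** Sorting *)

Definition rank kv (x : nat) : nat := #|[pred y : 'I_n | prec kv y x]|.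

Lemma rank_lt kv x : (x < n)%N -> (rank kv x < n)%N.
Proof.
move=> hx; rewrite -[X in (_ < X)%N]card_ord; apply: proper_card.
apply/properP; split; first exact: subset_predT.
by exists (Ordinal hx) => //; rewrite !inE prec_irr.
Qed.

Lemma rank_mono kv x y : (x < n)%N -> prec kv x y -> (rank kv x < rank kv y)%N.
Proof.
move=> hx hxy; apply: proper_card; apply/properP; split.
  by apply/fintype.subsetP => z; rewrite !inE => /prec_trans; apply.
by exists (Ordinal hx); rewrite !inE ?prec_irr.
Qed.

Lemma rank_inj kv x y : (x < n)%N -> (y < n)%N -> rank kv x = rank kv y -> x = y.
Proof.
move=> hx hy e; apply/eqP; case: eqVneq => // /(prec_total kv)/orP[] h.
  by have := rank_mono hx h; rewrite e ltnn.
by have := rank_mono hy h; rewrite e ltnn.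
Qed.

Lemma rank_prec kv x y : (x < n)%N -> (y < n)%N ->
  (rank kv x < rank kv y)%N -> prec kv x y.
Proof.
move=> hx hy h; have: x != y by apply: contraTneq h => ->; rewrite ltnn.
move=> /(prec_total kv)/orP[//|h']; have := rank_mono hy h'; lia.
Qed.

Lemma rank_surj kv i : (i < n)%N -> exists2 x, (x < n)%N & rank kv x = i.
Proof.
move=> hi; pose f (x : 'I_n) := Ordinal (rank_lt kv (ltn_ord x)).
have inj_f : injective f.
  by move=> x y [] /rank_inj e; apply: val_inj; apply: e.
have /codomP[x ex] := injF_onto inj_f (Ordinal hi).
by exists x => //; have [] := ex.
Qed.

Definition sort_by (key : wexp -> rexp) (o r : nat) : stmt :=
  Seq (ForN 2 (set_leaf key (V 2) (V 2 |+| ENum 1)))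
    (ForN 2 (Seq (Set_ 3 (EArr 7 (ENum 1) |-| ENum 1))
       (Seq (Store o (V 2) (V 3))
          (Seq (Store r (V 3) (V 2)) (set_leaf key (V 3) (ENum 0)))))).

Lemma n_lt_P2 : (n < P ^ 2)%N.
Proof. by apply: lt_P2; lia. Qed.

Lemma sort_byP key kv o r s : evals_to key kv -> bounded s -> zeroM (s 7%N) ->
  (12 < o)%N -> (o < r)%N ->
  runs_to (sort_by key o r) s (fun s' => zeroM (s' 7%N) /\
    forall x, (x < n)%N -> s' r x = rank kv x /\ s' o (rank kv x) = x).
Proof.
move=> hk bs hz ho hr.
have neo k : (k <= 12)%N -> k != o by lia.
have ner k : (k <= 12)%N -> k != r by lia.
have nor : o != r by lia.
apply: runs_seq => //.
pose f i q := if (q < n)%N && (q < i)%N then q.+1 else 0%N.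
apply: (@runs_forN _ _ _ (fun i s => tree kv (f i) (s 7%N))) => //.
- have -> : f 0%N = fun=> 0%N by apply/funext => q; rewrite /f ltn0 andbF.
  exact: zero_tree.
- move=> i s1 hi bs1 ht.
  have P2 := n_lt_P2.
  apply: runs_toW (set_leafP (q := i) hk _ ht _ _ _ _) => //.
  + move=> s' /=; rewrite upd_same eqxx addn1.
    congr (tree kv _ _); apply/funext => q; rewrite /f.
    case: eqVneq => [->|hq]; first by rewrite hi ltnSn.
    by have -> : (q < i.+1)%N = (q < i)%N by lia.
  + by apply: upd_bounded => //; apply: ltn_trans P2.
  + exact: leq_trans n_le.
  + by rewrite /= upd_same /=; lia.
move=> s1 bs1 ht _.
pose g i q := if (q < n)%N && (i <= rank kv q)%N then q.+1 else 0%N.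
pose I i s := tree kv (g i) (s 7%N) /\ forall x, (x < n)%N -> (rank kv x < i)%N ->
    s r x = rank kv x /\ s o (rank kv x) = x.
apply: (@runs_forN _ _ _ I) => //.
- split=> //; have -> // : g 0%N = f n.
  by apply/funext => q; rewrite /f /g andbT andbb.
- move=> i s2 hi bs2 [ht2 hr2].
  set s3 := upd s2 2 0 i.
  have bs3 : bounded s3 by apply: upd_bounded => //; apply: ltn_trans n_lt_P2.
  have s37 : s3 7%N = s2 7%N by [].
  have [x0 hx0 rx0] := rank_surj kv hi.
  have gx0 : g i x0 = x0.+1 by rewrite /g hx0 rx0 leqnn.
  have x0P : (x0 < P)%N by exact: leq_trans n_le.
  have [|h1 h2] := tree_anc ht2 x0P _ (leqnn L); first by rewrite gx0.
  have root1 : ((P + x0) %/ 2 ^ L = 1)%N.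
    by rewrite -/P divnDl ?dvdnn // divnn expn_gt0 divn_small // addn0.
  rewrite root1 in h1 h2.
  have [|q [hqP gq _]] := tree_mem ht2 (leqnn L) _ h1; first by rewrite subnn.
  have [hqn hiq] : (q < n)%N /\ (i <= rank kv q)%N.
    by apply/andP; move: gq h1; rewrite /g; case: ifP => // _ <-.
  have M1 : s2 7%N 1%N = q.+1 by rewrite -gq /g hqn hiq.
  have qx0 : q = x0.
    apply: (rank_inj hqn hx0 (kv := kv)); rewrite rx0.
    apply/eqP; rewrite eqn_leq hiq andbT.
    move: h2; rewrite M1 gx0 /= => /orP[/eqP->|/(rank_mono hqn)]; rewrite rx0 //.
    exact: ltnW.
  have rq : rank kv q = i by rewrite qx0.
  apply: runs_seq => //; split; first by rewrite /= s37 M1; have := n_lt_P2; lia.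
  move=> bs4; set s4 := den _ _ in bs4 *.
  have s43 : s4 3%N 0%N = q by rewrite /s4 /= upd_same /= s37 M1 subn1.
  have s42 : s4 2%N 0%N = i by [].
  apply: runs_seq => //; split; first by rewrite /= s43; have := n_lt_P2; lia.
  move=> bs5; set s5 := den _ _ in bs5 *.
  have s5E k : (k <= 12)%N -> s5 k = s4 k by move=> hk'; rewrite /s5 /= upd_other ?neo.
  apply: runs_seq => //; split; first by rewrite /= s5E // s42; have := n_lt_P2; lia.
  move=> bs6; set s6 := den _ _ in bs6 *.
  have s6E k : (k <= 12)%N -> s6 k = s4 k.
    by move=> hk'; rewrite /s6 /= upd_other ?ner // s5E.
  have ht6 : tree kv (g i) (s6 7%N) by rewrite s6E.
  have hset : runs_to (set_leaf key (V 3) (ENum 0)) s6 (fun s' =>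
      tree kv (fun q' => if q' == q then 0%N else g i q') (s' 7%N)).
    apply: (set_leafP hk bs6 ht6 hqP) => //=; first by rewrite s6E.
    by rewrite !expn_gt0.
  apply: runs_toW (runs_to_frame bs6 hset) => s' [ht7 bs7 fr].
  have s7o : s' o = s6 o.
    by apply: fr; rewrite /= !inE; lia.
  have s7r : s' r = s6 r.
    by apply: fr; rewrite /= !inE; lia.
  split=> [|x hx].
    move: ht7; congr (tree kv _ _); apply/funext => q' /=; rewrite /g.
    case: eqVneq => [->|hq']; first by rewrite rq ltnn andbF.
    case: ltnP => //= hq'n; suff -> : (i <= rank kv q')%N = (i < rank kv q')%N by [].
    rewrite leq_eqVlt; case: eqVneq => //= e.
    by rewrite (rank_inj hqn hq'n (kv := kv)) ?rq ?eqxx // in hq'.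
  have s4E k : (12 < k)%N -> s4 k = s2 k.
    by move=> hk'; rewrite /s4 /= /s3 !upd_other //; lia.
  have s6r : s6 r x = if x == q then i else s2 r x.
    rewrite /s6 /= upd_same /= s5E // s5E // s43 s42 /s5 /= upd_other 1?eq_sym //.
    by rewrite s4E //; lia.
  have s6o j : s6 o j = if j == i then q else s2 o j.
    rewrite /s6 /= upd_other // /s5 /= upd_same s42 s43.
    by rewrite s4E //; lia.
  rewrite s7o s7r s6r s6o; case: (eqVneq x q) => [->|hxq]; first by rewrite rq eqxx.
  rewrite ltnS leq_eqVlt => /orP[/eqP e|hlt].
    by rewrite (rank_inj hx hqn (kv := kv)) ?rq ?eqxx // in hxq.
  by rewrite ltn_eqF //; apply: hr2.
- move=> s' bs' [ht' hr']; split.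
    by apply: tree_zero ht' _ => q hq; rewrite /g; case: ltnP => //= hqn;
      rewrite leqNgt rank_lt.
  by move=> x hx; apply: hr' => //; apply: rank_lt.
Qed.

(** ** Comparing candidate pairs *)

Definition coord (e : wexp) c := XCoord (e |+| ENum 1) c [-] XCoord (ENum 0) c.

Definition cv (i c : nat) : R := inp (3 * (i + 1) + c)%N - inp (3 * 0 + c)%N.

Definition xsqr x := x [*] x.

Definition xdist2 e e' :=
  (xsqr (coord e 1 [*] coord e' 2 [-] coord e 2 [*] coord e' 1)
   [+] xsqr (coord e 2 [*] coord e' 0 [-] coord e 0 [*] coord e' 2)
   [+] xsqr (coord e 0 [*] coord e' 1 [-] coord e 1 [*] coord e' 0))
  [/] (xsqr (coord e 0 [-] coord e' 0) [+] xsqr (coord e 1 [-] coord e' 1)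
      [+] xsqr (coord e 2 [-] coord e' 2)).

Definition dist2 (i j : nat) : R :=
  ((cv i 1 * cv j 2 - cv i 2 * cv j 1) ^+ 2 + (cv i 2 * cv j 0 - cv i 0 * cv j 2) ^+ 2
   + (cv i 0 * cv j 1 - cv i 1 * cv j 0) ^+ 2)
  / ((cv i 0 - cv j 0) ^+ 2 + (cv i 1 - cv j 1) ^+ 2 + (cv i 2 - cv j 2) ^+ 2).

Definition check e e' : stmt :=
  If (TWEq e e') Skip
    (If (TRLt (xdist2 e e') (xdist2 (V 0) (V 1)))
       (Seq (Set_ 0 e) (Set_ 1 e')) Skip).

Definition best (s : store) : R := dist2 (s 0%N 0%N) (s 1%N 0%N).
Definition valid (s : store) : Prop :=
  [/\ (s 0%N 0%N < n)%N, (s 1%N 0%N < n)%N & s 0%N 0%N != s 1%N 0%N].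

Lemma checkP e e' s : bounded s -> valid s ->
  (weval e s < n)%N -> (weval e' s < n)%N ->
  (forall h, weval e' (upd s 0 0 h) = weval e' s) ->
  runs_to (check e e') s (fun s' => [/\ valid s', best s' <= best s &
    weval e s != weval e' s -> best s' <= dist2 (weval e s) (weval e' s)]).
Proof.
move=> bs hv hi hj hw; have P2 := n_lt_P2.
rewrite /runs_to /check denIf safeIf.
have -> : teval (TWEq e e') s = (weval e s == weval e' s) by [].
case: eqVneq => [|hne]; first by [].
rewrite denIf safeIf.
have -> : teval (TRLt (xdist2 e e') (xdist2 (V 0) (V 1))) s =
  (dist2 (weval e s) (weval e' s) < best s) by [].
case: ltP => [h|h]; last by [].
split; first by split=> /=; rewrite ?hw; apply: ltn_trans P2.
set s' := den _ s.
have e0 : s' 0%N 0%N = weval e s by [].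
have e1 : s' 1%N 0%N = weval e' s by rewrite -(hw (weval e s)).
by rewrite /valid /best e0 e1; split=> //; apply: ltW.
Qed.

Definition guard (l : seq (bool * htest)) (st : stmt) : stmt :=
  foldr (fun p st => if p.1 then If p.2 st Skip else If p.2 Skip st) st l.

Lemma guardE l st s : let b := all (fun p => teval p.2 s == p.1) l in
  den (guard l st) s = (if b then den st s else s) /\
  safe (guard l st) s = (if b then safe st s else True).
Proof.
elim: l => [//|[[] t] l [ihd ihs]] /=; case: (teval t s) => //=.
Qed.

Definition filters (act : wexp -> seq (bool * htest)) (av : nat -> bool) :=
  forall e s, all (fun p => teval p.2 s == p.1) (act e) = av (weval e s).

Lemma runs_guard act av e st s (Q : store -> Prop) : filters act av ->
  (av (weval e s) -> runs_to st s Q) -> (~~ av (weval e s) -> Q s) ->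
  runs_to (guard (act e) st) s Q.
Proof.
move=> ha h1 h2; have [d1 d2] := guardE (act e) st s.
rewrite /runs_to d1 d2 ha; case: ifP => h; first exact: h1.
by split=> //; apply: h2; rewrite h.
Qed.

Definition component (st : stmt) (E : R -> Prop) := forall s,
  bounded s -> valid s -> zeroM (s 7%N) ->
  runs_to st s (fun s' => [/\ valid s', zeroM (s' 7%N), best s' <= best s &
    E (best s')]).

Definition downward (E : R -> Prop) := forall u v, u <= v -> E v -> E u.

Lemma component_seq a b E F : downward E -> component a E -> component b F ->
  component (Seq a b) (fun u => E u /\ F u).
Proof.
move=> dE ha hb s bs vs zs; apply: runs_seq => //.
apply: runs_toW (ha s bs vs zs) => s1 [v1 z1 l1 e1] bs1.
apply: runs_toW (hb s1 bs1 v1 z1) => s2 [v2 z2 l2 e2].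
by split=> //; [apply: le_trans l1|split=> //; apply: dE e1].
Qed.

Definition seqs (l : seq stmt) : stmt := foldr Seq Skip l.

Lemma component_seqs (T : eqType) (l : seq T) (st : T -> stmt) (E : T -> R -> Prop) :
  (forall x, downward (E x)) -> (forall x, component (st x) (E x)) ->
  component (seqs (map st l)) (fun u => forall x, x \in l -> E x u).
Proof.
move=> dE hc; elim: l => [|x l ih] /=; first by move=> s bs vs zs; split.
move=> s bs vs zs; apply: runs_toW (component_seq (dE x) (hc x) ih bs vs zs).
move=> s' [v1 z1 l1 [e1 e2]]; split=> // y; rewrite inE => /orP[/eqP->//|].
exact: e2.
Qed.

Definition star : stmt := ForN 2 (check (ENum 0) (V 2)).

Lemma starP : component star (fun u => forall i, (i < n)%N -> i != 0%N ->
  u <= dist2 0 i).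
Proof.
move=> s0 bs vs zs.
pose I i s := [/\ valid s, s 7%N = s0 7%N, best s <= best s0 &
  forall j, (j < i)%N -> j != 0%N -> best s <= dist2 0 j].
apply: (@runs_forN _ _ _ I) => //; last first.
  by move=> s' bs' [v' z' l' e']; split=> //; rewrite z'.
move=> i s hi bsi [vi zi li ei].
have bs2 : bounded (upd s 2 0 i).
  by apply: upd_bounded => //; apply: ltn_trans n_lt_P2.
have := @checkP (ENum 0) (V 2) (upd s 2 0 i) bs2 vi n_gt0.
rewrite /= upd_same => /(_ hi (fun=> erefl)) hc.
apply: runs_toW (runs_to_frame bs2 hc) => s' [[v' l' e'] b' fr].
split=> //; [by rewrite fr|exact: le_trans li|move=> j].
rewrite ltnS leq_eqVlt => /orP[/eqP-> h|h h']; first by apply: e'; rewrite eq_sym.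
by apply: le_trans l' (ei _ h h').
Qed.

(** ** Extreme points of a cell *)

Definition scan (act : wexp -> seq (bool * htest)) (key : wexp -> rexp) : stmt :=
  Seq (Set_ 5 (ENum 0))
    (Seq (ForN 2 (guard (act (V 2))
            (If (TWEq (V 5) (ENum 0)) (Set_ 5 (V 2 |+| ENum 1))
               (If (TRLt (key (V 2)) (key (V 5 |-| ENum 1)))
                  (Set_ 5 (V 2 |+| ENum 1)) Skip))))
       (ForN 2 (If (TWEq (V 5) (ENum 0)) Skip (check (V 2) (V 5 |-| ENum 1))))).

Definition scanned (av : nat -> bool) (kv : nat -> R) (u : R) := forall b, (b < n)%N -> av b ->
  exists b', [/\ (b' < n)%N, av b', kv b' <= kv b &
    forall a, (a < n)%N -> a != b' -> u <= dist2 a b'].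

Lemma scanP act av key kv : filters act av -> evals_to key kv ->
  component (scan act key) (scanned av kv).
Proof.
move=> ha hk s0 bs0 vs zs; have P2 := n_lt_P2.
apply: runs_seq => //; split; first by rewrite /= !expn_gt0.
move=> bs1; set s1 := den _ _ in bs1 *.
apply: runs_seq => //.
pose J i s := [/\ s 0%N = s0 0%N, s 1%N = s0 1%N & s 7%N = s0 7%N] /\
  if s 5%N 0%N is b'.+1 then [/\ (b' < n)%N, av b' &
      forall b, (b < i)%N -> av b -> kv b' <= kv b]
  else forall b, (b < i)%N -> ~~ av b.
apply: (@runs_forN _ _ _ J) => //.
- move=> i s hi bs [hs hJ]; set s' := upd s 2 0 i.
  have s'5 : s' 5%N 0%N = s 5%N 0%N by [].
  have s'2 : s' 2%N 0%N = i by rewrite /s' upd_same.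
  have hval : (weval (V 2 |+| ENum 1) s' < P ^ 2)%N by rewrite /= s'2; lia.
  apply: (runs_guard ha); rewrite /= s'2 => avi; last first.
    split=> //=; rewrite s'5; case: (s 5%N 0%N) hJ => [|b'].
      move=> h b; rewrite ltnS leq_eqVlt => /orP[/eqP->//|]; exact: h.
    case=> h1 h2 h3; split=> // b; rewrite ltnS leq_eqVlt => /orP[/eqP->|]; last exact: h3.
    by rewrite (negbTE avi).
  rewrite /runs_to denIf safeIf.
  have -> : teval (TWEq (V 5) (ENum 0)) s' = (s 5%N 0%N == 0%N) by [].
  case: eqP hJ => [->|/eqP e5] hJ.
    split=> //; split=> //=; rewrite upd_same /= s'2 addn1; split=> // b.
    rewrite ltnS leq_eqVlt => /orP[/eqP->//|h ab].
    by have := hJ b h; rewrite ab.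
  rewrite denIf safeIf.
  have -> : teval (TRLt (key (V 2)) (key (V 5 |-| ENum 1))) s' =
      (kv i < kv (s 5%N 0%N).-1) by rewrite /= !hk /= s'2 s'5 subn1.
  case: (s 5%N 0%N) e5 hJ (s'5) => [//|b'] _ [h1 h2 h3] /= e5'.
  case: ltP => hlt.
    split=> //; split=> //=; rewrite upd_same /= s'2 addn1; split=> // b.
    rewrite ltnS leq_eqVlt => /orP[/eqP->//|h ab].
    by apply: le_trans (ltW hlt) (h3 _ h ab).
  split=> //; split=> //; rewrite e5'; split=> // b.
  by rewrite ltnS leq_eqVlt => /orP[/eqP->//|]; exact: h3.
- move=> s2 bs2 [[e0 e1 e7] hJ] _.
  have best2 : best s2 = best s0 by rewrite /best e0 e1.
  have v2 : valid s2 by rewrite /valid e0 e1.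
  pose I i s := [/\ valid s, s 7%N = s0 7%N, s 5%N = s2 5%N, best s <= best s0 &
    if s2 5%N 0%N is b'.+1 then forall a, (a < i)%N -> a != b' ->
      best s <= dist2 a b' else True].
  apply: (@runs_forN _ _ _ I) => //.
  + by split=> //; rewrite ?best2 //; case: (s2 5%N 0%N).
  + move=> i s hi bs [vi zi ei li Ei]; set s' := upd s 2 0 i.
    have bs' : bounded s' by apply: upd_bounded => //; apply: ltn_trans P2.
    have s'5 : s' 5%N 0%N = s2 5%N 0%N by rewrite -ei.
    have s'2 : s' 2%N 0%N = i by rewrite /s' upd_same.
    have -> : runs_to (If (TWEq (V 5) (ENum 0)) Skip (check (V 2) (V 5 |-| ENum 1))) s'
       (I i.+1) = if s2 5%N 0%N == 0%N then runs_to Skip s' (I i.+1) else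
      runs_to (check (V 2) (V 5 |-| ENum 1)) s' (I i.+1).
      by rewrite /runs_to denIf safeIf /= s'5; case: ifP.
    case: eqP => [e5|]; first by split=> //; split=> //; rewrite e5.
    move: hJ; case e5: (s2 5%N 0%N) => [//|b'] [h1 h2 h3] _.
    have := @checkP (V 2) (V 5 |-| ENum 1) s' bs' vi.
    have s'5' : (s' 5%N 0%N - 1)%N = b' by rewrite s'5 e5 subn1.
    rewrite /= s'2 s'5' => /(_ hi h1 (fun=> erefl)) hc.
    apply: runs_toW (runs_to_frame bs' hc) => s3 [[v' l' e'] b3 fr].
    split=> //; [by rewrite fr|by rewrite fr|exact: le_trans li|rewrite e5 => a].
    rewrite ltnS leq_eqVlt => /orP[/eqP-> h|h h']; first exact: e'.
    by apply: le_trans l' _; move: Ei; rewrite e5; apply.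
  + move=> s' bs' [v' z' e5 l' E']; split=> //; first by rewrite z'.
    move=> b hb ab; move: hJ E'; case: (s2 5%N 0%N) => [h|b' [h1 h2 h3] h].
      by have := h b hb; rewrite ab.
    by exists b'; split=> //; apply: h3.
Qed.

(** ** Dominance sweep *)

Lemma branching_level u v K : (u < v)%N -> (u %/ 2 ^ K = v %/ 2 ^ K)%N ->
  exists j, [/\ (j < K)%N, (v %/ 2 ^ j %% 2 = 1)%N & (u %/ 2 ^ j = v %/ 2 ^ j - 1)%N].
Proof.
move=> huv; elim: K => [|K ih]; first by rewrite !divn1; lia.
case: (eqVneq (u %/ 2 ^ K) (v %/ 2 ^ K))%N => [e _|hne].
  by have [j [hj h1 h2]] := ih e; exists j; split=> //; exact: ltnW.
have hle := leq_div2r (2 ^ K) (ltnW huv).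
rewrite !expnSr !divnMA => e.
move: hle hne e; set x := (u %/ _)%N; set y := (v %/ _)%N => hle hne e.
exists K; split=> //; rewrite -/x -/y; clearbody x y; lia.
Qed.

Definition query : stmt :=
  Seq (Set_ 4 (EPow |+| EArr 16 (V 3)))
    (ForL 12
       (Seq (If (TWEq (EBin WMod (V 4) (ENum 2)) (ENum 1))
               (Seq (Set_ 6 (EArr 7 (V 4 |-| ENum 1)))
                  (If (TWEq (V 6) (ENum 0)) Skip (check (V 3) (V 6 |-| ENum 1))))
               Skip)
          (Set_ 4 (V 4 |/| ENum 2)))).

Lemma queryP kv f s a q : bounded s -> valid s -> tree kv f (s 7%N) ->
  (forall q, (q < P)%N -> f q != 0%N -> ((f q).-1 < n)%N) ->
  (q < P)%N -> s 3%N 0%N = a -> (a < n)%N -> s 16%N a = q ->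
  runs_to query s (fun s' => [/\ valid s', best s' <= best s &
    forall j, (j < L)%N -> let h := ((P + q) %/ 2 ^ j)%N in
      (h %% 2 = 1)%N -> s 7%N (h - 1)%N != 0%N -> a != (s 7%N (h - 1)%N).-1 ->
      best s' <= dist2 a (s 7%N (h - 1)%N).-1]).
Proof.
move=> bs vs ht hf hq s3 ha s16; have P2 := n_lt_P2.
apply: runs_seq => //; split; first by rewrite /= s3 s16; apply: lt_P2; lia.
move=> bs1; set s1 := den _ _ in bs1 *.
pose I i s' := [/\ [/\ valid s', s' 3%N = s 3%N, s' 7%N = s 7%N & best s' <= best s],
  s' 4%N 0%N = ((P + q) %/ 2 ^ i)%N &
  forall j, (j < i)%N -> let h := ((P + q) %/ 2 ^ j)%N in
      (h %% 2 = 1)%N -> s 7%N (h - 1)%N != 0%N -> a != (s 7%N (h - 1)%N).-1 ->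
      best s' <= dist2 a (s 7%N (h - 1)%N).-1].
apply: (@runs_forL _ _ _ I) => //.
- by split=> //; rewrite /s1 /= s3 s16 divn1.
- move=> i t hi bt [[vt t3 t7 lt] t4 Et]; set t' := upd t 12 0 i.
  have bt' : bounded t'.
    by apply: upd_bounded => //; apply: lt_P2; have := ltn_expl L (ltnSn 1); rewrite -/P; lia.
  pose h := ((P + q) %/ 2 ^ i)%N.
  have t'4 : t' 4%N 0%N = h by [].
  have t'3 : t' 3%N 0%N = a by rewrite -s3 -t3.
  have t'7 : t' 7%N = s 7%N by rewrite -t7.
  have hlt : (h < 2 * P)%N by apply: leq_ltn_trans (leq_div _ _) _; lia.
  set E := fun s' => (h %% 2 = 1)%N -> s 7%N (h - 1)%N != 0%N ->
     a != (s 7%N (h - 1)%N).-1 -> best s' <= dist2 a (s 7%N (h - 1)%N).-1.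
  apply: runs_seq => //.
  apply: (@runs_toW _ _ (fun s' => [/\ [/\ valid s', s' 3%N = s 3%N, s' 7%N = s 7%N &
     best s' <= best t], s' 4%N 0%N = h & E s'])).
    move=> t5 [[v5 e3 e7 l5] e4 E5] b5; split.
      by rewrite /= e4; apply: lt_P2; apply: leq_ltn_trans (leq_div _ _) _.
    split; [by split=> //; exact: le_trans lt|by rewrite /= upd_same /= e4 expnSr divnMA|].
    move=> j; rewrite ltnS leq_eqVlt => /orP[/eqP->|hj]; first exact: E5.
    by move=> g h1 h2 h3; apply: le_trans l5 _; apply: Et.
  rewrite runs_if.
  have -> : teval (TWEq (EBin WMod (V 4) (ENum 2)) (ENum 1)) t' = (h %% 2 == 1)%N
    by rewrite /= t'4.
  case: (h %% 2 =P 1)%N => h1; last by split=> //; split=> // /h1.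
  apply: runs_seq => //; split; first by apply: bt'.
  move=> bu; set u := den _ _ in bu *.
  have u6 : u 6%N 0%N = s 7%N (h - 1)%N.
    by rewrite /u /= upd_same /= t'4 t'7.
  have u3 : u 3%N 0%N = a by [].
  have vu : valid u by [].
  rewrite runs_if.
  have -> : teval (TWEq (V 6) (ENum 0)) u = (s 7%N (h - 1)%N == 0%N) by rewrite /= u6.
  case: (s 7%N (h - 1)%N =P 0%N) => c0; first by split=> //; split=> // _ /eqP.
  have hpos : (0 < 2 ^ i)%N by rewrite expn_gt0.
  have hPe : (P = 2 ^ (L - i) * 2 ^ i)%N by rewrite -expnD subnK // ltnW.
  have hrange : (2 ^ (L - i) <= h - 1 < 2 * 2 ^ (L - i))%N.
    have : (2 ^ (L - i) <= h)%N by rewrite /h leq_divRL // -hPe leq_addr.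
    have : (h < 2 * 2 ^ (L - i))%N by rewrite /h ltn_divLR // -mulnA -hPe; lia.
    have : (2 ^ (L - i) %% 2 = 0)%N by rewrite -(subnSK hi) expnS modnMr.
    by lia.
  have [q' [hq' fq' _]] := tree_mem ht (ltnW hi) hrange (introN eqP c0).
  have cn : ((s 7%N (h - 1)%N).-1 < n)%N by rewrite -fq' hf // fq'; apply/eqP.
  have := @checkP (V 3) (V 6 |-| ENum 1) u bu vu.
  rewrite [weval (V 3) u]/= u3 [weval (V 6 |-| ENum 1) u]/= u6 subn1.
  have hw h0 : weval (V 6 |-| ENum 1) (upd u 0 0 h0) = (s 7%N (h - 1)%N).-1.
    by rewrite -subn1 -u6.
  move=> /(_ ha cn hw) hc.
  apply: runs_toW (runs_to_frame bu hc) => w [[vw lw Ew] bw fr].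
  by split; [split=> //; rewrite fr|rewrite fr|move=> _ _; apply: Ew].
- by move=> s' bs' [[v' _ _ l'] _ E'].
Qed.

Definition sweep (act : wexp -> seq (bool * htest)) (key1 key2 key : wexp -> rexp) : stmt :=
  Seq (sort_by key1 13 14) (Seq (sort_by key2 15 16)
    (Seq (ForN 2 (Seq (Set_ 3 (EArr 13 (V 2)))
            (guard (act (V 3)) (Seq query (set_leaf key (EArr 16 (V 3)) (V 3 |+| ENum 1))))))
         (ForN 2 (set_leaf key (V 2) (ENum 0))))).

Definition swept (av : nat -> bool) (k1 k2 kv : nat -> R) (u : R) :=
  forall a b, (a < n)%N -> (b < n)%N -> av a -> av b -> prec k1 b a -> prec k2 b a ->
  exists b', [/\ (b' < n)%N, av b', prec k1 b' a, prec k2 b' a &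
    kv b' <= kv b /\ u <= dist2 a b'].

Lemma sweepP act av key1 k1 key2 k2 key kv : filters act av ->
  evals_to key1 k1 -> evals_to key2 k2 -> evals_to key kv ->
  component (sweep act key1 key2 key) (swept av k1 k2 kv).
Proof.
move=> hact h1 h2 hk s0 bs0 vs0 zs0; have P2 := n_lt_P2.
apply: runs_seq => //.
apply: runs_toW (runs_to_frame bs0 (sort_byP (o := 13) (r := 14) h1 bs0 zs0 isT isT)).
move=> s1 [[z1 r1] _ fr1] bs1; apply: runs_seq => //.
apply: runs_toW (runs_to_frame bs1 (sort_byP (o := 15) (r := 16) h2 bs1 z1 isT isT)).
move=> s2 [[z2 r2] _ fr2] bs2; apply: runs_seq => //.
have v2 : valid s2 by rewrite /valid !fr2 // !fr1.
have best2 : best s2 = best s0 by rewrite /best !fr2 // !fr1.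
have o1E x : (x < n)%N -> s2 13%N (rank k1 x) = x.
  by move=> hx; rewrite fr2 //; have [] := r1 x hx.
pose ov := s2 15%N.
have ovE q : (q < n)%N -> (ov q < n)%N /\ rank k2 (ov q) = q.
  move=> hq; have [x hx <-] := rank_surj k2 hq.
  by rewrite /ov (r2 x hx).2.
pose f i q := if [&& (q < n)%N, av (ov q) & (rank k1 (ov q) < i)%N]
  then (ov q).+1 else 0%N.
have fn i q : (q < P)%N -> f i q != 0%N -> ((f i q).-1 < n)%N.
  by move=> _; rewrite /f; case: ifP => // /and3P[hq _ _] _; have [] := ovE q hq.
pose I i s := [/\ [/\ valid s, s 13%N = s2 13%N & s 16%N = s2 16%N],
  tree kv (f i) (s 7%N), best s <= best s2 &
  forall a, (a < n)%N -> (rank k1 a < i)%N -> forall b, (b < n)%N -> av a -> av b ->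
    prec k1 b a -> prec k2 b a ->
    exists b', [/\ (b' < n)%N, av b', prec k1 b' a, prec k2 b' a &
      kv b' <= kv b /\ best s <= dist2 a b']].
apply: (@runs_forN _ _ _ I) => //.
- split=> //; have -> : f 0%N = fun=> 0%N.
    by apply/funext => q; rewrite /f ltn0 !andbF.
  exact: zero_tree.
- move=> i s hi bs [[vs s13 s16] ht lb Es]; set s' := upd s 2 0 i.
  have bs' : bounded s' by apply: upd_bounded => //; apply: ltn_trans P2.
  have [x hx rx] := rank_surj k1 hi.
  have s'2 : s' 2%N 0%N = i by rewrite /s' upd_same.
  have s'13 : s' 13%N i = x by rewrite [s' 13%N]s13 -rx o1E.
  apply: runs_seq => //; split; first by rewrite /= s'2 s'13; lia.
  move=> bt; set t := den _ _ in bt *.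
  have t3 : t 3%N 0%N = x by rewrite /t /= upd_same /= s'2.
  have t7 : t 7%N = s 7%N by [].
  have vt : valid t by [].
  have bestt : best t = best s by [].
  have [_ ov2] := r2 x hx; have rx2 := rank_lt k2 hx.
  have fi q : (q < n)%N -> ov q != x -> f i.+1 q = f i q.
    move=> hq hne; rewrite /f; have [hoq roq] := ovE q hq.
    case: (eqVneq (rank k1 (ov q)) i) => [e|hi'].
      by rewrite (rank_inj hoq hx (kv := k1)) ?eqxx ?e // in hne.
    by have -> : (rank k1 (ov q) < i.+1)%N = (rank k1 (ov q) < i)%N by lia.
  have new_or_old a : (rank k1 a < i.+1)%N -> (a < n)%N -> a = x \/ (rank k1 a < i)%N.
    rewrite ltnS leq_eqVlt => /orP[/eqP e|hlt] han; last by right.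
    by left; apply: (rank_inj han hx (kv := k1)); rewrite e.
  apply: (runs_guard hact); rewrite /= t3 => avx; last first.
    split=> //.
      rewrite t7; have -> // : f i.+1 = f i.
      apply/funext => q; case: (ltnP q n) => hq; last by rewrite /f ltnNge hq.
      case: (eqVneq (ov q) x) => [e|]; last exact: fi.
      by rewrite /f e (negbTE avx) !andbF.
    move=> a han hra b hb aa; have [eax|hlt] := new_or_old a hra han.
      by rewrite -eax aa in avx.
    exact: Es.
  have t16 : t 16%N x = rank k2 x.
    by rewrite [t 16%N]s16; have [] := r2 x hx.
  have hqP : (rank k2 x < P)%N by exact: leq_trans n_le.
  have ht' : tree kv (f i) (t 7%N) by [].
  apply: runs_seq => //.
  apply: runs_toW (runs_to_frame bt (queryP bt vt ht' (fn i) hqP t3 hx t16)).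
  move=> u [[vu lu Eu] _ fru] bu.
  have u3 : u 3%N 0%N = x by rewrite fru.
  have u16 : u 16%N x = rank k2 x by rewrite fru.
  have htu : tree kv (f i) (u 7%N) by rewrite fru.
  have hset : runs_to (set_leaf key (EArr 16 (V 3)) (V 3 |+| ENum 1)) u (fun s' =>
      tree kv (fun q' => if q' == rank k2 x then x.+1 else f i q') (s' 7%N)).
    have := set_leafP (pos := EArr 16 (V 3)) (val := V 3 |+| ENum 1) hk bu htu hqP.
    rewrite /= u3 u16 addn1 => /(_ erefl); apply; last by lia.
    by move=> h; rewrite -u3 addn1.
  apply: runs_toW (runs_to_frame bu hset) => w [htw bw frw].
  have bestw : best w = best u by rewrite /best !frw.
  split.
  + by split; [rewrite /valid !frw // !fru|rewrite frw // fru|rewrite frw // fru].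
  + move: htw; congr (tree kv _ _); apply/funext => q.
    case: eqVneq => [->|hne].
      by rewrite /f rx2 [ov _]ov2 avx rx ltnSn.
    case: (ltnP q n) => hq; last by rewrite /f !(ltnNge q) hq.
    rewrite fi //; apply: contra_neq hne => <-.
    by have [_ ->] := ovE q hq.
  + by rewrite bestw; apply: le_trans lb; rewrite -bestt.
  + move=> a han hra b hb aa ab; have [eax|hlt] := new_or_old a hra han; last first.
      move=> p1 p2; have [b' [h3 h4 h5 h6 [h7 h8]]] := Es a han hlt b hb aa ab p1 p2.
      by exists b'; split=> //; split=> //; rewrite bestw; apply: le_trans lu _.
    rewrite eax => p1 p2.
    have hr1 : (rank k1 b < i)%N by rewrite -rx; apply: rank_mono.
    have hr2 : (rank k2 b < rank k2 x)%N by apply: rank_mono.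
    have hrn := rank_lt k2 hb.
    have fb : f i (rank k2 b) = b.+1.
      by rewrite /f hrn /ov (r2 b hb).2 ab hr1.
    have top q : (q < P)%N -> ((P + q) %/ 2 ^ L = 1)%N.
      by move=> hq; rewrite -/P divnDl ?dvdnn // divnn expn_gt0 divn_small // addn0.
    have hbP : (rank k2 b < P)%N by exact: leq_trans n_le.
    have [||j [hj j1 j2]] := @branching_level (P + rank k2 b) (P + rank k2 x) L.
    - by rewrite ltn_add2l.
    - by rewrite !top.
    have := tree_anc ht' hbP _ (ltnW hj); rewrite fb /= j2 => /(_ isT).
    set g := (_ - 1)%N; move=> [c0 hc].
    have hpos : (0 < 2 ^ j)%N by rewrite expn_gt0.
    have hPe : (P = 2 ^ (L - j) * 2 ^ j)%N by rewrite -expnD subnK // ltnW.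
    have hrange : (2 ^ (L - j) <= g < 2 * 2 ^ (L - j))%N.
      by rewrite /g -j2 leq_divRL // ltn_divLR // -mulnA -hPe leq_addr mul2n -addnn ltn_add2l.
    have [q [hqq fq eq']] := tree_mem ht' (ltnW hj) hrange c0.
    have fq0 : f i q != 0%N by rewrite fq.
    have [hqn aq rq] : [/\ (q < n)%N, av (ov q) & (rank k1 (ov q) < i)%N].
      by apply/and3P; move: fq0; rewrite /f; case: ifP.
    have fqE : f i q = (ov q).+1 by rewrite /f hqn aq rq.
    have [hoq roq] := ovE q hqn.
    have cE : (t 7%N g).-1 = ov q by rewrite -fq fqE.
    have hqx : (q < rank k2 x)%N.
      rewrite -(ltn_add2l P) ltnNge; apply/negP => /(leq_div2r (2 ^ j)).
      rewrite eq' /g; move: j1; case: (_ %/ _)%N => // h _.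
      by rewrite subn1 /= ltnn.
    exists (ov q); split=> //.
    - by apply: (rank_prec hoq hx); rewrite rx.
    - by apply: (rank_prec hoq hx); rewrite roq.
    - split; first by rewrite -cE; exact: preceq_le hc.
      rewrite bestw -cE; apply: Eu => //; rewrite cE.
      by apply: contraTneq rq => <-; rewrite rx ltnn.
- move=> s3 bs3 [[v3 _ _] ht3 l3 E3] _.
  pose g i q := if (i <= q)%N then f n q else 0%N.
  pose J i s := [/\ valid s, tree kv (g i) (s 7%N) & best s = best s3].
  apply: (@runs_forN _ _ _ J) => //.
  + move=> i s hi bs [vs ht eb]; set s' := upd s 2 0 i.
    have bs' : bounded s' by apply: upd_bounded => //; apply: ltn_trans P2.
    have hiP : (i < P)%N by exact: leq_trans n_le.
    have ht' : tree kv (g i) (s' 7%N) by [].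
    have hset : runs_to (set_leaf key (V 2) (ENum 0)) s' (fun s' =>
      tree kv (fun q' => if q' == i then 0%N else g i q') (s' 7%N)).
      by apply: (set_leafP hk bs' ht' hiP) => //=; rewrite ?upd_same ?expn_gt0.
    apply: runs_toW (runs_to_frame bs' hset) => w [htw bw frw].
    split; [by rewrite /valid !frw| |by rewrite /best !frw].
    move: htw; congr (tree kv _ _); apply/funext => q; rewrite /g.
    case: eqVneq => [->|hne]; first by rewrite ltnn.
    by have -> : (i <= q)%N = (i < q)%N by lia.
  + move=> s' bs' [v' t' e']; split=> //.
    * apply: tree_zero t' _ => q hq; rewrite /g; case: leqP => // hnq.
      by rewrite /f ltnNge hnq.
    * by rewrite e' -best2.
    * move=> a b ha hb aa ab p1 p2; rewrite e'; apply: E3 => //; exact: rank_lt.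
Qed.

End Algorithm.

(** * The main program *)

Section MainProgram.
Variable q : nat.

Definition xslope (c k : nat) (e : wexp) : rexp := coord e ((c + k) %% 3) [/] coord e c.

Definition grid_lo (N k : nat) : rat := k%:Q / N%:Q - 2.
Definition grid_hi (N k : nat) : rat := (k%:Q + 2) / N%:Q - 2.

Definition in_cell (N : nat) (g : nat * (nat * nat)) (e : wexp) : seq (bool * htest) :=
  [:: (false, TREq (coord e g.1) (XConst 0));
      (false, TRLt (xslope g.1 1 e) (XConst (grid_lo N g.2.1)));
      (false, TRLt (XConst (grid_hi N g.2.1)) (xslope g.1 1 e));
      (false, TRLt (xslope g.1 2 e) (XConst (grid_lo N g.2.2)));
      (false, TRLt (XConst (grid_hi N g.2.2)) (xslope g.1 2 e))].

Definition xinv (c : nat) (sg : bool) (e : wexp) : rexp :=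
  XConst (if sg then 1 else -1) [/] coord e c.

Definition xcone1 (j c k k' : nat) (e : wexp) : rexp :=
  XConst (cone_slope q j) [*] xslope c k e [-] xslope c k' e.
Definition xcone2 (j c k k' : nat) (e : wexp) : rexp :=
  xslope c k' e [-] XConst (cone_slope q j + 2 / q%:Q) [*] xslope c k e.

Definition cells (N : nat) : seq (nat * (nat * nat)) :=
  [seq (c, p) | c <- iota 0 3, p <- [seq (k, k') | k <- iota 0 (4 * N).+1,
                                                   k' <- iota 0 (4 * N).+1]].

Definition scan_cell (a : nat * (nat * nat) * bool) : stmt :=
  scan (in_cell (q * q) a.1) (xinv a.1.1 a.2).

Definition sweep_cell (a : nat * (nat * nat) * (nat * bool)) : stmt :=
  let k := if a.2.2 then 1%N else 2%N in
  let k' := if a.2.2 then 2%N else 1%N in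
  sweep (in_cell q a.1) (xcone1 a.2.1 a.1.1 k k') (xcone2 a.2.1 a.1.1 k k')
    (xslope a.1.1 k).

Definition scans := [seq (g, sg) | g <- cells (q * q), sg <- [:: true; false]].
Definition sweeps := [seq (g, p) | g <- cells q,
  p <- [seq (j, o) | j <- iota 0 (2 * q).+1, o <- [:: true; false]]].

Definition main : stmt :=
  Seq star (Seq (seqs (map scan_cell scans)) (seqs (map sweep_cell sweeps))).

Lemma oks_main : oks 17 main.
Proof.
have ok_seqs (T : Type) (st : T -> stmt) l : (forall a, oks 17 (st a)) ->
    oks 17 (seqs (map st l)).
  by move=> h; elim: l => //= a l ih; rewrite h.
rewrite /main /=; apply/andP; split; apply: ok_seqs => a.
  by case: a => [[c [k k']] sg]; rewrite /scan_cell /=.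
by case: a => [[c [k k']] [j []]]; rewrite /sweep_cell /=.
Qed.

Lemma deg_main : (degN main <= 1)%N /\ (degL main <= 1)%N.
Proof.
have deg_seqs (T : Type) (st : T -> stmt) l :
    (forall a, (degN (st a) <= 1)%N /\ (degL (st a) <= 1)%N) ->
    (degN (seqs (map st l)) <= 1)%N /\ (degL (seqs (map st l)) <= 1)%N.
  by move=> h; elim: l => //= a l [h1 h2]; have [h3 h4] := h a; rewrite !geq_max h1 h2 h3 h4.
have [|h1 h2] := deg_seqs _ scan_cell scans.
  by case=> [[c [k k']] sg]; rewrite /scan_cell /=.
have [|h3 h4] := deg_seqs _ sweep_cell sweeps.
  by case=> [[c [k k']] [j []]]; rewrite /sweep_cell /=.
rewrite /main; move: (seqs _) (seqs _) h1 h2 h3 h4 => a b h1 h2 h3 h4.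
by rewrite /= !geq_max h1 h2 h3 h4.
Qed.

Section Evaluation.
Variables (R : realType) (n L : nat) (inp : nat -> R).
Notation cv := (cv inp).
Notation dist2 := (dist2 inp).

Definition slope (c k i : nat) : R := cv i ((c + k) %% 3)%N / cv i c.

Definition cell_mem (N : nat) (g : nat * (nat * nat)) (i : nat) : bool :=
  [&& cv i g.1 != 0, ratr (grid_lo N g.2.1) <= slope g.1 1 i,
    slope g.1 1 i <= ratr (grid_hi N g.2.1), ratr (grid_lo N g.2.2) <= slope g.1 2 i &
    slope g.1 2 i <= ratr (grid_hi N g.2.2)].

Lemma in_cell_filters N g : filters L inp (in_cell N g) (cell_mem N g).
Proof.
move=> e s; rewrite /in_cell /cell_mem /= raddf0 !eqbF_neg -!leNgt andbT.
by [].
Qed.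

Definition inv_key (c : nat) (sg : bool) (i : nat) : R :=
  ratr (if sg then 1 else -1) / cv i c.

Definition star_ok (u : R) := forall i, (i < n)%N -> i != 0%N -> u <= dist2 0 i.
Definition scan_ok (a : nat * (nat * nat) * bool) :=
  scanned n inp (cell_mem (q * q) a.1) (inv_key a.1.1 a.2).
Definition sweep_ok (a : nat * (nat * nat) * (nat * bool)) :=
  let k := if a.2.2 then 1%N else 2%N in
  let k' := if a.2.2 then 2%N else 1%N in
  swept n inp (cell_mem q a.1) (cone_key1 q a.2.1 (slope a.1.1 k) (slope a.1.1 k'))
    (cone_key2 q a.2.1 (slope a.1.1 k) (slope a.1.1 k')) (slope a.1.1 k).

Lemma mainP : (0 < L)%N -> (0 < n)%N -> (n <= 2 ^ L)%N ->
  component n L inp main (fun u => star_ok u /\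
    ((forall a, a \in scans -> scan_ok a u) /\ (forall a, a \in sweeps -> sweep_ok a u))).
Proof.
move=> L0 n0 nL.
apply: component_seq => //.
- by move=> u v uv h i hi hi0; apply: le_trans uv (h i hi hi0).
- exact: starP.
apply: component_seq => //.
- move=> u v uv h a ha b hb ab; have [b' [h1 h2 h3 h4]] := h a ha b hb ab.
  by exists b'; split=> // a' ha' hne; apply: le_trans uv (h4 a' ha' hne).
- apply: (@component_seqs R n L inp L0 nL _ scans scan_cell scan_ok) => // [a u v uv h b hb ab|a].
    have [b' [h1 h2 h3 h4]] := h b hb ab.
    by exists b'; split=> // a' ha' hne; apply: le_trans uv (h4 a' ha' hne).
  by apply: scanP => //; exact: in_cell_filters.
- apply: (@component_seqs R n L inp L0 nL _ sweeps sweep_cell sweep_ok) => // [a u v uv h b b0 hb hb0 ab ab0 p1 p2|a].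
    have [b' [h1 h2 h3 h4 [h5 h6]]] := h b b0 hb hb0 ab ab0 p1 p2.
    by exists b'; split=> //; split=> //; apply: le_trans uv h6.
  apply: sweepP => //; first exact: in_cell_filters.
Qed.

End Evaluation.
End MainProgram.

Lemma ratr_grid_lo (R : realType) N k : ratr (grid_lo N k) = k%:R / N%:R - 2 :> R.
Proof. by rewrite /grid_lo -!pmulrn rmorphB /= fmorph_div /= !ratr_nat. Qed.

Lemma ratr_grid_hi (R : realType) N k : ratr (grid_hi N k) = (k%:R + 2) / N%:R - 2 :> R.
Proof.
by rewrite /grid_hi -!pmulrn rmorphB /= fmorph_div /= rmorphD /= !ratr_nat.
Qed.

Lemma grid_find (R : realType) (N : nat) (s t : R) : (0 < N)%N -> `|s| <= 1 ->
  `|t - s| <= N%:R^-1 -> exists k, [/\ k \in iota 0 (4 * N).+1,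
    ratr (grid_lo N k) <= s <= ratr (grid_hi N k) &
    ratr (grid_lo N k) <= t <= ratr (grid_hi N k)].
Proof.
move=> N0; rewrite !ler_norml => /andP[s1 s2] /andP[t1 t2].
have N0' : 0 < N%:R :> R by rewrite ltr0n.
pose i := N%:R^-1 : R; have i0 : 0 < i by rewrite invr_gt0.
have iN : i * N%:R = 1 by rewrite mulVf // gt_eqF.
have i1 : i <= 1 by rewrite invf_le1 // ler1n.
pose mn := Num.min s t.
have [m1 m2 m3 m4] : [/\ mn <= s, mn <= t, s <= mn + i & t <= mn + i].
  by rewrite /mn; case: (leP s t) => h; split=> //; move: t1 t2 i0 h; rewrite -/i; lra.
have v0 : 0 <= (mn + 2) * N%:R.
  by apply: mulr_ge0 (ltW N0'); move: s1 m3 i1; clear; lra.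
have /andP[k1 k2] := truncn_itv v0; set k := Num.truncn _ in k1 k2.
have {}k1 : k%:R * i <= mn + 2.
  by rewrite /i ler_pdivrMr.
have {}k2 : mn + 2 < (k%:R + 1) * i.
  by rewrite /i ltr_pdivlMr // natr1.
exists k; rewrite ratr_grid_lo ratr_grid_hi -/i; split.
- rewrite mem_iota leq0n add0n ltnS -(ler_nat R) natrM -ler_pdivrMr // -/i.
  by lra.
- by apply/andP; split; lra.
- by apply/andP; split; lra.
Qed.

Lemma box_le4 (R : realType) (v t w : R) : 0 <= v -> v <= 4 -> w <= 1 ->
  v - 2 <= t -> t <= v + 2 * w - 2 -> `|t| <= 4.
Proof. by move=> *; rewrite ler_norml; apply/andP; split; lra. Qed.

Section Candidates.
Variables (R : realType) (n q : nat) (inp : nat -> R) (e1 u : R).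
Notation cv := (cv inp).
Notation dist2 := (dist2 inp).
Notation slope := (slope inp).
Hypothesis n_gt1 : (1 < n)%N.
Hypothesis e1_gt0 : 0 < e1.
Hypothesis e1_le1 : e1 <= 1.
Hypothesis q_large : 84 <= e1 * q%:R.
Hypothesis gap_gt0 : forall i j, (i < n)%N -> (j < n)%N -> i != j ->
  0 < gap2 (cv^~ 0%N) (cv^~ 1%N) (cv^~ 2%N) i j.
Hypothesis u_gt0 : 0 < u.
Hypothesis star_u : star_ok n inp u.
Hypothesis scans_u : forall a, a \in scans q -> scan_ok q n inp a u.
Hypothesis sweeps_u : forall a, a \in sweeps q -> sweep_ok q n inp a u.

Let dl := Num.sqrt u.
Let dl2 : dl ^+ 2 = u. Proof. by rewrite sqr_sqrtr // ltW. Qed.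
Let dl_gt0 : 0 < dl. Proof. by rewrite sqrtr_gt0. Qed.

Let crd c k i := cv i ((c + k) %% 3)%N.

Lemma cross2_cyc c i j : (c < 3)%N -> cross2 (cv^~ c) (crd c 1) (crd c 2) i j =
  cross2 (cv^~ 0%N) (cv^~ 1%N) (cv^~ 2%N) i j.
Proof. by case: c => [|[|[|//]]] _; rewrite /cross2 /crd /=; ring. Qed.

Lemma gap2_cyc c i j : (c < 3)%N -> gap2 (cv^~ c) (crd c 1) (crd c 2) i j =
  gap2 (cv^~ 0%N) (cv^~ 1%N) (cv^~ 2%N) i j.
Proof. by case: c => [|[|[|//]]] _; rewrite /gap2 /crd /=; ring. Qed.

Let plane_c c i j :=
  exists w0 w1 w2, plane (cv^~ c) (crd c 1) (crd c 2) dl 1 i j w0 w1 w2.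

Lemma candidate_plane c i j : (c < 3)%N -> (i < n)%N -> (j < n)%N -> i != j ->
  u <= dist2 i j -> plane_c c i j.
Proof.
move=> hc hi hj hij hu; have g0 := gap_gt0 hi hj hij.
have h : u * gap2 (cv^~ 0%N) (cv^~ 1%N) (cv^~ 2%N) i j <=
    cross2 (cv^~ 0%N) (cv^~ 1%N) (cv^~ 2%N) i j.
  by rewrite -ler_pdivlMr.
apply: plane_exists; rewrite cross2_cyc // ?gap2_cyc // ?dl2 //.
by apply: lt_le_trans h; rewrite mulr_gt0.
Qed.

Lemma plane_cand c i j K : (c < 3)%N -> (i < n)%N -> (j < n)%N -> i != j ->
  (exists w0 w1 w2, plane (cv^~ c) (crd c 1) (crd c 2) dl K i j w0 w1 w2) ->
  u <= K * dist2 i j.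
Proof.
move=> hc hi hj hij [w0 [w1 [w2 /plane_dist]]]; rewrite cross2_cyc // gap2_cyc // dl2.
by move=> h; rewrite /dist2 mulrA ler_pdivlMr //; exact: gap_gt0.
Qed.

Lemma point_plane c i : (c < 3)%N -> (i < n)%N -> plane_c c i i.
Proof.
move=> hc hi; have [-> |i0] := eqVneq i 0%N.
  have [w0 [w1 [w2 [h1 h2 h3]]]] : plane_c c 0 1.
    by apply: candidate_plane; rewrite ?(ltnW n_gt1) //; exact: star_u.
  by exists w0, w1, w2.
have [w0 [w1 [w2 [h1 h2 h3]]]] : plane_c c 0 i.
  by apply: candidate_plane; rewrite ?(ltnW n_gt1) 1?eq_sym //; exact: star_u.
by exists w0, w1, w2.
Qed.

Lemma q_gt : 84 <= q%:R :> R.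
Proof. by apply: le_trans q_large _; rewrite ler_piMl. Qed.

Lemma q_gt0 : (0 < q)%N.
Proof. by rewrite -(ltr0n R); apply: lt_le_trans q_gt. Qed.

Lemma pick_chart i : (i < n)%N -> exists c, [/\ (c < 3)%N, cv i c != 0,
  `|crd c 1 i| <= `|cv i c| & `|crd c 2 i| <= `|cv i c|].
Proof.
move=> hi; have nz c : cv i c = 0 -> (c < 3)%N -> `|crd c 1 i| <= `|cv i c| ->
    `|crd c 2 i| <= `|cv i c| -> False.
  move=> e hc; rewrite e normr0 !normr_le0 => /eqP y0 /eqP z0.
  have [w0 [w1 [w2 [h _ _]]]] := point_plane hc hi.
  by move: h dl_gt0; rewrite e y0 z0 !mulr0 !addr0 => <-; rewrite ltxx.
have mk c : (c < 3)%N -> `|crd c 1 i| <= `|cv i c| -> `|crd c 2 i| <= `|cv i c| ->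
    exists c, [/\ (c < 3)%N, cv i c != 0, `|crd c 1 i| <= `|cv i c| &
      `|crd c 2 i| <= `|cv i c|].
  by move=> hc h1 h2; exists c; split=> //; apply/eqP => e; exact: nz e hc h1 h2.
have [h01|/ltW h01] := lerP `|cv i 1| `|cv i 0|; have [h12|/ltW h12] := lerP `|cv i 2| `|cv i 1|.
- by apply: (mk 0%N) => //; exact: le_trans h01.
- have [h02|/ltW h02] := lerP `|cv i 2| `|cv i 0|; first exact: (mk 0%N).
  by apply: (mk 2%N).
- exact: (mk 1%N).
- by apply: (mk 2%N) => //; exact: le_trans h12.
Qed.

Lemma mem_cells N c k k' : (c < 3)%N -> k \in iota 0 (4 * N).+1 ->
  k' \in iota 0 (4 * N).+1 -> (c, (k, k')) \in cells N.
Proof.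
move=> hc hk hk'; apply/allpairsP; exists (c, (k, k')); split=> //.
  by rewrite mem_iota.
by apply/allpairsP; exists (k, k').
Qed.

Lemma cell_width (N : nat) g i j : (0 < N)%N -> cell_mem inp N g i -> cell_mem inp N g j ->
  `|slope g.1 1 i - slope g.1 1 j| + `|slope g.1 2 i - slope g.1 2 j| <= 4 / N%:R.
Proof.
move=> N0 /and5P[_ a1 a2 a3 a4] /and5P[_ b1 b2 b3 b4].
move: a1 a2 a3 a4 b1 b2 b3 b4; rewrite !ratr_grid_lo !ratr_grid_hi ![(_ + 2) / _]mulrDl.
set i' := N%:R^-1 => a1 a2 a3 a4 b1 b2 b3 b4.
have -> : 4 * i' = 2 * i' + 2 * i' by ring.
by apply: lerD; rewrite ler_norml; apply/andP; split; lra.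
Qed.

Lemma near_pair c a b : (c < 3)%N -> (a < n)%N -> (b < n)%N -> a != b ->
  cv a c != 0 -> cv b c != 0 -> `|slope c 1 b| <= 1 -> `|slope c 2 b| <= 1 ->
  `|slope c 1 a - slope c 1 b| <= q%:R^-1 -> `|slope c 2 a - slope c 2 b| <= q%:R^-1 ->
  u <= (1 + e1) ^+ 4 * dist2 a b.
Proof.
move=> hc ha hb hab xa xb p1b p2b d1 d2.
have [k1 [k1m /andP[lo1b hi1b] /andP[lo1a hi1a]]] := grid_find q_gt0 p1b d1.
have [k2 [k2m /andP[lo2b hi2b] /andP[lo2a hi2a]]] := grid_find q_gt0 p2b d2.
pose g := (c, (k1, k2)); have gm : g \in cells q by exact: mem_cells.
pose av := cell_mem inp q g.
have ava : av a by apply/and5P.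
have avb : av b by apply/and5P.
have q0 : 0 < q%:R :> R by rewrite ltr0n q_gt0.
have [i' i'E] : exists i', i' = q%:R^-1 :> R by exists q%:R^-1.
have i'0 : 0 < i' by rewrite i'E invr_gt0.
have iq : i' * q%:R = 1 by rewrite i'E mulVf // gt_eqF.
have i'1 : 84 * i' <= e1.
  by have := ler_wpM2r (ltW i'0) q_large; rewrite -mulrA [q%:R * _]mulrC iq mulr1.
have i'le1 : i' <= 1.
  by apply: le_trans e1_le1; apply: le_trans i'1; rewrite ler_peMl ?ler1n // ltW.
pose tau := 12 * i'.
have bound4 k : k \in iota 0 (4 * q).+1 -> k%:R * i' <= 4.
  rewrite mem_iota leq0n add0n ltnS -(ler_nat R) natrM => h.
  by have := ler_wpM2r (ltW i'0) h; rewrite -mulrA [q%:R * _]mulrC iq mulr1.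
have edges o j : (j <= 2 * q)%N -> forall a b, (a < n)%N -> (b < n)%N -> av a -> av b ->
    let k := if o then 1%N else 2%N in let k' := if o then 2%N else 1%N in
    prec (cone_key1 q j (slope c k) (slope c k')) b a ->
    prec (cone_key2 q j (slope c k) (slope c k')) b a ->
    exists b', [/\ (b' < n)%N, av b', prec (cone_key1 q j (slope c k) (slope c k')) b' a,
      prec (cone_key2 q j (slope c k) (slope c k')) b' a &
      slope c k b' <= slope c k b /\ (a != b' /\ plane_c c a b')].
  move=> hj a' b' ha' hb' aa ab k k' h1 h2.
  have hm : (g, (j, o)) \in sweeps q.
    apply/allpairsP; exists (g, (j, o)); split=> //.
    apply/allpairsP; exists (j, o); split=> //; first by rewrite mem_iota leq0n add0n ltnS.
    by case: o {k k' h1 h2}.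
  have [b0 [h3 h4 h5 h6 [h7 h8]]] := sweeps_u hm ha' hb' aa ab h1 h2.
  exists b0; split=> //; split=> //.
  have hne : a' != b0 by apply: contraTneq h5 => ->; rewrite prec_irr.
  by split=> //; apply: candidate_plane.
have [||||||||w0 [w1 [w2 hpl]]] := @local_bound R (cv^~ c) (crd c 1) (crd c 2) dl n av
    dl_gt0 _ q e1 tau e1_gt0 e1_le1 _ _ _ _ _ _ _ (edges true) (edges false)
    a b ha hb ava avb hab.
- by move=> i _ /and5P[].
- by apply: le_trans q_large; rewrite ler_nat.
- by rewrite mulr_ge0 // ltW.
- by apply: le_trans e1_le1; apply: le_trans i'1; rewrite /tau ler_pM2r // ler_nat.
- move=> i hi /and5P[_]; rewrite !ratr_grid_lo !ratr_grid_hi ![(_ + 2) / _]mulrDl -i'E => h1 h2 h3 h4.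
  have hk1 := bound4 _ k1m; have hk2 := bound4 _ k2m.
  have hk10 : 0 <= k1%:R * i' by rewrite mulr_ge0 // ltW.
  have hk20 : 0 <= k2%:R * i' by rewrite mulr_ge0 // ltW.
  by split; [exact: box_le4 hk10 hk1 i'le1 h1 h2|exact: box_le4 hk20 hk2 i'le1 h3 h4].
- move=> i j hi hj ai aj; have := cell_width q_gt0 ai aj.
  by rewrite /slope /tau /crd /= -i'E; lra.
- by move=> i j hi hj hij; rewrite gap2_cyc //; exact: gap_gt0.
- by move=> i hi; exact: point_plane.
have hu : u <= (1 + e1) ^+ 2 * (1 + 7 * tau) * dist2 a b.
  by apply: (plane_cand hc ha hb hab); exists w0, w1, w2.
apply: le_trans hu _; apply: ler_wpM2r.
  by apply: divr_ge0; [exact: sumsq_ge0|exact: ltW (gap_gt0 ha hb hab)].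
have -> : (1 + e1) ^+ 4 = (1 + e1) ^+ 2 * (1 + e1) ^+ 2 by ring.
apply: ler_wpM2l; first exact: sqr_ge0.
by have := sqr_ge0 e1; rewrite /tau; move: i'1 e1_gt0; nra.
Qed.

Lemma far_pair c a b : (c < 3)%N -> (a < n)%N -> (b < n)%N -> a != b ->
  cv b c != 0 -> `|slope c 1 b| <= 1 -> `|slope c 2 b| <= 1 ->
  ~ [/\ cv a c != 0, `|slope c 1 a - slope c 1 b| <= q%:R^-1 &
       `|slope c 2 a - slope c 2 b| <= q%:R^-1] ->
  u <= (1 + e1) ^+ 4 * dist2 a b.
Proof.
move=> hc ha hb hab xb p1b p2b hfar.
have q0 : 0 < q%:R :> R by rewrite ltr0n q_gt0.
have qn0 : q%:R != 0 :> R by rewrite gt_eqF.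
have qq0 : (0 < q * q)%N by rewrite muln_gt0 q_gt0.
have iqq : 0 <= (q * q)%:R^-1 :> R by rewrite invr_ge0.
have [|k1 [k1m /andP[lo1 hi1] _]] := grid_find (t := slope c 1 b) qq0 p1b.
  by rewrite subrr normr0.
have [|k2 [k2m /andP[lo2 hi2] _]] := grid_find (t := slope c 2 b) qq0 p2b.
  by rewrite subrr normr0.
pose g := (c, (k1, k2)); have gm : g \in cells (q * q) by exact: mem_cells.
pose av := cell_mem inp (q * q) g.
have avb : av b by apply/and5P.
have scan_m sg : (g, sg) \in scans q.
  by apply/allpairsP; exists (g, sg); split=> //; case: sg.
have [b1 [hb1 avb1 key1 cand1]] := scans_u (scan_m true) hb avb.
have [b2 [hb2 avb2 key2 cand2]] := scans_u (scan_m false) hb avb.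
have {}key1 : (cv b1 c)^-1 <= (cv b c)^-1.
  by move: key1; rewrite /inv_key /= rmorph1 !mul1r.
have {}key2 : (cv b c)^-1 <= (cv b2 c)^-1.
  by move: key2; rewrite /inv_key /= rmorphN rmorph1 !mulN1r lerN2.
have not_in b' : av b' -> a != b'.
  move=> ab'; apply/eqP => e; apply: hfar.
  have := cell_width qq0 ab' avb; rewrite -e /= => h.
  have hq : 4 / (q * q)%:R <= q%:R^-1 :> R.
    rewrite natrM invfM mulrA ler_piMl ?invr_ge0 // ler_pdivrMr // mul1r.
    by apply: le_trans q_gt; rewrite ler_nat.
  split; first by rewrite e; case/and5P: ab'.
    by apply: le_trans hq; apply: le_trans h; rewrite lerDl.
  by apply: le_trans hq; apply: le_trans h; rewrite lerDr.
have pl1 : plane_c c a b1.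
  by apply: candidate_plane (not_in _ avb1) (cand1 _ ha (not_in _ avb1)).
have pl2 : plane_c c a b2.
  by apply: candidate_plane (not_in _ avb2) (cand2 _ ha (not_in _ avb2)).
pose P := slope c 1 b; pose Q := slope c 2 b.
have hratio : (cv a c) ^+ 2 + (crd c 1 a) ^+ 2 + (crd c 2 a) ^+ 2 <= (3 * q%:R) ^+ 2 *
   ((crd c 1 a * Q - crd c 2 a * P) ^+ 2 + (crd c 2 a - cv a c * Q) ^+ 2
    + (cv a c * P - crd c 1 a) ^+ 2).
  apply: far_ratio => //; first by apply: le_trans q_gt; rewrite ler1n.
  case=> h1 h2; apply: hfar; have [xa|xa] := eqVneq (cv a c) 0; last first.
    have nx : 0 < `|cv a c| by rewrite normr_gt0.
    have key k (v : R) : crd c k a - cv a c * v = (slope c k a - v) * cv a c.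
      by rewrite /crd /slope; field.
    have cl k v : q%:R * `|crd c k a - cv a c * v| <= `|cv a c| ->
        `|slope c k a - v| <= q%:R^-1.
      rewrite key normrM mulrA -[leRHS]mul1r ler_pM2r // => h.
      by rewrite -(ler_pM2l q0) divff.
    by split; [|exact: cl h1|exact: cl h2].
  move: h1 h2; rewrite xa !mul0r !subr0 normr0 !pmulr_rle0 // !normr_le0.
  move=> /eqP y0 /eqP z0; have [w0 [w1 [w2 [h _ _]]]] := point_plane hc ha.
  by move: h dl_gt0; rewrite xa y0 z0 !mulr0 !addr0 => <-; rewrite ltxx.
have xb2 : 0 < cv b c ^+ 2 by rewrite lt_neqAle sqr_ge0 eq_sym sqrf_eq0 xb.
have crossE : cross2 (cv^~ c) (crd c 1) (crd c 2) a b =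
   ((crd c 1 a * Q - crd c 2 a * P) ^+ 2 + (crd c 2 a - cv a c * Q) ^+ 2
    + (cv a c * P - crd c 1 a) ^+ 2) * cv b c ^+ 2.
  have yb : crd c 1 b = P * cv b c by rewrite /P /slope divfK.
  have zb : crd c 2 b = Q * cv b c by rewrite /Q /slope divfK.
  by rewrite /cross2 yb zb; ring.
have hA : ((cv a c) ^+ 2 + (crd c 1 a) ^+ 2 + (crd c 2 a) ^+ 2) * cv b c ^+ 2 <=
    (3 * q%:R) ^+ 2 * cross2 (cv^~ c) (crd c 1) (crd c 2) a b.
  by rewrite crossE mulrA ler_pM2r.
have A0 : 0 < (cv a c) ^+ 2 + (crd c 1 a) ^+ 2 + (crd c 2 a) ^+ 2.
  rewrite lt_neqAle sumsq_ge0 andbT eq_sym; apply/eqP => A0.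
  have [w0 [w1 [w2 [h _ _]]]] := point_plane hc ha.
  have := cauchy3_sqr w0 w1 w2 (cv a c) (crd c 1 a) (crd c 2 a).
  by rewrite A0 mulr0 h dl2 leNgt u_gt0.
have cr0 : 0 < cross2 (cv^~ c) (crd c 1) (crd c 2) a b.
  have : 0 < (3 * q%:R) ^+ 2 * cross2 (cv^~ c) (crd c 1) (crd c 2) a b.
    by apply: lt_le_trans hA; exact: mulr_gt0.
  by rewrite pmulr_rgt0 // exprn_gt0 // mulr_gt0.
have [|||||w0 [w1 [w2 hpl]]] := @far_bound R (cv^~ c) (crd c 1) (crd c 2) dl n av dl_gt0 _
  (4 / (q * q)%:R) (3 * q%:R) a b b1 b2 _ _ hb hb1 hb2 avb avb1 avb2 key1 key2 _ _
  pl1 pl2 cr0 hA.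
- by move=> i _ /and5P[].
- by rewrite divr_ge0.
- by rewrite mulr_ge0.
- exact: (cell_width qq0 avb avb1).
- exact: (cell_width qq0 avb avb2).
have hu : u <= (1 + 4 / (q * q)%:R * (3 * q%:R)) ^+ 2 * dist2 a b.
  by apply: (plane_cand hc ha hb hab); exists w0, w1, w2.
apply: le_trans hu _; apply: ler_wpM2r.
  by apply: divr_ge0; [exact: sumsq_ge0|exact: ltW (gap_gt0 ha hb hab)].
have hq : 4 / (q * q)%:R * (3 * q%:R) <= e1.
  have -> : 4 / (q * q)%:R * (3 * q%:R) = 12 / q%:R :> R by rewrite natrM; field.
  by rewrite ler_pdivrMr //; apply: le_trans q_large; rewrite ler_nat.
have hq0 : 0 <= 4 / (q * q)%:R * (3 * q%:R) :> R by rewrite mulr_ge0 ?divr_ge0 ?mulr_ge0.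
have h1 : 1 <= 1 + e1 by rewrite lerDl ltW.
apply: (@le_trans _ _ ((1 + e1) ^+ 2)); last by rewrite ler_weXn2l.
by rewrite ler_pXn2r ?nnegrE ?addr_ge0 ?lerD2l // ltW.
Qed.

Lemma candidates_suffice a b : (a < n)%N -> (b < n)%N -> a != b ->
  u <= (1 + e1) ^+ 4 * dist2 a b.
Proof.
move=> ha hb hab; have [c [hc xb y1 z1]] := pick_chart hb.
have nx : 0 < `|cv b c| by rewrite normr_gt0.
have p1 : `|slope c 1 b| <= 1 by rewrite /slope normrM normfV ler_pdivrMr // mul1r.
have p2 : `|slope c 2 b| <= 1 by rewrite /slope normrM normfV ler_pdivrMr // mul1r.
have [/and3P[xa d1 d2]|/negP hfar] := boolP [&& cv a c != 0,
  `|slope c 1 a - slope c 1 b| <= q%:R^-1 & `|slope c 2 a - slope c 2 b| <= q%:R^-1].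
  exact: near_pair d1 d2.
by apply: (far_pair hc) => //; move=> [h1 h2 h3]; apply: hfar; apply/and3P.
Qed.

End Candidates.

(** * Distances to lines *)

Section LineDist.
Variable R : realType.
Implicit Types (y a b v : 'rV[R]_3).

Definition rel_coord (S : seq 'rV[R]_3) y (i c : nat) : R :=
  (nth 0 S i - y) 0 (inord c).

Lemma eucl_norm3 v :
  eucl_norm v = norm3 (v 0 (inord 0)) (v 0 (inord 1)) (v 0 (inord 2)).
Proof.
rewrite /eucl_norm /norm3 !big_ord_recl big_ord0 addr0 addrA.
by congr (Num.sqrt (v 0 _ ^+ 2 + v 0 _ ^+ 2 + v 0 _ ^+ 2)); apply: val_inj;
  rewrite /= inordK.
Qed.

Lemma line_distE y S i j : (i < size S)%N -> (j < size S)%N ->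
  let x0 := ((rel_coord S y)^~ 0%N) in let x1 := ((rel_coord S y)^~ 1%N) in
  let x2 := ((rel_coord S y)^~ 2%N) in
  0 < gap2 x0 x1 x2 i j ->
  line_dist y (nth 0 S i) (nth 0 S j) = Num.sqrt (cross2 x0 x1 x2 i j / gap2 x0 x1 x2 i j).
Proof.
move=> hi hj x0 x1 x2 G0; set a := nth 0 S i; set b := nth 0 S j.
set C := cross2 _ _ _ _ _; set G := gap2 _ _ _ _ _ in G0 *.
have G0' : G != 0 by rewrite gt_eqF.
have C0 : 0 <= C by exact: sumsq_ge0.
pose nrm t := norm3 (x0 i + t * (x0 j - x0 i)) (x1 i + t * (x1 j - x1 i))
  (x2 i + t * (x2 j - x2 i)).
have distE t : eucl_norm (y - (a + t *: (b - a))) = nrm t.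
  rewrite eucl_norm3 /nrm /x0 /x1 /x2 /rel_coord -/a -/b !mxE.
  by rewrite /norm3; congr Num.sqrt; ring.
have sqE t : nrm t ^+ 2 * G - C =
   ((x0 i + t * (x0 j - x0 i)) * (x0 j - x0 i) + (x1 i + t * (x1 j - x1 i)) * (x1 j - x1 i)
    + (x2 i + t * (x2 j - x2 i)) * (x2 j - x2 i)) ^+ 2.
  by rewrite /nrm sqr_norm3 /C /G /cross2 /gap2; ring.
have lb t : Num.sqrt (C / G) <= nrm t.
  apply: ler_of_sqr; first exact: norm3_ge0.
  rewrite sqr_sqrtr; last by rewrite divr_ge0 // ltW.
  by rewrite ler_pdivrMr // -subr_ge0 sqE sqr_ge0.
pose t := - (x0 i * (x0 j - x0 i) + x1 i * (x1 j - x1 i) + x2 i * (x2 j - x2 i)) / G.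
have att : nrm t = Num.sqrt (C / G).
  have h : nrm t ^+ 2 * G - C = 0.
    rewrite sqE; apply/eqP; rewrite sqrf_eq0; apply/eqP.
    have -> : (x0 i + t * (x0 j - x0 i)) * (x0 j - x0 i) +
      (x1 i + t * (x1 j - x1 i)) * (x1 j - x1 i) +
      (x2 i + t * (x2 j - x2 i)) * (x2 j - x2 i) =
      (x0 i * (x0 j - x0 i) + x1 i * (x1 j - x1 i) + x2 i * (x2 j - x2 i)) + t * G.
      by rewrite /G /gap2; ring.
    by rewrite /t divfK // subrr.
  have -> : C / G = nrm t ^+ 2.
    by rewrite (_ : C = nrm t ^+ 2 * G) ?mulfK //; apply/esym/eqP; rewrite -subr_eq0 h.
  by rewrite sqrtr_sqr ger0_norm // norm3_ge0.
rewrite /line_dist; apply/eqP; rewrite eq_le; apply/andP; split.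
  apply: ge_inf.
    by exists (Num.sqrt (C / G)) => _ [_ [s _ <-] <-]; rewrite distE.
  by exists (a + t *: (b - a)); [exists t|rewrite distE att].
apply: lb_le_inf; first by exists (nrm t), (a + t *: (b - a)); [exists t|rewrite distE].
by move=> _ [_ [s _ <-] <-]; rewrite distE.
Qed.

Lemma gap2_gt0 y S i j : uniq S -> (i < size S)%N -> (j < size S)%N -> i != j ->
  0 < gap2 ((rel_coord S y)^~ 0%N) ((rel_coord S y)^~ 1%N) ((rel_coord S y)^~ 2%N) i j.
Proof.
move=> uS hi hj hij; rewrite lt_neqAle sumsq_ge0 andbT eq_sym; apply/negP => /eqP g0.
have /negP : nth 0 S i != nth 0 S j by rewrite nth_uniq.
apply; apply/eqP/rowP => c.
have eqc k : (k < 3)%N -> rel_coord S y i k = rel_coord S y j k.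
  move: g0; rewrite /gap2; set s0 := _ - _; set s1 := _ - _; set s2 := _ - _ => g0.
  have h0 := sqr_ge0 s0; have h1 := sqr_ge0 s1; have h2 := sqr_ge0 s2.
  case: k => [|[|[|//]]] _; apply/eqP; rewrite -subr_eq0 -sqrf_eq0; apply/eqP.
  - by rewrite -/s0; lra.
  - by rewrite -/s1; lra.
  - by rewrite -/s2; lra.
have := eqc c (ltn_ord c); rewrite /rel_coord !mxE => /addIr.
by have -> : inord c = c by apply: val_inj; rewrite /= inordK.
Qed.

Lemma cv_input y S i c : (i < size S)%N -> (c < 3)%N ->
  cv (reals (input y S)) i c = rel_coord S y i c.
Proof.
move=> hi hc; rewrite /cv /rel_coord /input /= !mxE.
have -> : ((3 * (i + 1) + c) %/ 3 = i.+1)%N by lia.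
have -> : ((3 * (i + 1) + c) %% 3 = c)%N by lia.
have -> : ((3 * 0 + c) %/ 3 = 0)%N by lia.
by have -> : ((3 * 0 + c) %% 3 = c)%N by lia.
Qed.

End LineDist.

Lemma up_log_le_ln (R : realType) n : (1 < n)%N ->
  (up_log 2 n)%:R <= 2 / ln 2 ^+ 3 * ln n%:R ^+ 3 :> R.
Proof.
move=> n1; set L := up_log 2 n; have L0 : (0 < L)%N by rewrite up_log_gt0.
have l2 : 0 < ln 2 :> R by apply: ln_gt0; rewrite ltr1n.
have ln2n : ln 2 <= ln n%:R :> R.
  by rewrite ler_ln ?posrE ?ltr0n ?ler_nat // ltnW.
have hL : L.-1%:R * ln 2 <= ln n%:R :> R.
  rewrite mulr_natl -lnXn // -natrX ler_ln ?posrE ?ltr0n ?expn_gt0 ?(ltnW n1) //.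
  by rewrite ler_nat ltnW // up_log_gtn.
have hLn : L%:R * ln 2 <= 2 * ln n%:R :> R.
  have -> : 2 * ln n%:R = ln n%:R + ln n%:R :> R by ring.
  by rewrite -(prednK L0) -natr1 mulrDl mul1r; exact: lerD.
rewrite mulrAC ler_pdivlMr ?exprn_gt0 //.
have -> : L%:R * ln 2 ^+ 3 = (L%:R * ln 2) * ln 2 ^+ 2 :> R by ring.
have -> : 2 * ln n%:R ^+ 3 = (2 * ln n%:R) * ln n%:R ^+ 2 :> R by ring.
apply: ler_pM => //; [by rewrite mulr_ge0 // ltW|exact: sqr_ge0|].
by rewrite ler_pXn2r ?nnegrE // ltW // (lt_le_trans l2).
Qed.

Theorem theorem1 (R : realType) (eps : R) (eps_gt0 : 0 < eps) :
  exists (P : program) (kappa : nat),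
    (forall (y : 'rV[R]_3) (S : seq 'rV[R]_3), uniq S -> (1 < size S)%N ->
       prob_halts_with P kappa y S (approx_nearest_line eps y S) t
         @[t --> \oo] --> (1 : R)) /\
    (forall c : nat, exists C : R,
       forall (y : 'rV[R]_3) (S : seq 'rV[R]_3), uniq S -> (1 < size S)%N ->
         let n : R := (size S)%:R in
         1 - n ^- c <= prob_halts_with P kappa y S (fun=> True)
                         (Num.truncn (C * (n * ln n ^+ 3)))).
Proof.
pose e1 := Num.min 1 (eps / 3).
have e1_gt0 : 0 < e1 by rewrite lt_min ltr01 divr_gt0.
have e1_le1 : e1 <= 1 by rewrite ge_min lexx.
have e1_eps : (1 + e1) ^+ 2 <= 1 + eps.
  have : e1 <= eps / 3 by rewrite ge_min lexx orbT.
  have : e1 * e1 <= e1 by rewrite ler_piMl // ltW.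
  by rewrite sqrrD expr1n mul1r mulr2n expr2; lra.
pose q := (Num.truncn (84 / e1)).+1.
have q_large : 84 <= e1 * q%:R.
  have v0 : 0 <= 84 / e1 by rewrite divr_ge0 // ltW.
  have /andP[_ /ltW] := truncn_itv v0.
  by rewrite ler_pdivrMr // mulrC.
have [dN dL] := deg_main q.
have [C0 hC0] := whole_ok (isT : (1 < 17)%N) (oks_main q) dN dL R.
exists (whole 17 (main q)), (whole_kappa 17 (main q)).
have run (y : 'rV[R]_3) (S : seq 'rV[R]_3) : uniq S -> (1 < size S)%N ->
    exists m t, [/\ halts (word_length (whole_kappa 17 (main q)) (size S))
       (whole 17 (main q)) (input y S) m t,
      (t <= C0 * (size S * up_log 2 (size S)))%N & approx_nearest_line eps y S m].
  move=> uS n1; set inp := reals (input y S).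
  have L0 : (0 < up_log 2 (size S))%N by rewrite up_log_gt0.
  have nP : (size S <= 2 ^ up_log 2 (size S))%N by exact: up_logP.
  have bs0 : bounded (up_log 2 (size S)) store0.
    move=> k i; rewrite /store0; apply: (@leq_ltn_trans 1); first by case: ifP.
    by rewrite -expnM -{1}(expn0 2) ltn_exp2l //; lia.
  have v0 : valid (size S) store0 by split=> //; exact: ltnW.
  have z0 : zeroM (up_log 2 (size S)) (store0 7%N) by [].
  have [hsafe [[va vb vab] _ _ [hstar [hscan hsweep]]]] :=
    mainP q inp L0 (ltnW n1) nP bs0 v0 z0.
  have [m [t [hh ht w0 w1]]] := hC0 y S n1 hsafe.
  exists m, t; split=> //.
  set s := den _ _ _ _ _ in va vb vab hstar hscan hsweep w0 w1.
  rewrite -w0 -w1 in va vb vab.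
  have bestE : best inp s = dist2 inp (words m 0) (words m 1) by rewrite /best -w0 -w1.
  rewrite bestE in hstar hscan hsweep; set u := dist2 inp _ _ in bestE hstar hscan hsweep.
  have crossE i j : (i < size S)%N -> (j < size S)%N ->
      cross2 ((cv inp)^~ 0%N) ((cv inp)^~ 1%N) ((cv inp)^~ 2%N) i j =
      cross2 ((rel_coord S y)^~ 0%N) ((rel_coord S y)^~ 1%N) ((rel_coord S y)^~ 2%N) i j.
    by move=> hi hj; rewrite /cross2 !cv_input.
  have gapE i j : (i < size S)%N -> (j < size S)%N ->
      gap2 ((cv inp)^~ 0%N) ((cv inp)^~ 1%N) ((cv inp)^~ 2%N) i j =
      gap2 ((rel_coord S y)^~ 0%N) ((rel_coord S y)^~ 1%N) ((rel_coord S y)^~ 2%N) i j.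
    by move=> hi hj; rewrite /gap2 !cv_input.
  have gap_gt0 i j : (i < size S)%N -> (j < size S)%N -> i != j ->
      0 < gap2 ((cv inp)^~ 0%N) ((cv inp)^~ 1%N) ((cv inp)^~ 2%N) i j.
    by move=> hi hj hij; rewrite gapE //; exact: gap2_gt0.
  have lineE i j : (i < size S)%N -> (j < size S)%N -> i != j ->
      line_dist y (nth 0 S i) (nth 0 S j) = Num.sqrt (dist2 inp i j).
    move=> hi hj hij; rewrite line_distE //; last exact: gap2_gt0.
    by rewrite -crossE // -gapE.
  have d2_ge0 i j : (i < size S)%N -> (j < size S)%N -> 0 <= dist2 inp i j.
    by move=> hi hj; apply: divr_ge0; exact: sumsq_ge0.
  have u_le i j : (i < size S)%N -> (j < size S)%N -> i != j ->
      u <= (1 + e1) ^+ 4 * dist2 inp i j.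
    move=> hi hj hij; have [u0|u0] := lerP u 0.
      apply: le_trans u0 _; apply: mulr_ge0; last exact: d2_ge0.
      by rewrite exprn_ge0 // addr_ge0 // ltW.
    exact: (candidates_suffice n1 e1_gt0 e1_le1 q_large gap_gt0 u0 hstar hscan hsweep).
  split=> //; first by rewrite nth_uniq.
  rewrite lineE //.
  have eps1 : 0 < 1 + eps by rewrite addr_gt0.
  rewrite -ler_pdivrMl // mulrC.
  apply: lb_le_inf.
    exists (line_dist y (nth 0 S (words m 0)) (nth 0 S (words m 1))).
    exists (nth 0 S (words m 0)), (nth 0 S (words m 1)).
    by split; rewrite ?mem_nth ?nth_uniq.
  move=> _ [a [b [aS bS ab ->]]].
  have hi : (index a S < size S)%N by rewrite index_mem.
  have hj : (index b S < size S)%N by rewrite index_mem.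
  have hij : index a S != index b S.
    by apply: contraNneq ab => e; rewrite -(nth_index 0 aS) e nth_index.
  rewrite -(nth_index 0 aS) -(nth_index 0 bS) lineE // ler_pdivrMr //.
  apply: ler_of_sqr; first by rewrite mulr_ge0 ?sqrtr_ge0 // ltW.
  rewrite exprMn !sqr_sqrtr ?d2_ge0 // mulrC.
  apply: le_trans (u_le _ _ hi hj hij) _; apply: ler_wpM2r; first exact: d2_ge0.
  have -> : (1 + e1) ^+ 4 = ((1 + e1) ^+ 2) ^+ 2 by ring.
  by rewrite ler_pXn2r ?nnegrE ?sqr_ge0 // ltW.
split=> [y S uS n1|c].
  have [m [t0 [hh _ hQ]]] := run y S uS n1.
  apply: cvg_near_cst; near=> t.
  rewrite /prob_halts_with (halts_le _ hh); last by near: t; exact: nbhs_infty_ge.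
  by rewrite asboolT.
exists (C0%:R * (2 / ln 2 ^+ 3)) => y S uS n1.
lazy zeta; set n : R := (size S)%:R.
have [m [t [hh ht _]]] := run y S uS n1.
rewrite /prob_halts_with (halts_le _ hh) ?asboolT //.
  by rewrite gerBl invr_ge0 exprn_ge0.
apply: leq_trans ht _.
have l2 : 0 < ln 2 :> R by apply: ln_gt0; rewrite ltr1n.
have hn : (C0 * (size S * up_log 2 (size S)))%:R <=
    C0%:R * (2 / ln 2 ^+ 3) * (n * ln n ^+ 3).
  rewrite !natrM -mulrA; apply: ler_wpM2l => //.
  rewrite mulrCA; apply: ler_wpM2l => //; exact: up_log_le_ln.
by rewrite truncn_ge_nat //; exact: le_trans hn.
Unshelve. all: by end_near.
Qed.
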